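(* Let $0\le\beta<1$ and let $U\subset\mathbb R^d$ be an open cone. The space $S^\beta(U)$ is Hausdorff and complete. A set $\mathcal B\subset S^\beta(U)$ is bounded if and only if it is contained in some space $S^{\beta,b}(U)$, $b>0$, and is bounded in each of the norms of that space.
   Context: Put $p=1/(1-\beta)$. A cone in $\mathbb R^d$ is a nonempty set invariant under multiplication by positive numbers. $|\cdot|$ is a fixed norm on $\mathbb R^d$ and $d(x,U)=\inf_{\xi\in U}|x-\xi|$. For an open cone $U\subset\mathbb R^d$, $B>0$ and $N=0,1,2,\dots$, let $H^{\beta,B}_N(U)$ be the Hilbert space of entire functions on $\mathbb C^d$ with finite norm for the inner product $$\langle f,g\rangle_{U,B,N}=\int_{\mathbb C^d}\overline{f(z)}\,g(z)\prod_{j=1}^d(1+|x_j|)^{2N}\exp\{-2d(Bx,U)^{p}-2|By|^{p}\}\,d\lambda,\qquad z=x+iy,$$ where $d\lambda=dx\,dy$ is Lebesgue measure. For $b>0$, $S^{\beta,b}(U)=\bigcap_{B>b,\,N\ge0}H^{\beta,B}_N(U)$ with the projective limit topology, i.e. the Fréchet topology defined by the norms $\|f\|_{U,B,N}=\langle f,f\rangle_{U,B,N}^{1/2}$, $B>b$, $N\ge 0$. $S^\beta(U)=\bigcup_{b>0}S^{\beta,b}(U)$ with the locally convex inductive limit topology (it does not depend on the choice of norm $|\cdot|$). *)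

(* Defs.v *)
From HB Require Import structures.
From mathcomp Require Import all_boot all_order all_algebra.
From mathcomp Require Import complex.
From mathcomp Require Import all_classical all_reals all_analysis.
From mathcomp Require Import measurable_realfun ring.
Set Implicit Arguments.
Unset Strict Implicit.
Unset Printing Implicit Defensive.
Import Order.TTheory GRing.Theory Num.Theory.
Import numFieldNormedType.Exports.
Local Open Scope classical_set_scope.
Local Open Scope ring_scope.

(* Restated because the canonical sigma-finite structure on [_ \x _] is only
   found when both factors are subprobabilities. *)
Lemma sigma_finite_prod d1 d2 (T1 : measurableType d1) (T2 : measurableType d2)
    (R : realType) (m1 : {sigma_finite_measure set T1 -> \bar R})
    (m2 : {sigma_finite_measure set T2 -> \bar R}) :
  sigma_finite setT (m1 \x m2)%E.
Proof.
have /sigma_finiteP[F [TF ndF Foo]] := sigma_finiteT m1.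
have /sigma_finiteP[G [TG ndG Goo]] := sigma_finiteT m2.
exists (fun n => F n `*` G n).
  rewrite -setXTT TF TG predeqE => -[x y]; split.
    move=> [/= [n _ Fnx] [k _ Gky]]; exists (maxn n k) => //; split.
    - by move: x Fnx; exact/subsetPset/ndF/leq_maxl.
    - by move: y Gky; exact/subsetPset/ndG/leq_maxr.
  by move=> [n _ []/= ? ?]; split; exists n.
move=> k; have [? ?] := Foo k; have [? ?] := Goo k.
split; first exact: measurableX.
by rewrite product_measure1E// lte_mul_pinfty// ge0_fin_numE.
Qed.

Section lebesgue_tuple.
Context {R : realType}.
Local Notation RT := (measurableTypeR R).

Definition cons_pair n (p : RT * n.-tuple RT) : n.+1.-tuple RT :=
  [tuple of p.1 :: p.2].

Lemma measurable_cons_pair n : measurable_fun setT (@cons_pair n).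
Proof. exact: measurable_cons. Qed.

Definition lebesgue_cons n (mu : {sigma_finite_measure set (n.-tuple RT) -> \bar R})
  : set (n.+1.-tuple RT) -> \bar R :=
  pushforward (@lebesgue_measure R \x mu)%E (@cons_pair n).

Section instances.
Context n (mu : {sigma_finite_measure set (n.-tuple RT) -> \bar R}).
Local Notation nu := (lebesgue_cons mu).

Let m0 : nu set0 = 0%E. 
Proof. by rewrite /lebesgue_cons /pushforward preimage_set0 measure0. Qed.
Let m_ge0 A : (0 <= nu A)%E.
Proof. by apply: integral_ge0 => x _; exact: measure_ge0. Qed.
Let m_sa : semi_sigma_additive nu.
Proof.
move=> F mF tF mUF; rewrite /nu /lebesgue_cons /pushforward preimage_bigcup.
apply: measure_semi_sigma_additive.
- by move=> k; rewrite -[X in measurable X]setTI; exact: measurable_cons_pair.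
- apply/trivIsetP => /= i j _ _ ij; rewrite -preimage_setI.
  by move/trivIsetP : tF => /(_ _ _ _ _ ij) ->//; rewrite preimage_set0.
- by rewrite -preimage_bigcup -[X in measurable X]setTI; exact: measurable_cons_pair.
Qed.
HB.instance Definition _ := isMeasure.Build _ _ _ nu m0 m_ge0 m_sa.

Let uncons (t : n.+1.-tuple RT) : RT * n.-tuple RT := (thead t, [tuple of behead t]).
Let m_uncons : measurable_fun setT uncons.
Proof.
apply/measurable_fun_pair; first exact: measurable_tnth.
exact: measurable_behead.
Qed.

Let sf : sigma_finite setT nu.
Proof.
have [F TF Foo] := sigma_finite_prod (@lebesgue_measure R) mu.
exists (fun k => uncons @^-1` F k).
  by rewrite -preimage_bigcup -TF preimage_setT.
move=> k; have [mF Fy] := Foo k; split.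
  by rewrite -[X in measurable X]setTI; exact: m_uncons.
rewrite /nu /lebesgue_cons /pushforward -comp_preimage.
rewrite (_ : uncons \o _ = id) ?preimage_id//.
apply/funext => -[x t]; rewrite /uncons/= /cons_pair/=; congr pair.
exact/val_inj.
Qed.
HB.instance Definition _ := Measure_isSigmaFinite.Build _ _ _ nu sf.
End instances.

(* Lebesgue measure on R^n, as the n-fold product of Lebesgue measure on R. *)
Fixpoint lebesgue_tuple n : {sigma_finite_measure set (n.-tuple RT) -> \bar R} :=
  if n is n'.+1 then lebesgue_cons (lebesgue_tuple n')
  else \d_([tuple] : 0.-tuple RT).

End lebesgue_tuple.

Section norm.
Context (R : realType) (d : nat).

(* An arbitrary norm on R^d; the topology of ['rV[R]_d] does not depend on it. *)
Record vnorm := VNorm {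
  vnorm_fun :> 'rV[R]_d -> R ;
  vnormD : forall x y, vnorm_fun (x + y) <= vnorm_fun x + vnorm_fun y ;
  vnormZ : forall (a : R) x, vnorm_fun (a *: x) = `|a| * vnorm_fun x ;
  vnorm0_eq0 : forall x, vnorm_fun x = 0 -> x = 0 }.

Context (nrm : vnorm).

Lemma vnorm0 : nrm 0 = 0.
Proof. by rewrite -(scale0r 0) vnormZ normr0 mul0r. Qed.

Lemma vnormN x : nrm (- x) = nrm x.
Proof. by rewrite -scaleN1r vnormZ normrN1 mul1r. Qed.

Lemma vnorm_ge0 x : 0 <= nrm x.
Proof.
have := vnormD nrm x (- x); rewrite subrr vnorm0 vnormN -mulr2n.
by rewrite pmulrn_lge0.
Qed.

(* The distance d(x, U) for the norm [nrm]. *)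
Definition vdist (U : set 'rV[R]_d) (x : 'rV[R]_d) : R :=
  inf [set nrm (x - xi) | xi in U].

Lemma vdist_lip U x y : vdist U x - vdist U y <= nrm (x - y).
Proof.
have [->|/set0P[u Uu]] := eqVneq U set0.
  by rewrite /vdist !image_set0 !inf0 subrr vnorm_ge0.
rewrite lerBlDr addrC -lerBlDr.
apply: lb_le_inf; first by exists (nrm (y - u)), u.
move=> _ [xi Uxi <-]; rewrite lerBlDr.
apply: (@le_trans _ _ (nrm (x - xi))).
  apply: ge_inf; last by exists xi.
  by exists 0 => _ [v _ <-]; exact: vnorm_ge0.
by rewrite (_ : x - xi = (y - xi) + (x - y)) ?vnormD// [RHS]addrC [RHS]addrA subrK.
Qed.

Lemma vdist_lip_norm U x y : `|vdist U x - vdist U y| <= nrm (x - y).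
Proof.
rewrite ler_norml vdist_lip andbT lerNl opprB.
by rewrite -(vnormN (x - y)) opprB vdist_lip.
Qed.

Lemma vnorm_lip_norm (x y : 'rV[R]_d) : `|nrm x - nrm y| <= nrm (x - y).
Proof.
have h a b : nrm a - nrm b <= nrm (a - b).
  by rewrite lerBlDr (le_trans _ (vnormD _ _ _))// subrK.
by rewrite ler_norml h andbT lerNl opprB -(vnormN (x - y)) opprB h.
Qed.

Lemma vnorm_le_coord (e : R) (x : 'rV[R]_d) : (forall j, `|x 0 j| <= e) ->
  nrm x <= e * \sum_j nrm (delta_mx 0 j).
Proof.
move=> xe; rewrite {1}(row_sum_delta x) mulr_sumr.
apply: (@le_trans _ _ (\sum_j nrm (x 0 j *: delta_mx 0 j))).
  elim/big_ind2 : _ => //; first by rewrite vnorm0.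
  by move=> a b u v ab uv; rewrite (le_trans (vnormD _ _ _))// lerD.
by apply: ler_sum => j _; rewrite vnormZ ler_wpM2r// vnorm_ge0.
Qed.

End norm.

Section complex_space.
Context (R : realType) (d : nat).
Local Notation C := R[i].
Local Notation RT := (measurableTypeR R).
Local Notation P := ((d.-tuple RT * d.-tuple RT)%type).

Definition re_rV (z : 'rV[C]_d) : 'rV[R]_d := map_mx (@complex.Re R) z.
Definition im_rV (z : 'rV[C]_d) : 'rV[R]_d := map_mx (@complex.Im R) z.

(* z = x + iy for a pair p = (x, y) of real d-tuples. *)
Definition cpoint (p : P) : 'rV[C]_d := \row_j (tnth p.1 j +i* tnth p.2 j)%C.

(* Integral over C^d for dx dy. *)
Definition integralC (F : 'rV[C]_d -> R) : \bar R :=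
  (\int[@lebesgue_tuple R d \x @lebesgue_tuple R d]_p (F (cpoint p))%:E)%E.

(* Scalars are complex, so [differentiable] is complex (Frechet)
   differentiability. *)
Definition entire (f : 'rV[C]_d -> C^o) := forall z, differentiable f z.

Let box (q : (d.-tuple rat * d.-tuple rat) * nat) : set P :=
  [set p | forall j, `|tnth p.1 j - ratr (tnth q.1.1 j)| < q.2.+1%:R^-1 /\
                     `|tnth p.2 j - ratr (tnth q.1.2 j)| < q.2.+1%:R^-1].

Let m_near (c r : R) : measurable [set x : RT | `|x - c| < r].
Proof.
rewrite (_ : [set _ | _] = [set` `]c - r, c + r[]); first exact: measurable_itv.
by apply/seteqP; split=> x /=; rewrite in_itv/= ltr_distl.
Qed.

Let m_box q : measurable (box q).
Proof.
rewrite (_ : box q = \bigcap_(j in [set: 'I_d])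
  ((fun p : P => tnth p.1 j) @^-1` [set x | `|x - ratr (tnth q.1.1 j)| < q.2.+1%:R^-1] `&`
   (fun p : P => tnth p.2 j) @^-1` [set x | `|x - ratr (tnth q.1.2 j)| < q.2.+1%:R^-1])).
  apply: fin_bigcap_measurable => // j _; apply: measurableI.
    rewrite -[X in measurable X]setTI.
    apply: (measurableT_comp (measurable_tnth j) measurable_fst) => //.
  rewrite -[X in measurable X]setTI.
  apply: (measurableT_comp (measurable_tnth j) measurable_snd) => //.
by apply/seteqP; split => [p bp j _|p bp j]; [exact: bp|exact: bp].
Qed.

Lemma measurable_locally_small (g : P -> RT) :
  (forall p e, 0 < e -> exists2 r, 0 < r & forall q,
    (forall j, `|tnth p.1 j - tnth q.1 j| < r /\ `|tnth p.2 j - tnth q.2 j| < r) ->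
    `|g p - g q| < e) ->
  measurable_fun setT g.
Proof.
move=> cg; apply: (measurability _ (RGenOInfty.measurableE R)).
move=> _ [_ [a ->] <-]; rewrite setTI.
rewrite (_ : _ @^-1` _ =
    \bigcup_(q in [set: (d.-tuple rat * d.-tuple rat) * nat])
      (if `[< box q `<=` g @^-1` [set` `]a, +oo[] >] then box q else set0)).
  apply: countable_bigcupT_measurable; first exact: countableP.
  by move=> q; case: ifP.
apply/seteqP; split => [p|p [q _]]; last by case: asboolP => // + bp; exact.
rewrite /= in_itv/= andbT => agp.
have [|r r0 rg] := cg p (g p - a); first by rewrite subr_gt0.
have r2 : 0 < r / 2 by rewrite divr_gt0.
have [k kr] : exists k : nat, k.+1%:R^-1 + k.+1%:R^-1 < r.
  near \oo => k; exists k; rewrite [ltRHS]splitr ltrD//;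
  by near: k; exact: (near_infty_natSinv_lt (PosNum r2)).
have k0 : 0 < k.+1%:R^-1 :> R by rewrite invr_gt0 ltr0Sn.
have approx (x : R) : exists q : rat, `|x - ratr q| < k.+1%:R^-1.
  have xx : x - k.+1%:R^-1 < x + k.+1%:R^-1.
    by rewrite ltrBlDr -addrA ltrDl addr_gt0.
  have [q] := rat_in_itvoo xx.
  by rewrite in_itv/= => xq; exists q; rewrite distrC ltr_distl.
have [q1 pq1] := choice (fun j => approx (tnth p.1 j)).
have [q2 pq2] := choice (fun j => approx (tnth p.2 j)).
exists ([tuple q1 j | j < d], [tuple q2 j | j < d], k) => //.
set Q := (X in if `[< box X `<=` _ >] then _ else _).
have bp : box Q p by move=> j; rewrite !tnth_mktuple.
rewrite asboolT// => x bx; rewrite /= in_itv/= andbT.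
have : `|g p - g x| < g p - a.
  apply: rg => j; have [p1 p2] := bp j; have [x1 x2] := bx j.
  split; apply: (lt_trans _ kr).
    apply: le_lt_trans (ler_distD (ratr (tnth [tuple q1 j | j < d] j)) _ _) _.
    by rewrite ltrD// distrC.
  apply: le_lt_trans (ler_distD (ratr (tnth [tuple q2 j | j < d] j)) _ _) _.
  by rewrite ltrD// distrC.
by rewrite ltr_norml => /andP[_]; rewrite ltrD2l ltrN2.
Unshelve. all: by end_near.
Qed.

Lemma re_cpoint p j : re_rV (cpoint p) 0 j = tnth p.1 j.
Proof. by rewrite !mxE. Qed.

Lemma im_cpoint p j : im_rV (cpoint p) 0 j = tnth p.2 j.
Proof. by rewrite !mxE. Qed.

Lemma normc_absE (z : C) : `|z| = (Normc.normc z)%:C%C.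
Proof. by []. Qed.

Lemma normc_ge0 (z : C) : 0 <= Normc.normc z.
Proof. by case: z => a b; exact: sqrtr_ge0. Qed.

Lemma measurable_entire (f : 'rV[C]_d -> C^o) : entire f ->
  measurable_fun setT (fun p : P => Normc.normc (f (cpoint p)) : RT).
Proof.
move=> ef; apply: measurable_locally_small => p e e0.
have /differentiable_continuous := ef (cpoint p).
have eC : 0 < e%:C%C by rewrite ltcR.
move=> /cvgrPdist_lt /(_ _ eC) /nbhs_ballP [r r0 rf].
have rR : r = (complex.Re r)%:C%C by rewrite RRe_real// ger0_real// ltW.
have R0 : 0 < complex.Re r by move: r0; rewrite /= rR ltcR.
exists (complex.Re r / 2); first by rewrite divr_gt0.
move=> q pq; suff : `|f (cpoint p) - f (cpoint q)| < e%:C%C.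
  rewrite normc_absE ltcR; apply: le_lt_trans.
  exact: (@ler_dist_dist R (Rcomplex R)).
apply: rf; split; first exact: r0.
move=> i j; have [pq1 pq2] := pq j.
rewrite -ball_normE/= !mxE rR.
set u := tnth p.1 j - tnth q.1 j in pq1 *.
set v := tnth p.2 j - tnth q.2 j in pq2 *.
rewrite [X in `|X|](_ : _ = (u +i* v)%C)// normc_absE ltcR.
apply: (@le_lt_trans _ _ (`|u| + `|v|)); last by rewrite [ltRHS]splitr ltrD.
rewrite -[leRHS]ger0_norm ?addr_ge0// -(sqrtr_sqr (`|u| + `|v|)) /= ler_wsqrtr//.
rewrite -(real_normK (num_real u)) -(real_normK (num_real v)) sqrrD.
by rewrite [leRHS]addrAC lerDl mulrn_wge0// mulr_ge0.
Qed.
End complex_space.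


Section spaces.
Context (R : realType) (d : nat) (nrm : vnorm R d) (beta : R) (U : set 'rV[R]_d).
Local Notation C := R[i].
Local Notation RT := (measurableTypeR R).
Local Notation P := ((d.-tuple RT * d.-tuple RT)%type).

Definition weight (B : R) (N : nat) (z : 'rV[C]_d) : R :=
  let p := (1 - beta)^-1 in
  (\prod_j (1 + `|re_rV z 0 j|) ^+ (2 * N)) *
  expR (- (2 * vdist nrm U (B *: re_rV z) `^ p) - 2 * nrm (B *: im_rV z) `^ p).

(* <f, f>_{U,B,N}; the integrand conj(f) f is the square of the modulus. *)
Definition sqnormH (B : R) (N : nat) (f : 'rV[C]_d -> C^o) : \bar R :=
  integralC (fun z => Normc.normc (f z) ^+ 2 * weight B N z).

(* Only meaningful when [sqnormH B N f] is finite, i.e. on [spaceH B N]. *)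
Definition normH (B : R) (N : nat) (f : 'rV[C]_d -> C^o) : R :=
  Num.sqrt (fine (sqnormH B N f)).

(* H^{beta,B}_N(U), S^{beta,b}(U) and S^beta(U), as sets of functions. *)
Definition spaceH (B : R) (N : nat) : set ('rV[C]_d -> C^o) :=
  [set f | entire f /\ (sqnormH B N f < +oo)%E].

Definition spaceSb (b : R) : set ('rV[C]_d -> C^o) :=
  [set f | forall B N, b < B -> spaceH B N f].

Definition spaceS : {pred 'rV[C]_d -> C^o} :=
  mem [set f | exists2 b, 0 < b & spaceSb b f].

Lemma weight_ge0 B N z : 0 <= weight B N z.
Proof.
by rewrite mulr_ge0 ?expR_ge0// prodr_ge0// => j _; rewrite exprn_ge0// addr_ge0.
Qed.

Let measurable_lip (h : 'rV[R]_d -> R) (s : P -> 'rV[R]_d) (B : R) :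
  (forall x y, `|h x - h y| <= nrm (x - y)) ->
  (s = (fun p => re_rV (cpoint p)) \/ s = (fun p => im_rV (cpoint p))) ->
  measurable_fun setT (fun p : P => h (B *: s p) : RT).
Proof.
move=> lip ss; apply: measurable_locally_small => p e e0.
pose M := `|B| * \sum_j nrm (delta_mx 0 j) + 1.
have M0 : 0 < M.
  by rewrite ltr_wpDl// mulr_ge0// sumr_ge0// => j _; exact: vnorm_ge0.
exists (e / M); first by rewrite divr_gt0.
move=> q pq; apply: (le_lt_trans (lip _ _)).
rewrite -scalerBr vnormZ.
apply: (@le_lt_trans _ _ (`|B| * (e / M * \sum_j nrm (delta_mx 0 j)))).
  rewrite ler_wpM2l// vnorm_le_coord// => j; have [pq1 pq2] := pq j.
  by case: ss => ->; rewrite !mxE/=; exact: ltW.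
by rewrite mulrCA -[ltRHS](divfK (lt0r_neq0 M0)) ltr_pM2l ?divr_gt0// ltrDl.
Qed.

Lemma measurable_weight B N :
  measurable_fun setT (fun p : P => weight B N (cpoint p) : RT).
Proof.
apply: measurable_funM.
  apply: measurable_prod => j _; apply: measurable_funX.
  apply: measurable_funD => //; apply: measurableT_comp => //.
  under eq_fun do rewrite re_cpoint.
  exact: (measurableT_comp (measurable_tnth j) measurable_fst).
apply: measurableT_comp => //; apply: measurable_funB.
  apply: measurableT_comp => //; apply: measurable_funM => //.
  apply: (measurableT_comp (measurable_powR _)) => //.
  by apply: measurable_lip; [exact: vdist_lip_norm|left].
apply: measurable_funM => //; apply: (measurableT_comp (measurable_powR _)) => //.
by apply: measurable_lip; [exact: vnorm_lip_norm|right].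
Qed.

Lemma measurable_sqnormH B N f : entire f -> measurable_fun setT
  (fun p : P => (Normc.normc (f (cpoint p)) ^+ 2 * weight B N (cpoint p))%:E).
Proof.
move=> ef; apply/measurable_EFinP; apply: measurable_funM.
  by apply: measurable_funX; exact: measurable_entire.
exact: measurable_weight.
Qed.

Let integrand_ge0 B N (f : 'rV[C]_d -> C^o) z :
  0 <= Normc.normc (f z) ^+ 2 * weight B N z.
Proof. by rewrite mulr_ge0 ?weight_ge0// sqr_ge0. Qed.

Lemma sqnormH_ge0 B N f : (0 <= sqnormH B N f)%E.
Proof. by apply: integral_ge0 => p _; rewrite lee_fin. Qed.

Lemma sqnormHZ B N (f : 'rV[C]_d -> C^o) (a : C) : entire f ->
  sqnormH B N (a *: f) = ((Normc.normc a ^+ 2)%:E * sqnormH B N f)%E.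
Proof.
move=> ef; rewrite /sqnormH /integralC -ge0_integralZl//=.
- by apply: eq_integral => p _; rewrite -EFinM [in RHS]mulrA -[in RHS]exprMn -Normc.normcM.
- exact: measurable_sqnormH.
- by move=> p _; rewrite lee_fin.
- by rewrite lee_fin sqr_ge0.
Qed.

Lemma sqnormHD B N (f g : 'rV[C]_d -> C^o) : entire f -> entire g ->
  (sqnormH B N (f + g)%R <= 2%:E * sqnormH B N f + 2%:E * sqnormH B N g)%E.
Proof.
move=> ef eg.
have efg : entire (f + g) by move=> z; exact: differentiableD.
have fg0 p := integrand_ge0 B N (f + g) (cpoint p).
rewrite /sqnormH /integralC.
rewrite -ge0_integralZl//=; [|exact: measurable_sqnormH|by move=> p _; rewrite lee_fin].
rewrite -ge0_integralZl//=; [|exact: measurable_sqnormH|by move=> p _; rewrite lee_fin].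
rewrite -ge0_integralD//=.
- apply: ge0_le_integral => //=.
  + by move=> p _; exact: fg0.
  + exact: measurable_sqnormH efg.
  + by apply: emeasurable_funD; apply: measurable_funeM; exact: measurable_sqnormH.
  + move=> p _; rewrite -!EFinM -EFinD lee_fin.
    rewrite [X in _ <= X + _]mulrA [X in _ <= _ + X]mulrA -mulrDl.
    rewrite ler_wpM2r ?weight_ge0//.
    set u := Normc.normc (f _); set v := Normc.normc (g _).
    have u0 : 0 <= u by exact: normc_ge0.
    have v0 : 0 <= v by exact: normc_ge0.
    apply: (@le_trans _ _ ((u + v) ^+ 2)).
      apply: lerXn2r; [exact: normc_ge0|exact: addr_ge0|exact: le_normcD].
    rewrite -subr_ge0 (_ : _ - _ = (u - v) ^+ 2) ?sqr_ge0//.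
    by ring.
- by move=> p _; rewrite -EFinM lee_fin mulr_ge0.
- by apply: measurable_funeM; exact: measurable_sqnormH.
- by move=> p _; rewrite -EFinM lee_fin mulr_ge0.
- by apply: measurable_funeM; exact: measurable_sqnormH.
Qed.

Lemma spaceHZ B N (a : C) (f : 'rV[C]_d -> C^o) : spaceH B N f -> spaceH B N (a *: f).
Proof.
move=> [ef fy]; split; first by move=> z; exact: differentiableZ.
by rewrite sqnormHZ// lte_mul_pinfty// lee_fin sqr_ge0.
Qed.

Lemma spaceHD B N (f g : 'rV[C]_d -> C^o) : spaceH B N f -> spaceH B N g -> spaceH B N (f + g).
Proof.
move=> [ef fy] [eg gy]; split; first by move=> z; exact: differentiableD.
apply: (le_lt_trans (sqnormHD _ _ ef eg)).
by rewrite lte_add_pinfty// lte_mul_pinfty// lee_fin.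
Qed.

Lemma spaceH0 B N : spaceH B N (0 : 'rV[C]_d -> C^o).
Proof.
split; first by move=> z; exact: differentiable_cst.
rewrite /sqnormH /integralC integral0_eq// => p _.
by rewrite [X in X ^+ 2](_ : _ = 0) ?expr0n/= ?mul0r//; exact: Normc.normc0.
Qed.

Lemma spaceSb_le b b' : b <= b' -> spaceSb b `<=` spaceSb b'.
Proof. by move=> bb f fb B N bB; apply: fb; exact: le_lt_trans bB. Qed.

Lemma spaceS_submod_closed : submod_closed spaceS.
Proof.
split; first by rewrite inE; exists 1 => // B N _; exact: spaceH0.
move=> a f g; rewrite !inE => -[b b0 fb] [c c0 gc].
exists (Num.max b c); first by rewrite lt_max b0.
move=> B N bB; apply: spaceHD.
  by apply: spaceHZ; apply: fb; apply: le_lt_trans bB; rewrite le_max lexx.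
by apply: gc; apply: le_lt_trans bB; rewrite le_max lexx orbT.
Qed.

HB.instance Definition _ := GRing.isSubmodClosed.Build _ _ spaceS
  spaceS_submod_closed.

Record Sbeta := MkSbeta {
  Sbeta_fun :> 'rV[C]_d -> C^o ;
  SbetaP : Sbeta_fun \in spaceS }.

HB.instance Definition _ := [isSub for Sbeta_fun].
HB.instance Definition _ := [Choice of Sbeta by <:].
HB.instance Definition _ := [SubChoice_isSubLmodule of Sbeta by <:].

End spaces.

Definition absconvex (K : numFieldType) (E : lmodType K) (V : set E) :=
  forall (a b : K) (x y : E), `|a| + `|b| <= 1 -> V x -> V y ->
    V (a *: x + b *: y).

Lemma conv_shift (K : numFieldType) (E : lmodType K) (l : K) (a b w x : E) :
  l *: (a + w - x) + (1 - l) *: (b + w - x) = l *: a + (1 - l) *: b + w - x.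
Proof.
rewrite -(addrA a) -(addrA b) -[RHS]addrA; set t := w - x.
by rewrite (scalerDr l a) (scalerDr _ b) addrACA -(scalerDl t) subrKC scale1r.
Qed.

Section inductive_topology.
Context (R : realType) (d : nat) (nrm : vnorm R d) (beta : R) (U : set 'rV[R]_d).
Local Notation C := R[i].
Local Notation E := (Sbeta nrm beta U).
Implicit Types (f x y : E) (V W : set E).

(* The trace of V on S^{beta,b}(U) is a neighbourhood of 0 for the projective
   limit topology: it contains a ball for finitely many of the norms with
   indices B > b and N. *)
Definition nbhs0_Sb (b : R) (V : set E) :=
  exists2 s : seq (R * nat), (forall q, q \in s -> b < q.1) &
  exists2 e : R, 0 < e & forall f : E, spaceSb nrm beta U b f ->
    (forall q, q \in s -> normH nrm beta U q.1 q.2 f < e) -> V f.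

(* The standard base of neighbourhoods of 0 of the locally convex inductive
   limit topology: the absolutely convex sets whose trace on each S^{beta,b}(U)
   is a neighbourhood of 0. *)
Definition ind_base : set (set E) :=
  [set V | absconvex V /\ forall b, 0 < b -> nbhs0_Sb b V].

Definition ind_nbhs (x : E) : set (set E) :=
  [set A | exists2 V, ind_base V & forall v, V v -> A (x + v)].

Lemma entire_Sbeta f : entire f.
Proof. by have := SbetaP f; rewrite inE => -[b b0 /(_ (b + 1) 0)[]//]; rewrite ltrDl. Qed.

Lemma normHZ B N (a : C) f :
  normH nrm beta U B N (a *: f) = Normc.normc a * normH nrm beta U B N f.
Proof.
rewrite /normH (sqnormHZ _ _ _ _ _ _ (entire_Sbeta f)).
have := sqnormH_ge0 nrm beta U B N f; case: (sqnormH _ _ _ _ _ _) => //=.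
- move=> r; rewrite lee_fin => r0.
  by rewrite sqrtrM ?sqr_ge0// sqrtr_sqr ger0_norm ?normc_ge0.
- move=> _; have [->|a0] := eqVneq a 0.
    by rewrite Normc.normc0 expr0n/= mul0e mul0r sqrtr0.
  rewrite sqrtr0 mulr0 gt0_muley ?sqrtr0// lte_fin exprn_gt0//.
  by rewrite lt_neqAle normc_ge0 andbT eq_sym; apply: contra a0 => /eqP/Normc.eq0_normc->.
Qed.

Lemma normH0 B N : normH nrm beta U B N (0 : E) = 0.
Proof. by have := normHZ B N 0 0; rewrite scale0r Normc.normc0 mul0r. Qed.

Lemma ind_base0 V : ind_base V -> V 0.
Proof.
move=> [_ /(_ 1 ltr01)[s _ [e e0]]]; apply.
  by move=> B N _; exact: spaceH0.
by move=> q _; rewrite normH0.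
Qed.

Lemma ind_baseT : ind_base setT.
Proof. by split=> // b b0; exists [::] => //; exists 1. Qed.

Lemma ind_baseI V W : ind_base V -> ind_base W -> ind_base (V `&` W).
Proof.
move=> [aV nV] [aW nW]; split.
  by move=> a b x y ab [Vx Wx] [Vy Wy]; split; [exact: aV|exact: aW].
move=> b b0; have [s sb [e e0 sV]] := nV b b0; have [t tb [r r0 tW]] := nW b b0.
exists (s ++ t).
  by move=> q; rewrite mem_cat => /orP[/sb|/tb].
exists (Num.min e r); first by rewrite lt_min e0 r0.
move=> f fb fst; split; [apply: sV|apply: tW] => // q qs.
  by have := fst q; rewrite mem_cat qs lt_min => /(_ isT)/andP[].
by have := fst q; rewrite mem_cat qs orbT lt_min => /(_ isT)/andP[].
Qed.

Lemma ind_baseZ (c : C) V : ind_base V -> ind_base [set x | V (c *: x)].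
Proof.
move=> [aV nV]; split.
  move=> a b x y ab /= Vx Vy; rewrite scalerDr !scalerA (mulrC c) (mulrC c).
  by rewrite -!scalerA; exact: aV.
move=> b b0; have [s sb [e e0 sV]] := nV b b0; exists s => //.
exists (e / (Normc.normc c + 1)).
  by rewrite divr_gt0// ltr_wpDl// normc_ge0.
move=> f fb fs; apply: sV.
  by move=> B N bB; apply: spaceHZ; exact: fb.
have c1 : 0 < Normc.normc c + 1 by rewrite ltr_wpDl// normc_ge0.
move=> q qs; rewrite normHZ.
have := fs q qs; rewrite ltr_pdivlMr// mulrC; apply: le_lt_trans.
by rewrite ler_wpM2r ?sqrtr_ge0// lerDl.
Qed.

Lemma ind_base_absorbing V x : ind_base V -> exists2 r : C, 0 < r & V (r *: x).
Proof.
move=> [_ nV]; have := SbetaP x; rewrite inE => -[b b0 xb].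
have [s sb [e e0 sV]] := nV b b0.
have [M M0 xM] : exists2 M, 0 < M &
    forall q, q \in s -> normH nrm beta U q.1 q.2 x <= M.
  exists (1 + \sum_(q <- s) normH nrm beta U q.1 q.2 x).
    by rewrite ltr_wpDr// sumr_ge0// => q _; exact: sqrtr_ge0.
  move=> q qs; rewrite (big_rem q)//= addrCA lerDl addr_ge0// sumr_ge0// => ? _.
  exact: sqrtr_ge0.
exists (e / (M + M))%:C%C; first by rewrite ltcR divr_gt0// addr_gt0.
apply: sV.
  by move=> B N bB; apply: spaceHZ; exact: xb.
move=> q qs; rewrite normHZ /= expr0n/= addr0 sqrtr_sqr gtr0_norm ?divr_gt0 ?addr_gt0//.
apply: (@le_lt_trans _ _ (e / (M + M) * M)).
  by rewrite ler_wpM2l ?xM// divr_ge0 ?addr_ge0 ?ltW.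
rewrite -mulrA gtr_pMr// mulrC ltr_pdivrMr ?addr_gt0// mul1r ltrDl//.
Qed.

Lemma ind_baseB V x : ind_base V -> V x -> forall a : C, `|a| <= 1 -> V (a *: x).
Proof.
move=> bV Vx a a1; rewrite -[_ *: _]addr0 -(scaler0 _ (0 : C)).
by apply: bV.1 => //; [rewrite normr0 addr0|exact: ind_base0].
Qed.

Let half : `|2^-1 : C| + `|2^-1 : C| = 1.
Proof. by rewrite ger0_norm ?invr_ge0// [RHS]splitr mul1r. Qed.

Let ind_baseD V v w : ind_base V -> V (2 *: v) -> V (2 *: w) -> V (v + w).
Proof.
move=> bV Vv Vw.
have -> : v + w = 2^-1 *: (2 *: v) + 2^-1 *: (2 *: w).
  by rewrite !scalerA mulVf ?pnatr_eq0// !scale1r.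
by apply: bV.1 => //; rewrite half.
Qed.

HB.instance Definition _ := hasNbhs.Build E ind_nbhs.

Let ind_nbhs_filter x : ProperFilter (ind_nbhs x).
Proof.
apply: Build_ProperFilter_ex.
  by move=> A [V bV VA]; exists (x + 0); apply: VA; exact: ind_base0.
split; first by exists setT => //; exact: ind_baseT.
  move=> A B [V bV VA] [W bW WB]; exists (V `&` W); first exact: ind_baseI.
  by move=> v [Vv Wv]; split; [exact: VA|exact: WB].
by move=> A B AB [V bV VA]; exists V => // v /VA /AB.
Qed.

Let ind_nbhs_singleton x A : ind_nbhs x A -> A x.
Proof. by move=> [V bV VA]; have := VA 0 (ind_base0 bV); rewrite addr0. Qed.

Let ind_nbhs_nbhs x A : ind_nbhs x A -> ind_nbhs x (ind_nbhs^~ A).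
Proof.
move=> [V bV VA]; exists [set v | V (2 *: v)]; first exact: ind_baseZ.
move=> v /= Vv; exists [set v | V (2 *: v)]; first exact: ind_baseZ.
by move=> w /= Vw; rewrite -addrA; apply: VA; exact: ind_baseD.
Qed.

HB.instance Definition _ := Nbhs_isNbhsTopological.Build E
  ind_nbhs_filter ind_nbhs_singleton ind_nbhs_nbhs.

Let ind_add_continuous : continuous (fun x : E * E => x.1 + x.2).
Proof.
move=> [x y] A [V bV VA].
have bW : ind_base [set v | V (2 *: v)] by exact: ind_baseZ.
exists ([set x + v | v in [set v | V (2 *: v)]],
        [set y + v | v in [set v | V (2 *: v)]]).
  by split; exists [set v | V (2 *: v)] => // v Vv; exists v.
move=> [_ _] [/= [v Vv <-] [w Vw <-]] /=; rewrite addrACA.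
by apply: VA; exact: ind_baseD.
Qed.

Let ind_scale_continuous : continuous (fun z : C^o * E => z.1 *: z.2).
Proof.
move=> [a x] A [V bV VA].
have [r r0 Vrx] := ind_base_absorbing x bV.
pose c : C := 2 * (`|a| + 1).
have c0 : 0 < c by rewrite mulr_gt0// ltr_wpDl.
have bW : ind_base [set v | V (c *: v)] by exact: ind_baseZ.
pose del : C := r / (2 * (r + 1)).
have del0 : 0 < del by rewrite divr_gt0// mulr_gt0// ltr_wpDl// ltW.
have del1 : del <= 1.
  rewrite ler_pdivrMr ?mulr_gt0 ?addr_gt0// mul1r mulr_natl mulrSr mulr1n.
  by rewrite -addrA lerDl ltW// addr_gt0// addr_gt0.
have delr : del <= r / 2.
  rewrite ler_wpM2l ?(ltW r0)// lef_pV2 ?posrE ?mulr_gt0 ?addr_gt0//.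
  by rewrite ler_pMr// lerDr ltW.
exists ([set a + t | t in [set t : C^o | `|t| < del]],
        [set x + v | v in [set v | V (c *: v)]]).
  split; last by exists [set v | V (c *: v)] => // v Vv; exists v.
  apply/nbhs_ballP; exists del => //= t; rewrite -ball_normE/= => at_.
  exists ((t : C) - a); first by move: at_; rewrite /= (@distrC C C).
  exact: (@subrKC C).
move=> [_ _] [/= [t td <-] [w Vw <-]] /=.
have -> : (a + t) *: (x + w) =
    a *: x + ((t / r) *: (r *: x) + ((a + t) / c) *: (c *: w)).
  rewrite !scalerA !divfK ?gt_eqF// scalerDr scalerDl addrA.
  by rewrite -addrA.
apply: VA; apply: bV.1 => //.
rewrite [leRHS]splitr lerD//.
  rewrite normf_div (gtr0_norm r0) ler_pdivrMr// mul1r mulrC.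
  by rewrite (le_trans (ltW td)).
rewrite normf_div (gtr0_norm c0) ler_pdivrMr// mul1r mulKf ?pnatr_eq0//.
by rewrite (le_trans (ler_normD _ _))// lerD2l (le_trans (ltW td)).
Qed.

Let ind_locally_convex :
  exists2 B : set (set E), (forall b, b \in B -> convex_set b) & basis B.
Proof.
exists [set b | open b /\ convex_set b].
  by move=> b; rewrite inE => -[].
split; first by move=> b [].
move=> x A [V bV VA].
exists (interior [set y | V (y - x)]); last first.
  by move=> y /interior_subset /= /VA; rewrite addrC subrK.
split; last first.
  by exists V => // v Vv; rewrite /= addrC addKr.
split; first exact: open_interior.
move=> y1 y2 l; rewrite !inE => -[W1 bW1 W1V] [W2 bW2 W2V].
exists (W1 `&` W2); first exact: ind_baseI.
move=> w [Ww1 Ww2] /=.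
have l0 : 0 <= l%:num :> C by [].
have l1 : 0 <= 1 - l%:num :> C by rewrite subr_ge0.
have := bV.1 l%:num (1 - l%:num) _ _ _ (W1V _ Ww1) (W2V _ Ww2).
rewrite (ger0_norm l0) (ger0_norm l1) subrKC lexx => /(_ isT).
by rewrite conv_shift.
Qed.

HB.instance Definition _ := PreTopologicalNmodule_isTopologicalNmodule.Build E
  ind_add_continuous.
HB.instance Definition _ := TopologicalNmodule_isTopologicalLmodule.Build C E
  ind_scale_continuous.
(* This factory only provides the uniform structure, whose entourages are given
   by the neighbourhoods of 0. *)
HB.instance Definition _ := PreTopologicalLmod_isTvs.Build C E
  ind_add_continuous ind_scale_continuous ind_locally_convex.
HB.instance Definition _ := Uniform_isTvs.Build C E ind_locally_convex.

End inductive_topology.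

Lemma nbhs0_SbetaE (R : realType) (d : nat) (nrm : vnorm R d) (beta : R)
    (U : set 'rV[R]_d) (A : set (Sbeta nrm beta U)) :
  nbhs 0 A <-> exists2 V, ind_base V & V `<=` A.
Proof.
split=> -[V bV VA]; exists V => // v Vv; last by rewrite add0r; exact: VA.
by rewrite -(add0r v); exact: VA.
Qed.

Lemma entourage_SbetaE (R : realType) (d : nat) (nrm : vnorm R d) (beta : R)
    (U : set 'rV[R]_d) (A : set (Sbeta nrm beta U * Sbeta nrm beta U)) :
  entourage A <->
  exists2 V, ind_base V & forall x y : Sbeta nrm beta U, V (x - y) -> A (x, y).
Proof.
split=> [[W [/nbhs0_SbetaE[V bV VW] WA]]|[V bV VA]].
  exists V => // x y Vxy; apply: set_mem; apply: WA.
  by apply: mem_set; exact: VW.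
exists V; split; first by apply/nbhs0_SbetaE; exists V.
by move=> [x y] Vxy; apply: mem_set; apply: VA; exact: set_mem Vxy.
Qed.

Definition is_cone (R : realType) (d : nat) (U : set 'rV[R]_d) :=
  U !=set0 /\ forall (t : R) x, 0 < t -> U x -> U (t *: x).

(* Boundedness in a topological vector space: A is absorbed by every
   neighbourhood of 0. *)
Definition tvs_bounded (K : numFieldType) (E : tvsType K) (A : set E) :=
  forall V : set E, nbhs 0 V ->
    exists2 r : K, 0 < r & forall l : K, r <= `|l| -> A `<=` [set l *: v | v in V].

Definition complete_space (T : uniformType) :=
  forall F : set_system T, ProperFilter F -> cauchy F -> exists x : T, F --> x.

(* Main.v *)
Require Import Defs.
From HB Require Import structures.
From mathcomp Require Import all_boot all_order all_algebra.
From mathcomp Require Import complex.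
From mathcomp Require Import all_classical all_reals all_analysis.
From mathcomp Require Import measurable_realfun ring lra.
Set Implicit Arguments.
Unset Strict Implicit.
Unset Printing Implicit Defensive.
Import Order.TTheory GRing.Theory Num.Theory.
Import numFieldNormedType.Exports.
Local Open Scope classical_set_scope.
Local Open Scope ring_scope.

(** The weight of index (B, N) is X^(2N) exp (- 2 B^p T), where
    X = prod_j (1 + |x_j|) and T = d(x, U)^p + |y|^p, because U is a cone
    ([weightE]). A large B gains an exponential factor over a small one, which
    interpolates between the norms: for 0 < n < B < B' and every delta > 0, the
    weight of index (B, N) is at most delta times that of index (n, 0) plus a
    multiple of that of some index (B', N') ([weight_interp]). The part in excess
    of delta times the weight of index (n, 0) is therefore dominated by a weight
    of each step, so its L2 seminorm is continuous on the inductive limit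
    ([dominated_excess], [ind_base_qform]). Hence on a ball of the norm of index
    (n, 0), every norm of larger index is controlled, up to an arbitrarily small
    error, by continuous seminorms of the limit. Boundedness and completeness
    both reduce to this.

    Bounded sets. If a set were bounded for none of the norms of index (n, 0),
    then elements f_n of it violating the bounds, cut off to bounded regions,
    would give countably many continuous seminorms whose unit balls intersect in a
    neighbourhood of 0 that does not absorb it ([tvs_bounded_step]); bounded
    for one such norm, it is bounded for all those of larger index by the
    excess weights ([bounded_in_step]). Conversely a set bounded in a step is
    absorbed by every neighbourhood of 0 of the limit.

    Completeness. A similar argument shows that a Cauchy filter F on the limit,
    thickened by neighbourhoods of 0, always meets a fixed ball of one norm
    ([cauchy_concentrated]). There, F is Cauchy for all the norms of a step
    ([near_ball_osc]), so that it has a locally uniform limit, which is entire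
    ([entire_limit]) and is the limit of F by Fatou's lemma ([qform_fatou],
    [cauchy_cvg_Sbeta]). Separation is easier: the L2 seminorms over bounded
    regions are continuous on the limit and control the values of an entire
    function ([entire_L2_bound], [Sbeta_hausdorff]).

    The two facts used on entire functions, the local bound by the L2 norm and
    the closure under locally uniform limits, come from Goursat's theorem on
    rectangles ([goursat]), with removable points ([rint_removable]). It yields
    Cauchy's formula on rectangles, with the integral of the kernel bounded below
    instead of evaluated ([cauchy_formula], [kernel_lower]). Averaging over the
    position of the sides bounds a value by an area integral ([area_bound]), and
    iterating over the coordinates gives the bound in several variables
    ([submean_box]). Applied to a difference quotient, the formula gives a
    Lipschitz bound ([lipschitz_bound]), by which the difference quotients of a
    locally uniformly convergent sequence converge uniformly and its
    differentials pass to the limit. *)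

(** * Complex-valued integrals over real intervals *)

Section complex_integral.
Context (R : realType).
Local Notation C := R[i].
Local Notation normc := (@Normc.normc R).
Local Notation mu := (@lebesgue_measure R).

(** Bridges the C-valued norm of the topology of C and the R-valued modulus in
    which the estimates below are carried out. *)
Lemma cvgC_P T (F : set_system T) (FF : Filter F) (f : T -> C^o) (l : C^o) :
  f @ F --> l <-> forall e : R, 0 < e -> \forall w \near F, normc (l - f w) < e.
Proof.
split => [/cvgrPdist_lt fl e e0|fl].
  have /fl : 0 < e%:C%C by rewrite ltcR.
  by apply: filterS => w; rewrite normc_absE ltcR.
apply/cvgrPdist_lt => e e0.
have eE : e = (complex.Re e)%:C%C by rewrite RRe_real// ger0_real// ltW.
have /fl : 0 < complex.Re e by rewrite -ltcR -eE.
by apply: filterS => w; rewrite normc_absE {2}eE ltcR.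
Qed.

Lemma normc_ReIm (z : C) : normc z ^+ 2 = complex.Re z ^+ 2 + complex.Im z ^+ 2.
Proof. by case: z => a b /=; rewrite sqr_sqrtr// addr_ge0// sqr_ge0. Qed.

Lemma Re_le_normc (z : C) : `|complex.Re z| <= normc z.
Proof.
by rewrite -(ler_pXn2r (_ : 0 < 2)%N) ?nnegrE ?normc_ge0//
  normc_ReIm real_normK ?num_real// lerDl sqr_ge0.
Qed.

Lemma Im_le_normc (z : C) : `|complex.Im z| <= normc z.
Proof.
by rewrite -(ler_pXn2r (_ : 0 < 2)%N) ?nnegrE ?normc_ge0//
  normc_ReIm real_normK ?num_real// lerDr sqr_ge0.
Qed.

Lemma normc_le_ReIm (z : C) : normc z <= `|complex.Re z| + `|complex.Im z|.
Proof.
rewrite -(ler_pXn2r (_ : 0 < 2)%N) ?nnegrE ?addr_ge0 ?normc_ge0//.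
by rewrite normc_ReIm sqrrD !real_normK ?num_real// lerD2r lerDl mulrn_wge0.
Qed.

Lemma normcD (x y : C) : normc (x + y) <= normc x + normc y.
Proof. exact: le_normcD. Qed.

Lemma normcN1 (x : C) : normc (- x) = normc x.
Proof. exact: normcN. Qed.

Lemma normcB (x y : C) : normc (x - y) <= normc x + normc y.
Proof. by rewrite -(normcN1 y) normcD. Qed.

Lemma normc_distC (x y : C) : normc (x - y) = normc (y - x).
Proof. by rewrite -normcN1 opprB. Qed.

Lemma normc_R (x : R) : normc x%:C%C = `|x|.
Proof. by rewrite /= expr0n/= addr0 sqrtr_sqr. Qed.

Lemma normc_i : normc 'i%C = 1.
Proof. by rewrite /= expr0n/= add0r expr1n sqrtr1. Qed.

Section cont.
Context (T : topologicalType).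
Implicit Types F : T -> C^o.

Lemma continuous_Re F : continuous F -> continuous (fun x => complex.Re (F x) : R).
Proof.
move=> cF x; apply/cvgrPdist_lt => e e0; have /cvgC_P/(_ e e0) := cF x.
apply: filterS => w; apply: le_lt_trans.
by have := Re_le_normc (F x - F w); case: (F x) => a b; case: (F w).
Qed.

Lemma continuous_Im F : continuous F -> continuous (fun x => complex.Im (F x) : R).
Proof.
move=> cF x; apply/cvgrPdist_lt => e e0; have /cvgC_P/(_ e e0) := cF x.
apply: filterS => w; apply: le_lt_trans.
by have := Im_le_normc (F x - F w); case: (F x) => a b; case: (F w).
Qed.

Lemma continuous_normc F : continuous F -> continuous (fun x => normc (F x) : R).
Proof.
move=> cF x; apply/cvgrPdist_lt => e e0; have /cvgC_P/(_ e e0) := cF x.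
apply: filterS => w; apply: le_lt_trans.
have h (a b : C) : normc a - normc b <= normc (a - b).
  by rewrite lerBlDr (le_trans _ (normcD _ _))// subrK.
by rewrite ler_norml h andbT lerNl opprB normc_distC h.
Qed.

Lemma cfunD F G x : {for x, continuous F} -> {for x, continuous G} ->
  {for x, continuous (fun x => F x + G x : C^o)}.
Proof. exact: (@cvgD C C^o). Qed.

Lemma cfunB F G x : {for x, continuous F} -> {for x, continuous G} ->
  {for x, continuous (fun x => F x - G x : C^o)}.
Proof. exact: (@cvgB C C^o). Qed.

Lemma cfunM F G x : {for x, continuous F} -> {for x, continuous G} ->
  {for x, continuous (fun x => F x * G x : C^o)}.
Proof. exact: (@cvgM C). Qed.

Lemma cfunV F x : F x != 0 -> {for x, continuous F} ->
  {for x, continuous (fun x => (F x)^-1 : C^o)}.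
Proof. exact: (@cvgV C). Qed.

Lemma cfun_cst (k : C^o) x : {for x, continuous (fun _ : T => k)}.
Proof. exact: cvg_cst. Qed.
End cont.

Lemma cfun_id (x : C^o) : {for x, continuous (fun z : C^o => z)}.
Proof. exact: cvg_id. Qed.

Lemma continuous_ballP (g : C^o -> C^o) (a : C^o) :
  {for a, continuous g} <-> forall e : R, 0 < e -> exists2 r : R, 0 < r &
    forall w, normc (w - a) < r -> normc (g w - g a) < e.
Proof.
have aF : ProperFilter (nbhs a) by exact: nbhs_pfilter.
split => [/(@cvgC_P _ (nbhs a) _) ca e e0|ca].
  have /nbhs_ballP[r /= r0 rg] := ca e e0.
  have rE : r = (complex.Re r)%:C%C by rewrite RRe_real// ger0_real// ltW.
  exists (complex.Re r); first by rewrite -ltcR -rE.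
  move=> w wr; rewrite normc_distC; apply: rg.
  by rewrite -ball_normE/= normc_absE rE ltcR normc_distC.
apply/(@cvgC_P _ (nbhs a) _) => e e0; have [r r0 rg] := ca e e0.
apply/nbhs_ballP; exists r%:C%C; first by rewrite /= ltcR.
by move=> w; rewrite -ball_normE/= normc_absE ltcR !(normc_distC a) => /rg; rewrite normc_distC.
Qed.

Lemma continuous_hline (c : R) : continuous (fun x : R => (x +i* c)%C : C^o).
Proof.
move=> x; apply/cvgC_P => e e0; near=> y.
rewrite (_ : (_ - _ : C) = (x - y)%:C%C).
  by rewrite normc_R; near: y; exact: cvgr_dist_lt.
by apply/eqP; rewrite eq_complex/= subrr !eqxx.
Unshelve. all: by end_near. Qed.

Lemma continuous_vline (c : R) : continuous (fun x : R => (c +i* x)%C : C^o).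
Proof.
move=> x; apply/cvgC_P => e e0; near=> y.
rewrite (_ : (_ - _ : C) = 'i%C * (x - y)%:C%C).
  by rewrite Normc.normcM normc_i mul1r normc_R; near: y; exact: cvgr_dist_lt.
by apply/eqP; rewrite eq_complex/=; apply/andP; split; apply/eqP; ring.
Unshelve. all: by end_near. Qed.

Definition cint (F : R -> C) (a b : R) : C :=
  ((\int[mu]_(x in `[a, b]) complex.Re (F x)) +i*
   (\int[mu]_(x in `[a, b]) complex.Im (F x)))%C.

Lemma continuous_integrable (f : R -> R) a b : continuous f ->
  mu.-integrable `[a, b] (EFin \o f).
Proof.
move=> cf; apply: continuous_compact_integrable; first exact: segment_compact.
exact: continuous_subspaceT.
Qed.

Implicit Types F G : R -> C^o.

Let iRe F a b : continuous F -> mu.-integrable `[a, b] (EFin \o (fun x => complex.Re (F x))).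
Proof. by move=> cF; exact/continuous_integrable/continuous_Re. Qed.

Let iIm F a b : continuous F -> mu.-integrable `[a, b] (EFin \o (fun x => complex.Im (F x))).
Proof. by move=> cF; exact/continuous_integrable/continuous_Im. Qed.

Lemma cint_ext F G a b : {in `[a, b], F =1 G} -> cint F a b = cint G a b.
Proof.
by move=> FG; rewrite /cint; congr Complex; apply: eq_Rintegral => x;
   rewrite inE/= => xab; rewrite FG.
Qed.

Lemma cintD F G a b : continuous F -> continuous G ->
  cint (fun x => F x + G x) a b = cint F a b + cint G a b.
Proof.
move=> cF cG; rewrite /cint.
have ReD (x y : C) : complex.Re (x + y) = complex.Re x + complex.Re y by case: x; case: y.
have ImD (x y : C) : complex.Im (x + y) = complex.Im x + complex.Im y by case: x; case: y.
under eq_Rintegral do rewrite ReD.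
under [X in (_ +i* X)%C]eq_Rintegral do rewrite ImD.
by rewrite !RintegralD//; auto.
Qed.

Lemma cintZ (k : C) F a b : continuous F ->
  cint (fun x => k * F x) a b = k * cint F a b.
Proof.
move=> cF; rewrite /cint; case: k => u v.
have ReM (z : C) : complex.Re ((u +i* v)%C * z) = u * complex.Re z + (- v) * complex.Im z.
  by case: z => ? ? /=; rewrite mulNr.
have ImM (z : C) : complex.Im ((u +i* v)%C * z) = u * complex.Im z + v * complex.Re z.
  by case: z => p q /=.
have cR : continuous (fun x => complex.Re (F x) : R) by exact: continuous_Re.
have cI : continuous (fun x => complex.Im (F x) : R) by exact: continuous_Im.
have cM (w : R) (f : R -> R) : continuous f -> mu.-integrable `[a, b] (EFin \o (fun x => w * f x)).
  move=> cf; apply: continuous_integrable => x; apply: cvgM; [exact: cvg_cst|exact: cf].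
under eq_Rintegral do rewrite ReM.
under [X in (_ +i* X)%C]eq_Rintegral do rewrite ImM.
rewrite !RintegralD//; try exact: cM.
rewrite !RintegralZl//; auto.
by apply/eqP; rewrite eq_complex/=; apply/andP; split; apply/eqP; ring.
Qed.

Lemma cint_cst (k : C) a b : a <= b -> cint (fun=> k) a b = k * (b - a)%:C%C.
Proof.
move=> ab; rewrite /cint !Rintegral_cst//= lebesgue_measure_itv/= lte_fin.
have -> : fine (if (a < b)%R then (b%:E - a%:E)%E else 0%E) = b - a.
  case: ltP => //= ba; apply/eqP; rewrite eq_sym subr_eq0.
  by rewrite eq_le ab ba.
by case: k => u v; apply/eqP; rewrite eq_complex/=; apply/andP; split; apply/eqP; ring.
Qed.

Lemma cint_split F a m b : continuous F -> a <= m -> m <= b ->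
  cint F a b = cint F a m + cint F m b.
Proof.
move=> cF am mb.
have h (f : R -> R) : continuous f -> \int[mu]_(x in `[a, b]) f x =
    \int[mu]_(x in `[a, m]) f x + \int[mu]_(x in `[m, b]) f x.
  move=> cf; rewrite -(@Rintegral_itv_obnd_cbnd _ m); last first.
    apply: integrableS (@continuous_integrable f m b cf) => //.
    by apply: subset_itvr; rewrite bnd_simp.
  rewrite -(@Rintegral_itvB _ f (BLeft a) (BRight b) m) ?bnd_simp//.
    by rewrite addrC subrK.
  exact: continuous_integrable.
by rewrite /cint !h//; [exact: continuous_Im|exact: continuous_Re].
Qed.

(** The factor 2 comes from bounding the real and the imaginary parts of the
    integral separately. *)
Lemma normc_cint_le F a b : continuous F ->
  normc (cint F a b) <= 2 * \int[mu]_(x in `[a, b]) normc (F x).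
Proof.
move=> cF; rewrite (le_trans (normc_le_ReIm _))//= mulr_natl mulr2n lerD//.
  rewrite (le_trans (le_normr_Rintegral _ (iRe _ _ cF)))// le_Rintegral//.
  - apply: continuous_integrable => x; apply: cvg_norm; exact: continuous_Re.
  - by apply: continuous_integrable; exact: continuous_normc.
  - by move=> x _; exact: Re_le_normc.
rewrite (le_trans (le_normr_Rintegral _ (iIm _ _ cF)))// le_Rintegral//.
- apply: continuous_integrable => x; apply: cvg_norm; exact: continuous_Im.
- by apply: continuous_integrable; exact: continuous_normc.
- by move=> x _; exact: Im_le_normc.
Qed.

Lemma normc_cint_leM F a b M : continuous F -> a <= b ->
  (forall x, a <= x <= b -> normc (F x) <= M) ->
  normc (cint F a b) <= 2 * M * (b - a).
Proof.
move=> cF ab FM; rewrite (le_trans (normc_cint_le _ _ cF))// -mulrA ler_wpM2l//.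
have -> : M * (b - a) = \int[mu]_(x in `[a, b]) M.
  rewrite Rintegral_cst//= lebesgue_measure_itv/= lte_fin; congr (_ * _).
  case: ltP => //= ba; apply/eqP; rewrite subr_eq0.
  by rewrite eq_le ab ba.
apply: le_Rintegral => //.
- by apply: continuous_integrable; exact: continuous_normc.
- by apply: continuous_integrable => x; exact: cvg_cst.
Qed.

End complex_integral.

(** * Goursat's theorem on rectangles *)

Section goursat.
Context (R : realType).
Local Notation C := R[i].
Local Notation normc := (@Normc.normc R).
Local Notation mu := (@lebesgue_measure R).
Implicit Types g h : C^o -> C^o.

(** The contour integral of g over the counterclockwise boundary of
    [a, b] x [c, d]. Opposite sides are paired under one integral, so that an
    affine g has a constant integrand on each of them. *)
Definition rint (g : C -> C) (a b c d : R) : C :=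
  cint (fun x => g (x +i* c)%C - g (x +i* d)%C) a b +
  'i%C * cint (fun y => g (b +i* y)%C - g (a +i* y)%C) c d.

Lemma continuous_hslice g c : continuous g -> continuous (fun x : R => g (x +i* c)%C : C^o).
Proof.
move=> cg x; apply: (@continuous_comp _ _ _ (fun x : R => (x +i* c)%C : C^o) g).
  exact: continuous_hline.
exact: cg.
Qed.

Lemma continuous_vslice g c : continuous g -> continuous (fun x : R => g (c +i* x)%C : C^o).
Proof.
move=> cg x; apply: (@continuous_comp _ _ _ (fun x : R => (c +i* x)%C : C^o) g).
  exact: continuous_vline.
exact: cg.
Qed.

Let cB (F G : R -> C^o) : continuous F -> continuous G ->
  continuous (fun x => F x - G x : C^o).
Proof. by move=> cF cG x; apply: cvgB; [exact: cF|exact: cG]. Qed.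

Let chB g c d : continuous g -> continuous (fun x : R => g (x +i* c)%C - g (x +i* d)%C : C^o).
Proof. by move=> cg; apply: cB; exact: continuous_hslice. Qed.

Let cvB g a b : continuous g -> continuous (fun x : R => g (b +i* x)%C - g (a +i* x)%C : C^o).
Proof. by move=> cg; apply: cB; exact: continuous_vslice. Qed.

Lemma rintD g h a b c d : continuous g -> continuous h ->
  rint (fun z => g z + h z) a b c d = rint g a b c d + rint h a b c d.
Proof.
move=> cg ch; rewrite /rint addrACA -mulrDr -!cintD//; [|by auto..].
by congr (_ + _ * _); apply: cint_ext => x _; rewrite opprD addrACA.
Qed.

Lemma cplxE (x y : R) : (x +i* y)%C = x%:C%C + 'i%C * y%:C%C.
Proof.
by apply/eqP; rewrite eq_complex/= !(mul0r, mul1r, mulr0, subr0, addr0, add0r) !eqxx.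
Qed.

Lemma rint_affine (k D p : C) a b c d : a <= b -> c <= d ->
  rint (fun z => k + D * (z - p)) a b c d = 0.
Proof.
move=> ab cd; rewrite /rint.
rewrite (@cint_ext _ _ (fun=> D * 'i%C * (c - d)%:C%C)); last first.
  by move=> x _; rewrite (cplxE x c) (cplxE x d) rmorphB/=; ring.
rewrite [X in _ + 'i%C * X](@cint_ext _ _ (fun=> D * (b - a)%:C%C)); last first.
  by move=> y _; rewrite (cplxE b y) (cplxE a y) rmorphB/=; ring.
rewrite !cint_cst// -[c - d]opprB rmorphN/=; ring.
Qed.

Lemma rint_splitx g a m b c d : continuous g -> a <= m -> m <= b ->
  rint g a b c d = rint g a m c d + rint g m b c d.
Proof.
move=> cg am mb; rewrite /rint (cint_split _ am mb); last exact: chB.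
rewrite addrACA -mulrDr -cintD; [|exact: cvB..].
by congr (_ + _ * _); apply: cint_ext => y _; rewrite [RHS]addrC addrA subrK.
Qed.

Lemma rint_splity g a b c m d : continuous g -> c <= m -> m <= d ->
  rint g a b c d = rint g a b c m + rint g a b m d.
Proof.
move=> cg am mb; rewrite /rint (cint_split _ am mb); last exact: cvB.
rewrite mulrDr addrACA -cintD; [|exact: chB..].
by congr (_ + _); apply: cint_ext => y _; rewrite addrA subrK.
Qed.

Lemma normc_rint_le g a b c d M : continuous g -> a <= b -> c <= d ->
  (forall z : C, a <= complex.Re z <= b -> c <= complex.Im z <= d -> normc (g z) <= M) ->
  normc (rint g a b c d) <= 4 * M * ((b - a) + (d - c)).
Proof.
move=> cg ab cd gM; rewrite /rint (le_trans (normcD _ _))// Normc.normcM normc_i mul1r.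
rewrite mulrDr lerD// (_ : 4 * M = 2 * (M + M)); try ring.
  apply: normc_cint_leM => //; first exact: chB.
  by move=> x xab; rewrite (le_trans (normcB _ _))// lerD// gM//= ?lexx ?cd.
apply: normc_cint_leM => //; first exact: cvB.
by move=> x xab; rewrite (le_trans (normcB _ _))// lerD// gM//= ?lexx ?ab.
Qed.


(** [frechet_ball] and [ball_frechet] unfold Frechet differentiability into an
    epsilon-delta statement with real epsilon and delta. *)
Lemma frechet_ball (V : normedModType C) (f : V -> C^o) z : differentiable f z ->
  forall e : R, 0 < e -> exists2 r : R, 0 < r & forall v, `|v| < r%:C%C ->
    (normc (f (v + z) - (f z + 'd f z v)))%:C%C <= e%:C%C * `|v|.
Proof.
move=> /diff_locally /eqaddoP fz e e0.
have e0C : 0 < e%:C%C by rewrite ltcR.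
have /nbhs_ballP[r /= r0 rf] := fz _ e0C.
have rE : r = (complex.Re r)%:C%C by rewrite RRe_real// ger0_real// ltW.
exists (complex.Re r); first by rewrite -ltcR -rE.
move=> v; rewrite -rE => vr; have := rf v.
by rewrite -ball_normE/= sub0r normrN; exact.
Qed.

Lemma ball_frechet (V : normedModType C) (f : V -> C^o) z (L : {linear V -> C^o}) :
  continuous L ->
  (forall e : R, 0 < e -> exists2 r : R, 0 < r & forall v, `|v| < r%:C%C ->
    (normc (f (v + z) - (f z + L v)))%:C%C <= e%:C%C * `|v|) ->
  differentiable f z.
Proof.
move=> cL fL.
have fE : f \o shift z = cst (f z) + L +o_ 0 id.
  apply/eqaddoP => e e0.
  have eE : e = (complex.Re e)%:C%C by rewrite RRe_real// ger0_real// ltW.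
  have [|r r0 rf] := fL (complex.Re e); first by rewrite -ltcR -eE.
  apply/nbhs_ballP; exists r%:C%C; first by rewrite /= ltcR.
  by move=> v; rewrite -ball_normE/= sub0r normrN => /rf; rewrite -eE.
apply/diff_locallyP; have -> : 'd f z = L :> (V -> C^o) by exact: diff_unique fE.
by split.
Qed.

Lemma frechet_ball1 g (p : C^o) : differentiable g p ->
  exists D : C, forall e : R, 0 < e -> exists2 r : R, 0 < r &
    forall w : C, normc (w - p) < r ->
      normc (g w - (g p + D * (w - p))) <= e * normc (w - p).
Proof.
move=> dg; exists ('d g p 1) => e e0.
have [r r0 rg] := frechet_ball dg e0.
exists r => // w wr.
have := rg (w - p); rewrite (@subrK C) normc_absE ltcR => /(_ wr).
rewrite -rmorphM lecR.
have -> // : 'd g p (w - p) = 'd g p 1 * (w - p).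
transitivity ('d g p ((w - p : C) *: (1 : C^o))).
  by congr ('d g p _); rewrite /GRing.scale/= mulr1.
by rewrite linearZ/= mulrC.
Qed.

(** The boundary integrals of the four quarters of a rectangle add up to that of
    the rectangle, so one of them has at least a quarter of its modulus. *)
Lemma rint_quarter g (a c w h : R) : continuous g -> 0 <= w -> 0 <= h ->
  exists p : R * R, [/\ a <= p.1, p.1 + w / 2 <= a + w, c <= p.2, p.2 + h / 2 <= c + h &
    normc (rint g a (a + w) c (c + h)) / 4 <=
    normc (rint g p.1 (p.1 + w / 2) p.2 (p.2 + h / 2))].
Proof.
move=> cg w0 h0.
have w2 : 0 <= w / 2 by rewrite divr_ge0.
have h2 : 0 <= h / 2 by rewrite divr_ge0.
have wE : w / 2 + w / 2 = w by rewrite -splitr.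
have hE : h / 2 + h / 2 = h by rewrite -splitr.
pose J a c := rint g a (a + w / 2) c (c + h / 2).
have JE : rint g a (a + w) c (c + h) =
    (J a c + J a (c + h / 2)) + (J (a + w / 2) c + J (a + w / 2) (c + h / 2)).
  rewrite /J -!addrA wE hE.
  rewrite (@rint_splitx g _ (a + w / 2)) ?lerD2l ?lerDl//; last first.
    by rewrite -[leRHS]wE lerDl.
  have ch : c + h / 2 <= c + h by rewrite lerD2l -[leRHS]hE lerDl.
  have c2 : c <= c + h / 2 by rewrite lerDl.
  rewrite (@rint_splity g a _ c (c + h / 2) (c + h))//.
  by rewrite (@rint_splity g (a + w / 2) _ c (c + h / 2) (c + h))// !addrA.
apply: contrapT => /forallNP no.
have lt x y : a <= x -> x + w / 2 <= a + w -> c <= y -> y + h / 2 <= c + h ->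
    normc (J x y) < normc (rint g a (a + w) c (c + h)) / 4.
  by move=> ? ? ? ?; rewrite ltNge; apply/negP => ?; apply: (no (x, y)); split.
have : normc (rint g a (a + w) c (c + h)) < normc (rint g a (a + w) c (c + h)).
  rewrite {1}JE; set t := normc (rint _ _ _ _ _) in lt *.
  have -> : t = (t / 4 + t / 4) + (t / 4 + t / 4) by field.
  have aw : a + w / 2 <= a + w by rewrite lerD2l -[leRHS]wE lerDl.
  have ch : c + h / 2 <= c + h by rewrite lerD2l -[leRHS]hE lerDl.
  have aww : a + w / 2 + w / 2 <= a + w by rewrite -addrA wE.
  have chh : c + h / 2 + h / 2 <= c + h by rewrite -addrA hE.
  have a2 : a <= a + w / 2 by rewrite lerDl.
  have c2 : c <= c + h / 2 by rewrite lerDl.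
  rewrite (le_lt_trans (normcD _ _))// ltrD//; rewrite (le_lt_trans (normcD _ _))// ltrD//; exact: lt.
by rewrite ltxx.
Qed.

(** Bisection yields nested rectangles R_n shrinking to a point p, with a
    boundary integral of modulus at least |I| / 4^n. Removing from g its affine
    approximation at p does not change that integral, and what is left is at
    most e times the diameter on R_n for large n; the integral is then at most
    a constant times e / 4^n, for every e > 0. *)
Theorem goursat g a b c d : continuous g -> a <= b -> c <= d ->
  (forall z : C^o, a <= complex.Re z <= b -> c <= complex.Im z <= d -> differentiable g z) ->
  rint g a b c d = 0.
Proof.
move=> cg ab cd dg.
have close (u l x y : R) : u <= x <= u + l -> u <= y <= u + l -> `|y - x| <= l.
  by move=> /andP[? ?] /andP[? ?]; rewrite ler_norml; apply/andP; split; lra.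
pose w := b - a; pose h := d - c.
have w0 : 0 <= w by rewrite subr_ge0.
have h0 : 0 <= h by rewrite subr_ge0.
pose W n := w / 2 ^+ n; pose H n := h / 2 ^+ n.
have W0 n : 0 <= W n by rewrite divr_ge0// exprn_ge0.
have H0 n : 0 <= H n by rewrite divr_ge0// exprn_ge0.
have step (q : nat * (R * R)) : exists p : R * R,
    [/\ q.2.1 <= p.1, p.1 + W q.1.+1 <= q.2.1 + W q.1,
        q.2.2 <= p.2, p.2 + H q.1.+1 <= q.2.2 + H q.1 &
    normc (rint g q.2.1 (q.2.1 + W q.1) q.2.2 (q.2.2 + H q.1)) / 4 <=
    normc (rint g p.1 (p.1 + W q.1.+1) p.2 (p.2 + H q.1.+1))].
  have WS n : W n.+1 = W n / 2 by rewrite /W exprSr invfM mulrA.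
  have HS n : H n.+1 = H n / 2 by rewrite /H exprSr invfM mulrA.
  by rewrite WS HS; exact: (rint_quarter _ _ cg (W0 _) (H0 _)).
have [F FP] := choice step.
pose s := fix s n := if n is n'.+1 then F (n', s n') else (a, c).
have sP n := FP (n, s n).
have sx n : a <= (s n).1 /\ (s n).1 + W n <= b.
  elim: n => [|n [n1 n2]]; first by rewrite /W expr0 divr1 addrC subrK.
  have [x1 x2 _ _ _] := sP n; split; [exact: le_trans x1|exact: le_trans n2].
have sy n : c <= (s n).2 /\ (s n).2 + H n <= d.
  elim: n => [|n [n1 n2]]; first by rewrite /H expr0 divr1 addrC subrK.
  have [_ _ x1 x2 _] := sP n; split; [exact: le_trans x1|exact: le_trans n2].
have s1mono n m : (n <= m)%N -> (s n).1 <= (s m).1 /\ (s m).1 + W m <= (s n).1 + W n.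
  move=> /subnK <-; elim: (m - n)%N => [//|k [k1 k2]]; rewrite addSn.
  have [x1 x2 _ _ _] := sP (k + n)%N; split; [exact: le_trans x1|exact: le_trans k2].
have s2mono n m : (n <= m)%N -> (s n).2 <= (s m).2 /\ (s m).2 + H m <= (s n).2 + H n.
  move=> /subnK <-; elim: (m - n)%N => [//|k [k1 k2]]; rewrite addSn.
  have [_ _ x1 x2 _] := sP (k + n)%N; split; [exact: le_trans x1|exact: le_trans k2].
have nested (u V : R^nat) : (forall n, 0 <= V n) ->
    (forall n m, (n <= m)%N -> u n <= u m /\ u m + V m <= u n + V n) ->
    exists p, forall n, u n <= p <= u n + V n.
  move=> V0 uV; exists (sup (range u)) => n.
  have ub m : ubound (range u) (u m + V m).
    move=> _ [k _ <-]; have [km|/ltnW mk] := leqP k m.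
      by rewrite (le_trans (uV _ _ km).1)// lerDl.
    by rewrite (le_trans _ (uV _ _ mk).2)// lerDl.
  apply/andP; split; first by apply: ub_le_sup; [exists (u 0 + V 0)|exists n].
  by apply: ge_sup => //; exists (u n), n.
have [p1 p1P] := nested (fun n => (s n).1) W W0 s1mono.
have [p2 p2P] := nested (fun n => (s n).2) H H0 s2mono.
have Iquart n : normc (rint g a b c d) / 4 ^+ n <=
    normc (rint g (s n).1 ((s n).1 + W n) (s n).2 ((s n).2 + H n)).
  elim: n => [|n ih].
    by rewrite /W /H expr0 !divr1 ![_ + (_ - _)]addrC !subrK.
  have [_ _ _ _] := sP n; apply: le_trans.
  by rewrite exprSr invfM mulrA ler_wpM2r.
have [] := frechet_ball1 (dg (p1 +i* p2)%C _ _).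
- have [x1 x2] := sx 0%N; have /andP[y1 y2] := p1P 0%N.
  by rewrite /= (le_trans x1)//= (le_trans y2).
- have [x1 x2] := sy 0%N; have /andP[y1 y2] := p2P 0%N.
  by rewrite /= (le_trans x1)//= (le_trans y2).
move=> D; set p : C := (p1 +i* p2)%C => gD.
have small e : 0 < e -> normc (rint g a b c d) <= 4 * (e * (w + h) * (w + h)).
  move=> e0; have [r r0 rg] := gD e e0.
  have [n nr] : exists n, W n + H n < r.
    have := @cvg_expr R (2^-1); rewrite ger0_norm ?invr_ge0// invf_lt1// ltr1n => /(_ isT).
    move=> /cvgrPdist_lt /(_ (r / (w + h + 1))).
    have wh1 : 0 < w + h + 1 by rewrite ltr_wpDl// addr_ge0.
    rewrite divr_gt0// => /(_ isT)[n _ /(_ n (leqnn n))] /=.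
    rewrite sub0r normrN ger0_norm ?exprn_ge0 ?invr_ge0// exprVn => nr; exists n.
    rewrite /W /H -mulrDl (@le_lt_trans _ _ ((w + h + 1) / 2 ^+ n))//.
      by rewrite ler_wpM2r ?invr_ge0 ?exprn_ge0// lerDl.
    by rewrite mulrC -ltr_pdivlMr.
  set L := W n + H n in nr.
  have L0 : 0 <= L by rewrite addr_ge0.
  have LE : L = (w + h) / 2 ^+ n by rewrite /L /W /H -mulrDl.
  pose q z : C^o := g z + (- g p + (- D) * (z - p)).
  have caff : continuous (fun z : C^o => - g p + (- D) * (z - p) : C^o).
    move=> z; apply: (@cfunD R C^o (fun=> - g p) (fun z => - D * (z - p))).
      exact: cfun_cst.
    apply: (@cfunM R C^o (fun=> - D) (fun z => z - p)); first exact: cfun_cst.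
    by apply: (@cfunB R C^o (fun z => z) (fun=> p)); [exact: cfun_id|exact: cfun_cst].
  have cq : continuous q.
    by move=> z; apply: (@cfunD R C^o g (fun z => - g p + - D * (z - p))); [exact: cg|exact: caff].
  have x0 : (s n).1 <= (s n).1 + W n by rewrite lerDl.
  have y0 : (s n).2 <= (s n).2 + H n by rewrite lerDl.
  have := @rintD g (fun z => - g p + (- D) * (z - p)) (s n).1 ((s n).1 + W n) (s n).2 ((s n).2 + H n) cg caff.
  rewrite rint_affine// addr0 => rq.
  have := Iquart n; rewrite -rq => /le_trans/(_ (normc_rint_le (M := e * L) cq x0 y0 _)).
  rewrite ler_pdivrMr ?exprn_gt0// => h1; rewrite (le_trans (h1 _))//; last first.
    rewrite (_ : _ + _ = L); last by rewrite /L; ring.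
    rewrite LE (_ : 4 = 2 * 2) ?exprMn -?natrM//.
    have t0 : 2 ^+ n != 0 :> R by rewrite expf_neq0.
    by rewrite le_eqVlt; apply/orP; left; apply/eqP; field.
  move=> z zx zy.
  have zp : normc (z - p) <= L.
    rewrite (le_trans (normc_le_ReIm _))// lerD//.
      have -> : complex.Re (z - p) = complex.Re z - p1 by case: (z).
      exact: (close _ _ _ _ (p1P n) zx).
    have -> : complex.Im (z - p) = complex.Im z - p2 by case: (z).
    exact: (close _ _ _ _ (p2P n) zy).
  have := rg z (le_lt_trans zp nr).
  rewrite opprD -mulNr; move/le_trans; apply; rewrite ler_wpM2l//; exact: ltW.
apply: Normc.eq0_normc; apply/eqP; rewrite eq_le normc_ge0 andbT.
apply/ler_addgt0Pl => e e0; rewrite addr0.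
have e' : 0 < e / (4 * ((w + h) * (w + h)) + 1).
  by rewrite divr_gt0// ltr_wpDl// !mulr_ge0// addr_ge0.
rewrite (le_trans (small _ e'))//; set X := 4 * _ in e' *.
rewrite (_ : 4 * _ = e * (X / (X + 1))); last by rewrite /X; ring.
by rewrite ger_pMr// ler_pdivrMr ?mul1r ?lerDl// ltr_wpDl// !mulr_ge0// addr_ge0.
Qed.

End goursat.

(** * Removable points and difference quotients *)

Section cauchy.
Context (R : realType).
Local Notation C := R[i].
Local Notation normc := (@Normc.normc R).
Local Notation mu := (@lebesgue_measure R).
Implicit Types g h : C^o -> C^o.

Lemma rint_degenx g a c d : continuous g -> rint g a a c d = 0.
Proof.
move=> cg; have := @rint_splitx _ g a a a c d cg (lexx _) (lexx _).
by move=> /eqP; rewrite -subr_eq0 opprD addrA subrr sub0r oppr_eq0 => /eqP.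
Qed.

Lemma rint_degeny g a b c : continuous g -> rint g a b c c = 0.
Proof.
move=> cg; have := @rint_splity _ g a b c c c cg (lexx _) (lexx _).
by move=> /eqP; rewrite -subr_eq0 opprD addrA subrr sub0r oppr_eq0 => /eqP.
Qed.

Definition in_rect (a b c d : R) (z : C) : Prop :=
  a <= complex.Re z <= b /\ c <= complex.Im z <= d.

(** Removable points: four cuts reduce the boundary integral to that of a square
    about p, which tends to 0 with its side because g is bounded near p. The
    predicate A restricts the rectangles under consideration, so that several
    points can be removed one after the other. *)
Lemma rint_removable g (p : C^o) (A : R -> R -> R -> R -> Prop) : continuous g ->
  (forall a b c d a' b' c' d', A a b c d -> a <= a' -> b' <= b -> c <= c' -> d' <= d -> A a' b' c' d') ->
  (forall a b c d, A a b c d -> a <= b -> c <= d -> ~ in_rect a b c d p -> rint g a b c d = 0) ->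
  forall a b c d, A a b c d -> a <= b -> c <= d -> rint g a b c d = 0.
Proof.
move=> cg Asub g0 a b c d aA ab cd.
have [[/andP[pa pb] /andP[pc pd]]|nin] := pselect (in_rect a b c d p); last exact: g0.
have /continuous_ballP/(_ 1 ltr01)[r r0 rg] := cg p.
pose M := normc (g p) + 1.
have M0 : 0 < M by rewrite ltr_wpDl// normc_ge0.
apply: Normc.eq0_normc; apply/eqP; rewrite eq_le normc_ge0 andbT.
apply/ler_addgt0Pl => e e0; rewrite addr0.
pose n := Num.min (r / 4) (e / (16 * M)).
have n0 : 0 < n by rewrite lt_min !divr_gt0// mulr_gt0.
pose a' := Num.max a (complex.Re p - n); pose b' := Num.min b (complex.Re p + n).
pose c' := Num.max c (complex.Im p - n); pose d' := Num.min d (complex.Im p + n).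
have aa' : a <= a' by rewrite le_max lexx.
have bb' : b' <= b by rewrite ge_min lexx.
have cc' : c <= c' by rewrite le_max lexx.
have dd' : d' <= d by rewrite ge_min lexx.
have a'p : complex.Re p - n <= a' <= complex.Re p.
  by rewrite le_max lexx orbT/= ge_max pa gerBl ltW.
have b'p : complex.Re p <= b' <= complex.Re p + n.
  by rewrite ge_min lexx orbT/= le_min pb lerDl ltW.
have c'p : complex.Im p - n <= c' <= complex.Im p.
  by rewrite le_max lexx orbT/= ge_max pc gerBl ltW.
have d'p : complex.Im p <= d' <= complex.Im p + n.
  by rewrite ge_min lexx orbT/= le_min pd lerDl ltW.
move: (a'p) (b'p) (c'p) (d'p) => /andP[a1 a2] /andP[b1 b2] /andP[c1 c2] /andP[d1 d2].
have ab' : a' <= b' by exact: le_trans b1.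
have cd' : c' <= d' by exact: le_trans d1.
rewrite (@rint_splitx _ g a a' b)//; last exact: le_trans bb'.
rewrite (@rint_splitx _ g a' b' b)//.
(* the part left of a' is degenerate, or avoids p as a' = Re p - n there *)
have -> : rint g a a' c d = 0.
  rewrite {1}/a'; case: (leP a (complex.Re p - n)) => [ap|_]; last exact: rint_degenx.
  apply: g0 => //; first by apply: (Asub _ _ _ _ _ _ _ _ aA) => //; rewrite (le_trans _ pb)// gerBl ltW.
  by case=> /andP[_]; rewrite leNgt ltrBlDr ltrDl n0.
have -> : rint g b' b c d = 0.
  rewrite {1}/b'; case: (leP b (complex.Re p + n)) => [_|/ltW bp]; first exact: rint_degenx.
  apply: g0 => //; first by apply: (Asub _ _ _ _ _ _ _ _ aA) => //; rewrite (le_trans pa)// lerDl ltW.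
  by case=> /andP[]; rewrite leNgt ltrDl n0.
rewrite add0r addr0.
rewrite (@rint_splity _ g a' b' c c' d)//; last exact: le_trans dd'.
rewrite (@rint_splity _ g a' b' c' d' d)//.
have aA' : A a' b' c d by exact: (Asub _ _ _ _ _ _ _ _ aA).
have -> : rint g a' b' c c' = 0.
  rewrite {1}/c'; case: (leP c (complex.Im p - n)) => [ap|_]; last exact: rint_degeny.
  apply: g0 => //; first by apply: (Asub _ _ _ _ _ _ _ _ aA') => //; rewrite (le_trans _ pd)// gerBl ltW.
  by case=> _ /andP[_]; rewrite leNgt ltrBlDr ltrDl n0.
have -> : rint g a' b' d' d = 0.
  rewrite {1}/d'; case: (leP d (complex.Im p + n)) => [_|/ltW bp]; first exact: rint_degeny.
  apply: g0 => //; first by apply: (Asub _ _ _ _ _ _ _ _ aA') => //; rewrite (le_trans pc)// lerDl ltW.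
  by case=> _ /andP[]; rewrite leNgt ltrDl n0.
rewrite add0r addr0.
have nr : n <= r / 4 by rewrite ge_min lexx.
have ne : n <= e / (16 * M) by rewrite ge_min lexx orbT.
rewrite (le_trans (normc_rint_le (M := M) cg ab' cd' _))//.
  move=> z /andP[z1 z2] /andP[z3 z4].
  have : normc (g z - g p) < 1.
    apply: rg; rewrite normc_distC.
    rewrite (le_lt_trans (normc_le_ReIm _))//.
    have -> : complex.Re (p - z) = complex.Re p - complex.Re z by case: (p); case: (z).
    have -> : complex.Im (p - z) = complex.Im p - complex.Im z by case: (p); case: (z).
    rewrite (@le_lt_trans _ _ (n + n))//; last lra.
    by rewrite lerD// ler_norml; apply/andP; split; lra.
  move=> h; rewrite /M -[X in normc X](subrK (g p)) (le_trans (normcD _ _))// addrC lerD2l.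
  exact: ltW.
apply: (@le_trans _ _ (4 * M * (2 * n + 2 * n))).
  by rewrite ler_wpM2l ?mulr_ge0 ?(ltW M0)//; lra.
rewrite (_ : 4 * M * (2 * n + 2 * n) = n * (16 * M)); last by clearbody n M; ring.
by rewrite -ler_pdivlMr// mulr_gt0.
Qed.

Lemma goursat_punctured g (p q : C^o) a b c d : continuous g -> a <= b -> c <= d ->
  (forall z, z != p -> z != q -> differentiable g z) ->
  rint g a b c d = 0.
Proof.
move=> cg + + dg.
apply: (@rint_removable g p (fun _ _ _ _ => True)) => // {}a {}b {}c {}d _ + + np.
move: np; apply: (@rint_removable g q (fun a b c d => ~ in_rect a b c d p)) => //.
  move=> a1 b1 c1 d1 a2 b2 c2 d2 np aa bb cc dd [/andP[x1 x2] /andP[y1 y2]]; apply: np.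
  by split; apply/andP; split; [exact: le_trans x1|exact: le_trans bb|exact: le_trans y1|exact: le_trans dd].
move=> {}a {}b {}c {}d np ab cd nq; apply: goursat; [exact: cg|exact: ab|exact: cd|].
  move=> z zx zy; apply: dg.
  by apply: contra_notN np => /eqP <-; split.
by apply: contra_notN nq => /eqP <-; split.
Qed.

Section diffquot.
Context (g : C^o -> C^o) (a : C^o).
Hypotheses (cg : continuous g) (dga : differentiable g a).

(** The difference quotient, extended at a by the derivative of g. It is only
    known to be continuous at a, which suffices for Goursat's theorem with
    removable points. *)
Lemma diffquot_ex : exists q : C^o -> C^o, [/\ continuous q,
  forall z, z != a -> q z = (g z - g a) * (z - a)^-1 &
  forall z, z != a -> differentiable g z -> differentiable q z].
Proof.
have [D gD] := frechet_ball1 dga.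
pose q z : C^o := if z == a then D else (g z - g a) * (z - a)^-1.
have qE z : z != a -> q z = (g z - g a) * (z - a)^-1 by rewrite /q => /negPf->.
have near_ne (z : C^o) : z != a -> \forall w \near z, w != a.
  move=> za; apply/nbhs_ballP; exists `|z - a|.
    by rewrite /= normr_gt0 subr_eq0.
  by move=> w; rewrite -ball_normE/=; apply: contraTN => /eqP ->; rewrite ltxx.
have qN z : z != a -> {near z, (fun w => (g w - g a) * (w - a)^-1) =1 q}.
  by move=> /near_ne; apply: filterS => w /qE.
exists q; split; [|exact: qE|].
- move=> z; have [->|za] := eqVneq z a.
    apply/continuous_ballP => e e0; have e2 : 0 < e / 2 by rewrite divr_gt0.
    have [r r0 rg] := gD _ e2; exists r => // w /rg h.
    rewrite /q eqxx; case: eqVneq => [_|wa]; first by rewrite subrr Normc.normc0.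
    have wa0 : w - a != 0 by rewrite subr_eq0.
    have n0 : 0 < normc (w - a).
      rewrite lt_neqAle normc_ge0 andbT eq_sym; apply: contra wa0 => /eqP.
      by move=> /Normc.eq0_normc ->.
    rewrite (_ : _ - D = (g w - (g a + D * (w - a))) * (w - a)^-1); last by field.
    rewrite Normc.normcM Normc.normcV (le_lt_trans (y := e / 2))//; last lra.
    by rewrite ler_pdivrMr.
  have qz : {for z, continuous (fun w => (g w - g a) * (w - a)^-1 : C^o)}.
    apply: (@cfunM R C^o (fun w => g w - g a) (fun w => (w - a)^-1)).
      by apply: (@cfunB R C^o g (fun=> g a)); [exact: cg|exact: cfun_cst].
    apply: (@cfunV R C^o (fun w => w - a)); first by rewrite subr_eq0.
    by apply: (@cfunB R C^o (fun w => w) (fun=> a)); [exact: cfun_id|exact: cfun_cst].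
  rewrite /continuous_at qE//.
  apply: cvg_trans qz; exact: (near_eq_cvg (FF := nbhs_filter z) (qN z za)).
- move=> z za dg; apply/derivable1_diffP.
  apply: (near_eq_derivable (qN z za)); apply/derivable1_diffP.
  apply: (@differentiableM C C^o).
    by apply: (@differentiableB C C^o C^o g (cst (g a))); [exact: dg|exact: differentiable_cst].
  apply: (@differentiableV C C^o); last by rewrite subr_eq0.
  by apply: (@differentiableB C C^o C^o id (cst a)); [exact: ex_diff|exact: differentiable_cst].
Qed.
End diffquot.

End cauchy.

(** * Cauchy's formula on rectangles *)

Section cauchy_formula.
Context (R : realType).
Local Notation C := R[i].
Local Notation normc := (@Normc.normc R).
Local Notation mu := (@lebesgue_measure R).
Implicit Types g h : C^o -> C^o.

(** The Cauchy kernel. *)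
Let k (a z : C) : C := (z - a)^-1.

Let hne (a : C) (x t : R) : t != complex.Im a -> (x +i* t)%C - a != 0 :> C.
Proof. by apply: contraNneq => /eqP; rewrite subr_eq0 => /eqP <-. Qed.

Let vne (a : C) (x t : R) : t != complex.Re a -> (t +i* x)%C - a != 0 :> C.
Proof. by apply: contraNneq => /eqP; rewrite subr_eq0 => /eqP <-. Qed.

Let ckh (a : C) t : t != complex.Im a -> continuous (fun x : R => k a (x +i* t)%C : C^o).
Proof.
move=> ta x; apply: (@cfunV R R (fun x : R => (x +i* t)%C - a : C^o)); first exact: hne.
by apply: (@cfunB R R (fun x : R => (x +i* t)%C : C^o) (fun=> a)); [exact: continuous_hline|exact: cfun_cst].
Qed.

Let ckv (a : C) t : t != complex.Re a -> continuous (fun x : R => k a (t +i* x)%C : C^o).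
Proof.
move=> ta x; apply: (@cfunV R R (fun x : R => (t +i* x)%C - a : C^o)); first exact: vne.
by apply: (@cfunB R R (fun x : R => (t +i* x)%C : C^o) (fun=> a)); [exact: continuous_vline|exact: cfun_cst].
Qed.

(** The integral of (g z - g a) / (z - a) vanishes, by Goursat's theorem with the
    removable points a and b. The value of the integral of the kernel is left
    unevaluated. *)
Lemma cauchy_formula g (a b : C^o) (s1 s2 t1 t2 : R) : continuous g ->
  (forall z, z != b -> differentiable g z) -> a != b ->
  s1 < complex.Re a < s2 -> t1 < complex.Im a < t2 ->
  g a * rint (k a) s1 s2 t1 t2 = rint (fun z => g z * k a z) s1 s2 t1 t2.
Proof.
move=> cg dg ab /andP[s1a s2a] /andP[t1a t2a].
have [q [cq qE dq]] := diffquot_ex cg (dg _ ab).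
have s12 : s1 <= s2 by exact/ltW/(lt_trans s1a).
have t12 : t1 <= t2 by exact/ltW/(lt_trans t1a).
have q0 : rint q s1 s2 t1 t2 = 0.
  apply: (@goursat_punctured _ q a b); [exact: cq|exact: s12|exact: t12|].
  by move=> z za zb; apply: dq; [exact: za|exact: dg].
have cM (F G : R -> C^o) : continuous F -> continuous G -> continuous (fun x => F x * G x : C^o).
  by move=> cF cG x; apply: (@cfunM R R F G); [exact: cF|exact: cG].
have cB (F G : R -> C^o) : continuous F -> continuous G -> continuous (fun x => F x - G x : C^o).
  by move=> cF cG x; apply: (@cfunB R R F G); [exact: cF|exact: cG].
have s1n : s1 != complex.Re a by rewrite lt_eqF.
have s2n : s2 != complex.Re a by rewrite gt_eqF.
have t1n : t1 != complex.Im a by rewrite lt_eqF.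
have t2n : t2 != complex.Im a by rewrite gt_eqF.
have cgh t : continuous (fun x : R => g (x +i* t)%C : C^o) by exact: continuous_hslice.
have cgv t : continuous (fun x : R => g (t +i* x)%C : C^o) by exact: continuous_vslice.
have K1 : continuous (fun x : R => k a (x +i* t1)%C - k a (x +i* t2)%C : C^o).
  by apply: cB; apply: ckh.
have K2 : continuous (fun x : R => k a (s2 +i* x)%C - k a (s1 +i* x)%C : C^o).
  by apply: cB; apply: ckv.
have Q1 : continuous (fun x : R => q (x +i* t1)%C - q (x +i* t2)%C : C^o).
  by apply: cB; exact: continuous_hslice.
have Q2 : continuous (fun x : R => q (s2 +i* x)%C - q (s1 +i* x)%C : C^o).
  by apply: cB; exact: continuous_vslice.
have -> : rint (fun z => g z * k a z) s1 s2 t1 t2 =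
    rint q s1 s2 t1 t2 + g a * rint (k a) s1 s2 t1 t2.
  rewrite /rint mulrDr mulrCA -(cintZ _ _ _ K1) -(cintZ _ _ _ K2) addrACA -mulrDr.
  have cc (F : R -> C^o) : continuous F -> continuous (fun x => g a * F x : C^o).
    by move=> cF; apply: cM; [move=> x; exact: cfun_cst|exact: cF].
  have cK1 := cc _ K1; have cK2 := cc _ K2.
  rewrite -!cintD; [|exact: Q2|exact: cK2|exact: Q1|exact: cK1].
  have e1 z : z - a != 0 -> g z * k a z = q z + g a * k a z.
    by rewrite subr_eq0 => /qE ->; rewrite /k; ring.
  congr (_ + _ * _); apply: cint_ext => x _; rewrite mulrBr addrACA -opprD.
    by rewrite -!e1; [|exact: hne..].
  by rewrite -!e1; [|exact: vne..].
by rewrite q0 add0r.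
Qed.

(** In place of the value 2 i pi, a lower bound on the imaginary part: each of
    the four sides contributes a positive amount, and the two horizontal ones at
    least 1 / 2 together. *)
Lemma kernel_lower (a : C^o) (s1 s2 t1 t2 : R) :
  complex.Re a - 2 <= s1 <= complex.Re a - 1 ->
  complex.Re a + 1 <= s2 <= complex.Re a + 2 ->
  complex.Im a - 2 <= t1 <= complex.Im a - 1 ->
  complex.Im a + 1 <= t2 <= complex.Im a + 2 ->
  1 / 2 <= normc (rint (k a) s1 s2 t1 t2).
Proof.
move=> /andP[s1a s1b] /andP[s2a s2b] /andP[t1a t1b] /andP[t2a t2b].
have s12 : s1 <= s2 by lra.
have kIm (x t : R) : complex.Im (k a (x +i* t)%C) =
    (complex.Im a - t) / ((x - complex.Re a) ^+ 2 + (t - complex.Im a) ^+ 2).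
  by rewrite /k; case: (a) => a1 a2 /=; rewrite -mulNr opprB.
have kRe (x t : R) : complex.Re (k a (x +i* t)%C) =
    (x - complex.Re a) / ((x - complex.Re a) ^+ 2 + (t - complex.Im a) ^+ 2).
  by rewrite /k; case: (a) => a1 a2.
have ImB (x y : C) : complex.Im (x - y) = complex.Im x - complex.Im y by case: x; case: y.
have ReB (x y : C) : complex.Re (x - y) = complex.Re x - complex.Re y by case: x; case: y.
rewrite (le_trans _ (Im_le_normc _))// (le_trans _ (ler_norm _))//.
have -> : complex.Im (rint (k a) s1 s2 t1 t2) =
    \int[mu]_(x in `[s1, s2]) complex.Im (k a (x +i* t1)%C - k a (x +i* t2)%C) +
    \int[mu]_(y in `[t1, t2]) complex.Re (k a (s2 +i* y)%C - k a (s1 +i* y)%C).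
  by rewrite /rint /cint /= !mul0r mul1r add0r.
have n0 (u v : R) : 0 <= (u ^+ 2 + v ^+ 2)^-1.
  by rewrite invr_ge0 addr_ge0 ?sqr_ge0.
rewrite -[leLHS]addr0 lerD//; last first.
  apply: Rintegral_ge0 => y _; rewrite ReB !kRe subr_ge0.
  apply: (@le_trans _ _ 0).
    by apply: mulr_le0_ge0 (n0 _ _); lra.
  by apply: mulr_ge0 (n0 _ _); lra.
have cF : continuous (fun x : R => complex.Im (k a (x +i* t1)%C - k a (x +i* t2)%C) : R).
  apply: continuous_Im => x.
  apply: (@cfunB R R (fun x : R => k a (x +i* t1)%C) (fun x : R => k a (x +i* t2)%C)); apply: ckh.
    by apply/eqP; lra.
  by apply/eqP; lra.
apply: (@le_trans _ _ (\int[mu]_(x in `[s1, s2]) (1 / 4))).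
  rewrite Rintegral_cst//= lebesgue_measure_itv/= lte_fin.
  case: ltP => /= ?; lra.
apply: le_Rintegral => //.
- by apply: continuous_integrable => x; exact: cvg_cst.
- by apply: continuous_integrable.
- move=> x /=; rewrite in_itv/= => /andP[x1 x2]; rewrite ImB !kIm.
  have low (u v : R) : -2 <= u <= 2 -> 1 <= `|v| <= 2 -> 1 / 8 <= `|v| / (u ^+ 2 + v ^+ 2).
    move=> /andP[u1 u2] /andP[v1 v2]; rewrite -(real_normK (num_real v)).
    by rewrite ler_pdivlMr; nra.
  have e1 : complex.Im a - t1 = `|t1 - complex.Im a| by rewrite ler0_norm; lra.
  have e2 : - (complex.Im a - t2) = `|t2 - complex.Im a| by rewrite ger0_norm; lra.
  rewrite e1 -mulNr e2.
  have := low (x - complex.Re a) (t1 - complex.Im a); rewrite -e1 => l1.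
  have := low (x - complex.Re a) (t2 - complex.Im a); rewrite -e2 => l2.
  have -> : 1 / 4 = 1 / 8 + 1 / 8 :> R by lra.
  by rewrite lerD// ?l1// ?l2//; apply/andP; split; lra.
Qed.

(** The sides are at distance at least 1 from a, where the kernel is bounded
    by 1. Each side may be moved independently in a strip of width 1. *)
Lemma cauchy_bound g (a b : C^o) (s1 s2 t1 t2 : R) : continuous g ->
  (forall z, z != b -> differentiable g z) -> a != b ->
  complex.Re a - 2 <= s1 <= complex.Re a - 1 ->
  complex.Re a + 1 <= s2 <= complex.Re a + 2 ->
  complex.Im a - 2 <= t1 <= complex.Im a - 1 ->
  complex.Im a + 1 <= t2 <= complex.Im a + 2 ->
  normc (g a) <= 4 * (\int[mu]_(x in `[s1, s2]) normc (g (x +i* t1)%C) +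
      \int[mu]_(x in `[s1, s2]) normc (g (x +i* t2)%C) +
      (\int[mu]_(y in `[t1, t2]) normc (g (s1 +i* y)%C) +
      \int[mu]_(y in `[t1, t2]) normc (g (s2 +i* y)%C))).
Proof.
move=> cg dg ab Hs1 Hs2 Ht1 Ht2.
move: (Hs1) (Hs2) (Ht1) (Ht2) => /andP[s1a s1b] /andP[s2a s2b] /andP[t1a t1b] /andP[t2a t2b].
have s1n : s1 < complex.Re a by lra.
have s2n : complex.Re a < s2 by lra.
have t1n : t1 < complex.Im a by lra.
have t2n : complex.Im a < t2 by lra.
have K0 := kernel_lower Hs1 Hs2 Ht1 Ht2.
have s12 : s1 <= s2 by lra.
have t12 : t1 <= t2 by lra.
have ga : normc (g a) <= 2 * normc (rint (fun z => g z * k a z) s1 s2 t1 t2).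
  rewrite -(cauchy_formula cg dg ab) ?s1n ?t1n// Normc.normcM mulrCA.
  by rewrite ler_peMr ?normc_ge0//; lra.
rewrite (le_trans ga)// (_ : 4 = 2 * 2) -?mulrA; last lra.
rewrite ler_wpM2l// mulrDr /rint (le_trans (normcD _ _))// Normc.normcM normc_i mul1r.
have cgh t : continuous (fun x : R => g (x +i* t)%C : C^o) by exact: continuous_hslice.
have cgv t : continuous (fun x : R => g (t +i* x)%C : C^o) by exact: continuous_vslice.
have igh t : mu.-integrable `[s1, s2] (EFin \o (fun x => normc (g (x +i* t)%C))).
  by apply: continuous_integrable; apply: continuous_normc; exact: cgh.
have igv t : mu.-integrable `[t1, t2] (EFin \o (fun x => normc (g (t +i* x)%C))).
  by apply: continuous_integrable; apply: continuous_normc; exact: cgv.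
have cMB (F G F' G' : R -> C^o) : continuous F -> continuous G -> continuous F' -> continuous G' ->
    continuous (fun x => F x * G x - F' x * G' x : C^o).
  move=> cF cG cF' cG' x; apply: (@cfunB R R (fun x => F x * G x) (fun x => F' x * G' x)).
    by apply: (@cfunM R R F G); [exact: cF|exact: cG].
  by apply: (@cfunM R R F' G'); [exact: cF'|exact: cG'].
have k1 (u : C) : 1 <= `|complex.Re (u - a)| \/ 1 <= `|complex.Im (u - a)| ->
    normc (g u * k a u) <= normc (g u).
  move=> h; rewrite Normc.normcM Normc.normcV ler_piMr ?normc_ge0//.
  have n1 : 1 <= normc (u - a).
    by case: h => h; apply: (le_trans h); [exact: Re_le_normc|exact: Im_le_normc].
  by rewrite invf_le1// (lt_le_trans _ n1).
have ImB (x y : C) : complex.Im (x - y) = complex.Im x - complex.Im y by case: x; case: y.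
have ReB (x y : C) : complex.Re (x - y) = complex.Re x - complex.Re y by case: x; case: y.
have bound (F G F' G' : R -> C^o) (u v : R) : continuous F -> continuous G -> continuous F' -> continuous G' ->
    mu.-integrable `[u, v] (EFin \o (fun x => normc (F x))) ->
    mu.-integrable `[u, v] (EFin \o (fun x => normc (F' x))) ->
    (forall x, normc (F x * G x) <= normc (F x)) ->
    (forall x, normc (F' x * G' x) <= normc (F' x)) ->
    normc (cint (fun x => F x * G x - F' x * G' x) u v) <=
    2 * (\int[mu]_(x in `[u, v]) normc (F x) + \int[mu]_(x in `[u, v]) normc (F' x)).
  move=> cF cG cF' cG' iF iF' FG FG'.
  rewrite (le_trans (normc_cint_le _ _ (cMB _ _ _ _ cF cG cF' cG')))// ler_wpM2l//.
  rewrite -RintegralD//; apply: le_Rintegral => //.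
  - by apply: continuous_integrable; apply: continuous_normc; apply: cMB.
  - have n1 := continuous_normc cF; have n2 := continuous_normc cF'.
    by apply: continuous_integrable => x; exact: (cvgD (n1 x) (n2 x)).
  - by move=> x _; rewrite (le_trans (normcB _ _))// lerD.
rewrite lerD//.
  apply: bound; [exact: cgh|apply: ckh|exact: cgh|apply: ckh|exact: igh|exact: igh| |].
  - by rewrite lt_eqF.
  - by rewrite gt_eqF.
  - by move=> x; apply: k1; right; rewrite ImB/= ler0_norm; lra.
  - by move=> x; apply: k1; right; rewrite ImB/= ger0_norm; lra.
rewrite (addrC (Rintegral _ _ _)).
apply: bound; [exact: cgv|apply: ckv|exact: cgv|apply: ckv|exact: igv|exact: igv| |].
- by rewrite gt_eqF.
- by rewrite lt_eqF.
- by move=> x; apply: k1; left; rewrite ReB/= ger0_norm; lra.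
- by move=> x; apply: k1; left; rewrite ReB/= ler0_norm; lra.
Qed.
End cauchy_formula.

(** * Area bound and Lipschitz bound in one variable *)

Section integral_tools.
Local Open Scope ereal_scope.

(** The integral of a nonnegative function is a supremum over the simple functions
    below it, and those below f are below g. *)
Lemma le_integral_ge0 d (T : measurableType d) (R : realType)
    (mu : {measure set T -> \bar R}) (D : set T) (f g : T -> \bar R) :
  (forall x, D x -> 0 <= f x) -> (forall x, D x -> f x <= g x) ->
  \int[mu]_(x in D) f x <= \int[mu]_(x in D) g x.
Proof.
move=> f0 fg.
have g0 x : D x -> 0 <= g x by move=> Dx; exact: le_trans (f0 _ Dx) (fg _ Dx).
rewrite !ge0_integralE//; apply: ereal_sup_le => _ [h /= hf <-].
exists h => //= x; rewrite (le_trans (hf x))// !patchE; case: ifPn => //.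
by rewrite inE; exact: fg.
Qed.

Lemma le_integral_subset d (T : measurableType d) (R : realType)
    (mu : {measure set T -> \bar R}) (A B : set T) (f : T -> \bar R) :
  A `<=` B -> (forall x, B x -> 0 <= f x) ->
  \int[mu]_(x in A) f x <= \int[mu]_(x in B) f x.
Proof.
move=> AB f0; rewrite [leLHS]integral_mkcond [leRHS]integral_mkcond.
apply: le_integral_ge0 => x _.
  by rewrite patchE; case: ifPn => // /set_mem/AB/f0.
rewrite !patchE; case: ifPn => [/set_mem/AB xB|_]; first by rewrite mem_set.
by case: ifPn => // /set_mem/f0.
Qed.

End integral_tools.

Section area.
Context (R : realType).
Local Notation C := R[i].
Local Notation RT := (measurableTypeR R).
Local Notation normc := (@Normc.normc R).
Local Notation mu := (@lebesgue_measure R).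
Implicit Types g h : C^o -> C^o.

Lemma exists_below_mean (f : R -> \bar R) (a v eta : R) : (forall x, 0 <= f x)%E ->
  0 < eta ->
  (\int[mu]_(x in `[a, (a + 1)%R]) f x <= v%:E)%E ->
  exists2 x, a <= x <= a + 1 & (f x <= (v + eta)%:E)%E.
Proof.
move=> f0 eta0 fv; apply: contrapT => no.
have big x : `[a, (a + 1)%R]%classic x -> ((v + eta)%:E <= f x)%E.
  rewrite /= in_itv/= => xa; rewrite leNgt; apply/negP => /ltW fx.
  by apply: no; exists x.
have v0 : 0 <= v.
  by rewrite -lee_fin (le_trans _ fv)// integral_ge0.
have : (\int[mu]_(x in `[a, (a + 1)%R]) (v + eta)%:E <= v%:E)%E.
  apply: (le_trans _ fv); apply: le_integral_ge0 => // x _.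
  by rewrite lee_fin addr_ge0// ltW.
rewrite integral_cst//= lebesgue_measure_itv/= lte_fin ltrDl ltr01 -EFinB addrAC subrr add0r.
by rewrite mule1 lee_fin gerDl leNgt eta0.
Qed.

(** Each of the four sides in [cauchy_bound] can be placed where the integral of
    |g| over it is at most the integral over the whole square, up to an arbitrary
    error. *)
Lemma area_bound g (a : C) (r : R) : continuous g -> (forall z, differentiable g z) ->
  measurable_fun setT (fun p : RT * RT => (normc (g (p.1 +i* p.2)%C))%:E) ->
  `|complex.Re a| <= r -> `|complex.Im a| <= r ->
  ((normc (g a))%:E <= 16%:E * \int[mu]_(s in `[(- (r + 2))%R, (r + 2)%R])
     \int[mu]_(t in `[(- (r + 2))%R, (r + 2)%R]) (normc (g (s +i* t)%C))%:E)%E.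
Proof.
move=> cg dg mg ra rb.
set J := `[- (r + 2), (r + 2)%R]%classic.
set V := (X in (_ <= 16%:E * X)%E).
have V0 : (0 <= V)%E.
  by apply: integral_ge0 => s _; apply: integral_ge0 => t _; rewrite lee_fin normc_ge0.
have [Vfin|] := boolP (V \is a fin_num); last first.
  rewrite ge0_fin_numE// -leNgt leye_eq => /eqP ->.
  by rewrite gt0_muley ?leey// lte_fin.
pose S s := (\int[mu]_(t in J) (normc (g (s +i* t)%C))%:E)%E.
pose T t := (\int[mu]_(s in J) (normc (g (s +i* t)%C))%:E)%E.
have S0 s : (0 <= S s)%E by apply: integral_ge0 => t _; rewrite lee_fin normc_ge0.
have T0 s : (0 <= T s)%E by apply: integral_ge0 => t _; rewrite lee_fin normc_ge0.
have VS : V = (\int[mu]_(s in J) S s)%E by [].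
have VT : V = (\int[mu]_(t in J) T t)%E.
  pose F (p : RT * RT) := (((fun p : RT * RT => (normc (g (p.1 +i* p.2)%C))%:E) \_ (J `*` J)) p).
  have mF : measurable_fun setT F.
    have mJ : measurable (J : set RT) by exact: measurable_itv.
    apply/(measurable_restrictT _ _).1; last exact: measurable_funTS.
    exact: (measurableX mJ mJ).
  have F0 p : (0 <= F p)%E.
    by rewrite /F patchE; case: ifPn => // _; rewrite lee_fin normc_ge0.
  rewrite VS integral_mkcond [RHS]integral_mkcond.
  transitivity (\int[mu]_s \int[mu]_t F (s, t))%E.
    apply: eq_integral => s _; rewrite patchE; case: ifPn => [sJ|sJ].
      rewrite /S integral_mkcond; apply: eq_integral => t _.
      by rewrite /F !patchE in_setX/= sJ.
    rewrite integral0_eq// => t _; by rewrite /F patchE in_setX/= (negPf sJ).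
  rewrite (@fubini_tonelli _ _ RT RT R mu mu F mF F0)//.
  apply: eq_integral => t _; rewrite patchE; case: ifPn => [sJ|sJ].
    rewrite /T [RHS]integral_mkcond; apply: eq_integral => s _.
    by rewrite /F !patchE in_setX/= sJ andbT.
  rewrite integral0_eq// => s _; by rewrite /F patchE in_setX/= (negPf sJ) andbF.
pose v := fine V.
have Vv : V = v%:E by rewrite fineK.
rewrite Vv -EFinM lee_fin; apply/ler_addgt0Pl => e e0.
have e16 : 0 < e / 16 by rewrite divr_gt0.
move: (ra) (rb); rewrite !ler_norml => /andP[ra1 ra2] /andP[rb1 rb2].
have pick (f : R -> \bar R) (c : R) : (forall x, 0 <= f x)%E ->
    V = (\int[mu]_(s in J) f s)%E -> - (r + 2) <= c -> c + 1 <= r + 2 ->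
    exists2 x, c <= x <= c + 1 & (f x <= (v + e / 16)%:E)%E.
  move=> f0 Vf c1 c2; apply: exists_below_mean => //; rewrite -Vv Vf.
  apply: le_integral_subset => // x /=; rewrite /J /= !in_itv/= => /andP[x1 x2].
  by rewrite (le_trans c1 x1) (le_trans x2 c2).
have [s1 /andP[s1a s1b] Ss1] := pick S (complex.Re a - 2) S0 VS ltac:(lra) ltac:(lra).
have [s2 /andP[s2a s2b] Ss2] := pick S (complex.Re a + 1) S0 VS ltac:(lra) ltac:(lra).
have [t1 /andP[t1a t1b] Tt1] := pick T (complex.Im a - 2) T0 VT ltac:(lra) ltac:(lra).
have [t2 /andP[t2a t2b] Tt2] := pick T (complex.Im a + 1) T0 VT ltac:(lra) ltac:(lra).
have ab : a != a + 1 by rewrite -subr_eq0 opprD addrA subrr sub0r oppr_eq0 oner_eq0.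
have := cauchy_bound cg (fun z _ => dg z) ab (s1:=s1) (s2:=s2) (t1:=t1) (t2:=t2).
move/(_ ltac:(lra) ltac:(lra) ltac:(lra) ltac:(lra)) => /le_trans; apply.
have side (f : R -> R) (c d : R) (w : \bar R) : continuous f -> (forall x, 0 <= f x) ->
    - (r + 2) <= c -> d <= r + 2 -> (\int[mu]_(x in J) (f x)%:E <= w)%E ->
    (w <= (v + e / 16)%:E)%E ->
    \int[mu]_(x in `[c, d]) f x <= v + e / 16.
  move=> cf f0 c1 d1 fw wv; rewrite -lee_fin fineK; last first.
    exact: integrable_fin_num (continuous_integrable _ _ cf).
  apply: (le_trans _ (le_trans fw wv)); apply: le_integral_subset.
    by move=> x /=; rewrite /J /= !in_itv/= => /andP[x1 x2]; rewrite (le_trans c1 x1) (le_trans x2 d1).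
  by move=> x _; rewrite lee_fin.
have -> : e + 16 * v = 4 * (v + e / 16 + (v + e / 16) + (v + e / 16 + (v + e / 16))) by field.
have cgh t : continuous (fun x : R => normc (g (x +i* t)%C)).
  by apply: continuous_normc; exact: continuous_hslice.
have cgv t : continuous (fun x : R => normc (g (t +i* x)%C)).
  by apply: continuous_normc; exact: continuous_vslice.
apply: ler_wpM2l => //; apply: lerD; apply: lerD.
- by apply: (side _ _ _ _ (cgh t1) _ _ _ (lexx _) Tt1) => [x||]; [exact: normc_ge0|lra|lra].
- by apply: (side _ _ _ _ (cgh t2) _ _ _ (lexx _) Tt2) => [x||]; [exact: normc_ge0|lra|lra].
- by apply: (side _ _ _ _ (cgv s1) _ _ _ (lexx _) Ss1) => [x||]; [exact: normc_ge0|lra|lra].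
- by apply: (side _ _ _ _ (cgv s2) _ _ _ (lexx _) Ss2) => [x||]; [exact: normc_ge0|lra|lra].
Qed.

(** [cauchy_bound] for the difference quotient of f at 0, which is continuous and
    differentiable off 0, and bounded by 4 M on the sides of the rectangle. *)
Lemma lipschitz_bound (f : C^o -> C^o) (s M : R) : (forall z, differentiable f z) ->
  0 < s <= 1 / 2 ->
  (forall z : C, `|complex.Re z| <= 2 -> `|complex.Im z| <= 2 -> normc (f z) <= M) ->
  normc (f s%:C%C - f 0) <= 128 * s * M.
Proof.
move=> df /andP[s0 s2] fM.
have cf : continuous f by move=> z; exact: differentiable_continuous.
have [q [cq qE dq]] := diffquot_ex cf (df 0).
have sn0 : s%:C%C != 0 :> C by rewrite eq_complex/= eqxx andbT gt_eqF.
have f0M : normc (f 0) <= M.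
  apply: fM; first by rewrite (_ : complex.Re (0 : C) = 0)// normr0.
  by rewrite (_ : complex.Im (0 : C) = 0)// normr0.
have M0 : 0 <= M by exact: le_trans (normc_ge0 _) f0M.
have qM (z : C) : 1 / 2 <= `|complex.Re z| \/ 1 <= `|complex.Im z| ->
    `|complex.Re z| <= 2 -> `|complex.Im z| <= 2 -> normc (q z) <= 4 * M.
  move=> z1 z2 z3.
  have nz : 1 / 2 <= normc z.
    case: z1 => h.
      by rewrite (le_trans h)// Re_le_normc.
    rewrite (le_trans _ (Im_le_normc _))//; lra.
  have zn0 : z != 0 by apply: contraTneq nz => ->; rewrite Normc.normc0 -ltNge; lra.
  rewrite qE// subr0 Normc.normcM Normc.normcV ler_pdivrMr; last by apply: lt_le_trans nz; lra.
  rewrite (le_trans (normcB _ _))//.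
  have := fM z z2 z3; move: f0M; nra.
have := cauchy_bound (s1 := s - 1) (s2 := s + 1) (t1 := -1) (t2 := 1) cq
   (fun z zn => dq z zn (df z)) sn0.
move=> /(_ ltac:(by apply/andP; split; rewrite /=; lra) ltac:(by apply/andP; split; rewrite /=; lra)
  ltac:(by apply/andP; split; rewrite /=; lra) ltac:(by apply/andP; split; rewrite /=; lra)) qs.
have side (F : R -> C^o) (c d : R) : continuous F -> c <= d -> d - c = 2 ->
    (forall x, c <= x <= d -> normc (F x) <= 4 * M) ->
    \int[mu]_(x in `[c, d]) normc (F x) <= 8 * M.
  move=> cF cd dc FM; apply: (@le_trans _ _ (\int[mu]_(x in `[c, d]) (4 * M))).
    apply: le_Rintegral.
    - exact: measurable_itv.
    - by apply: continuous_integrable; exact: continuous_normc.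
    - by apply: continuous_integrable => x; exact: cvg_cst.
    - by move=> x /=; rewrite in_itv/=; exact: FM.
  rewrite [leLHS]Rintegral_cst; last exact: measurable_itv.
  by rewrite /= lebesgue_measure_itv/= lte_fin -subr_gt0 dc ltr0n/= dc; lra.
have {}qs : normc (q s%:C%C) <= 128 * M.
  rewrite (le_trans qs)//.
  have cqh t := @continuous_hslice _ q t cq; have cqv t := @continuous_vslice _ q t cq.
  have e1 : s - 1 <= s + 1 by lra.
  have e2 : s + 1 - (s - 1) = 2 by ring.
  have e3 : -1 <= 1 :> R by lra.
  have e4 : 1 - -1 = 2 :> R by ring.
  have h1 := side _ _ _ (cqh (-1)) e1 e2.
  have h2 := side _ _ _ (cqh 1) e1 e2.
  have h3 := side _ _ _ (cqv (s - 1)) e3 e4.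
  have h4 := side _ _ _ (cqv (s + 1)) e3 e4.
  have -> : 128 * M = 4 * (8 * M + 8 * M + (8 * M + 8 * M)) by ring.
  apply: ler_wpM2l => //; apply: lerD; apply: lerD.
  - apply: h1 => x /andP[x1 x2]; apply: qM => /=; rewrite ?normrN1; [by right|rewrite ler_norml; apply/andP; split; lra|lra].
  - apply: h2 => x /andP[x1 x2]; apply: qM => /=; rewrite ?normr1; [by right|rewrite ler_norml; apply/andP; split; lra|lra].
  - apply: h3 => x /andP[x1 x2]; apply: qM => /=; [left; rewrite ler0_norm; lra| |]; rewrite ler_norml; apply/andP; split; lra.
  - apply: h4 => x /andP[x1 x2]; apply: qM => /=; [left; rewrite ger0_norm; lra| |]; rewrite ler_norml; apply/andP; split; lra.
move: qs; rewrite qE// subr0 Normc.normcM Normc.normcV normc_R gtr0_norm//.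
by rewrite ler_pdivrMr// mulrAC.
Qed.

End area.

(** * Iterating over the coordinates *)

Section tuple_integral.
Context (R : realType).
Local Notation RT := (measurableTypeR R).
Local Notation mu := (@lebesgue_measure R).
Local Notation lam := (@lebesgue_tuple R).
Local Open Scope ereal_scope.

Lemma integral_tuple0 (F : 0.-tuple RT -> \bar R) : \int[lam 0]_x F x = F [tuple].
Proof.
rewrite (_ : F = cst (F [tuple])); last by apply/funext => x; rewrite (tuple0 x).
by rewrite integral_cst//= diracE in_setT mule1.
Qed.

Lemma ge0_integral_tupleS n (F : n.+1.-tuple RT -> \bar R) :
  measurable_fun setT F -> (forall x, 0 <= F x) ->
  \int[lam n.+1]_x F x = \int[mu]_s \int[lam n]_x F (cons_pair (s, x)).
Proof.
move=> mF F0.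
have -> : \int[lam n.+1]_x F x =
    \int[pushforward (mu \x lam n)%E (@cons_pair R n)]_x F x by [].
rewrite (ge0_integral_pushforward (@measurable_cons_pair R n))//.
rewrite preimage_setT (@fubini_tonelli1 _ _ _ _ _ mu (lam n))//.
  by apply: measurableT_comp => //; exact: measurable_cons_pair.
by move=> p; exact: F0.
Qed.

(** The product structure of C^n.+1 = C * C^n: adds a first coordinate to a pair
    of real tuples. *)
Definition consP n (st : RT * RT) (p : n.-tuple RT * n.-tuple RT) :
    n.+1.-tuple RT * n.+1.-tuple RT :=
  (cons_pair (st.1, p.1), cons_pair (st.2, p.2)).

Lemma measurable_consP n :
  measurable_fun setT (fun q : ((RT * RT) * n.-tuple RT) * n.-tuple RT =>
    consP q.1.1 (q.1.2, q.2)).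
Proof.
apply/measurable_fun_pair => /=.
  apply: (measurableT_comp (@measurable_cons_pair R n)).
  apply/measurable_fun_pair => /=.
    by apply: measurableT_comp => //; apply: measurableT_comp.
  exact: measurableT_comp.
apply: (measurableT_comp (@measurable_cons_pair R n)).
apply/measurable_fun_pair => //=.
by apply: measurableT_comp => //; apply: measurableT_comp.
Qed.

Definition iint n (F : n.-tuple RT * n.-tuple RT -> \bar R) :=
  \int[lam n]_x \int[lam n]_y F (x, y).

Section iterate.
Context n (F : n.+1.-tuple RT * n.+1.-tuple RT -> \bar R).
Hypotheses (mF : measurable_fun setT F) (F0 : forall p, 0 <= F p).

Let F4 (q : ((RT * RT) * n.-tuple RT) * n.-tuple RT) := F (consP q.1.1 (q.1.2, q.2)).

Let mF4 : measurable_fun setT F4.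
Proof. by apply: (measurableT_comp mF); exact: measurable_consP. Qed.

Let F3 (q : (RT * RT) * n.-tuple RT) := \int[lam n]_y F4 (q, y).

Let mF3 : measurable_fun setT F3.
Proof. exact: (@measurable_fun_fubini_tonelli_F _ _ _ _ _ (lam n) F4 mF4 (fun q => F0 _)). Qed.

Let F30 q : 0 <= F3 q. Proof. by apply: integral_ge0 => y _; exact: F0. Qed.

Lemma measurable_iint_consP : measurable_fun setT (fun st => iint (F \o consP st)).
Proof. exact: (@measurable_fun_fubini_tonelli_F _ _ _ _ _ (lam n) F3 mF3 F30). Qed.

(** Tonelli: the first coordinates of both tuples are moved to the front. *)
Lemma iint_consP : iint F = \int[mu]_s \int[mu]_t iint (F \o consP (s, t)).
Proof.
rewrite /iint ge0_integral_tupleS; last 2 first.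
- exact: (@measurable_fun_fubini_tonelli_F _ _ _ _ _ (lam n.+1) F mF F0).
- by move=> x; exact: integral_ge0.
apply: eq_integral => s _.
have mK : measurable_fun setT (fun q : n.-tuple RT * RT => F3 ((s, q.2), q.1)).
  apply: (measurableT_comp mF3); apply/measurable_fun_pair => //=.
  by apply/measurable_fun_pair => //=.
transitivity (\int[lam n]_x \int[mu]_t F3 ((s, t), x)).
  apply: eq_integral => x _; rewrite ge0_integral_tupleS//.
  by apply: (measurableT_comp mF); apply/measurable_fun_pair => //=.
by rewrite (@fubini_tonelli _ _ _ _ _ (lam n) mu (fun q => F3 ((s, q.2), q.1))).
Qed.
End iterate.

Definition box n (r : R) : set (n.-tuple RT * n.-tuple RT) :=
  [set p | forall j, (`|tnth p.1 j| <= r)%R /\ (`|tnth p.2 j| <= r)%R].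

Lemma box_consP n r st p : box r (@consP n st p) <->
  [/\ (`|st.1| <= r)%R, (`|st.2| <= r)%R & box r p].
Proof.
split => [bp|[s1 t1 bp] j].
  split; [exact: (bp ord0).1|exact: (bp ord0).2|move=> j].
  by have := bp (lift ord0 j); rewrite /= !tnthS.
by have [i ->|->] := unliftP ord0 j; rewrite /= ?tnthS ?tnth0.
Qed.

Lemma measurable_box n r : measurable (@box n r).
Proof.
have mle : measurable [set x : RT | (`|x| <= r)%R].
  rewrite (_ : [set _ | _] = [set` `[(- r)%R, r]]); first exact: measurable_itv.
  by apply/seteqP; split => x /=; rewrite in_itv/= ler_norml.
rewrite (_ : @box n r = \bigcap_(j in [set: 'I_n])
  ((fun p : n.-tuple RT * n.-tuple RT => tnth p.1 j) @^-1` [set x | (`|x| <= r)%R] `&`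
   (fun p : n.-tuple RT * n.-tuple RT => tnth p.2 j) @^-1` [set x | (`|x| <= r)%R])).
  apply: fin_bigcap_measurable => // j _; apply: measurableI.
    rewrite -[X in measurable X]setTI.
    exact: (measurableT_comp (measurable_tnth j) measurable_fst).
  rewrite -[X in measurable X]setTI.
  exact: (measurableT_comp (measurable_tnth j) measurable_snd).
by apply/seteqP; split => [p bp j _|p bp j]; exact: bp.
Qed.

Definition upd n (x : n.-tuple RT) (j : 'I_n) (s : RT) : n.-tuple RT :=
  [tuple if i == j then s else tnth x i | i < n].

Lemma upd_cons0 n (s0 s : RT) (x : n.-tuple RT) : upd (cons_pair (s0, x)) ord0 s = cons_pair (s, x).
Proof.
apply: eq_from_tnth => i; rewrite tnth_mktuple.
by have [j ->|->] := unliftP ord0 i; rewrite ?eqxx //= ?tnthS.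
Qed.

Lemma upd_consS n (s0 s : RT) (x : n.-tuple RT) j :
  upd (cons_pair (s0, x)) (lift ord0 j) s = cons_pair (s0, upd x j s).
Proof.
apply: eq_from_tnth => i; rewrite tnth_mktuple.
have [k ->|->] := unliftP ord0 i; rewrite ?(inj_eq lift_inj) /= ?tnthS ?tnth_mktuple//.
Qed.

(** Induction on the dimension: the mean inequality in the first coordinate
    bounds G at p by values at points with the same other coordinates, to which
    the induction hypothesis applies. *)
Lemma submean_box n (G : n.-tuple RT * n.-tuple RT -> \bar R) (k r : R) : (0 <= k)%R ->
  measurable_fun setT G -> (forall p, 0 <= G p) ->
  (forall p j, (`|tnth p.1 j| <= r)%R -> (`|tnth p.2 j| <= r)%R ->
    G p <= k%:E * \int[mu]_(s in `[(- (r + 2))%R, (r + 2)%R])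
      \int[mu]_(t in `[(- (r + 2))%R, (r + 2)%R]) G (upd p.1 j s, upd p.2 j t)) ->
  forall p, box r p -> G p <= (k ^+ n)%:E * iint (G \_ (box (r + 2))).
Proof.
move=> k0; elim: n G => [|n ih] G mG G0 HG p bp.
  rewrite expr0 mul1e /iint !integral_tuple0.
  rewrite patchE mem_set; last by case.
  by rewrite (_ : p = ([tuple], [tuple]))//; case: p {bp} => a b; rewrite (tuple0 a) (tuple0 b).
case: p bp => x y bp.
have [s0 [x' xE]] : exists s x', x = cons_pair (s, x').
  by case/tupleP: x bp => s x' _; exists s, x'; apply: val_inj.
have [t0 [y' yE]] : exists s x', y = cons_pair (s, x').
  by case/tupleP: y bp => s y' _; exists s, y'; apply: val_inj.
have pE : (x, y) = consP (s0, t0) (x', y') by rewrite xE yE.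
rewrite pE in bp *; have [/= bs bt bp'] := (box_consP _ _ _).1 bp.
set J := `[(- (r + 2))%R, (r + 2)%R]%classic in HG.
have JP s : J s = (`|s| <= r + 2)%R :> Prop by rewrite /J /= in_itv/= ler_norml.
pose F := G \_ (box (r + 2)).
have mF : measurable_fun setT F.
  by apply/(measurable_restrictT _ _).1; [exact: measurable_box|exact: measurable_funTS].
have F0 q : 0 <= F q by rewrite /F patchE; case: ifPn.
pose D st := iint (F \o consP st).
have D0 st : 0 <= D st by apply: integral_ge0 => a _; apply: integral_ge0 => b _; exact: F0.
have mD : measurable_fun setT D by exact: measurable_iint_consP.
apply: (@le_trans _ _ (k%:E * \int[mu]_(s in J) \int[mu]_(t in J) ((k ^+ n)%:E * D (s, t)))).
  have := HG (consP (s0, t0) (x', y')) ord0; rewrite /= !tnth0 => /(_ bs bt)/le_trans; apply.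
  apply: lee_wpmul2l; first by rewrite lee_fin.
  apply: le_integral_ge0 => s Js; first by apply: integral_ge0 => t _; exact: G0.
  apply: le_integral_ge0 => t Jt; first exact: G0.
  rewrite !upd_cons0 -[X in G X]/(consP (s, t) (x', y')).
  apply: (le_trans (ih (G \o consP (s, t)) _ _ _ (x', y') bp')).
  - apply: (measurableT_comp mG); apply/measurable_fun_pair => /=.
      by apply: (measurableT_comp (@measurable_cons_pair R n)); apply/measurable_fun_pair.
    by apply: (measurableT_comp (@measurable_cons_pair R n)); apply/measurable_fun_pair.
  - by move=> q; exact: G0.
  - move=> q j qj1 qj2; have := HG (consP (s, t) q) (lift ord0 j).
    rewrite /= !tnthS => /(_ qj1 qj2) /le_trans; apply.
    by apply: lee_wpmul2l => //; under eq_integral do under eq_integral do rewrite !upd_consS.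
  - apply: lee_wpmul2l; first by rewrite lee_fin exprn_ge0.
    apply: le_integral_ge0 => a _.
      by apply: integral_ge0 => b _; rewrite patchE; case: ifPn => // _; exact: G0.
    apply: le_integral_ge0 => b _; first by rewrite patchE; case: ifPn => // _; exact: G0.
    rewrite [leLHS]patchE; case: ifPn => [h|_]; last exact: F0.
    rewrite /F /= patchE mem_set//.
    by apply/box_consP; split; [rewrite -JP|rewrite -JP|exact: set_mem h].
rewrite exprS EFinM -muleA; apply: lee_wpmul2l; first by rewrite lee_fin.
rewrite (iint_consP mF F0).
have mJ : measurable (J : set RT) by exact: measurable_itv.
have mD1 s : measurable_fun setT (fun t => D (s, t)).
  by apply: (measurableT_comp mD); apply/measurable_fun_pair.
have mDF : measurable_fun setT (fun s => \int[mu]_t D (s, t)).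
  exact: (@measurable_fun_fubini_tonelli_F _ _ _ _ _ mu D).
rewrite -ge0_integralZl//; last 2 first.
- by move=> s _; apply: integral_ge0 => t _; exact: D0.
- by rewrite lee_fin exprn_ge0.
apply: (@le_trans _ _ (\int[mu]_s \int[mu]_t ((k ^+ n)%:E * D (s, t)))).
  have kD s t : 0 <= (k ^+ n)%:E * D (s, t) by rewrite mule_ge0// lee_fin exprn_ge0.
  apply: (@le_trans _ _ (\int[mu]_(s in J) \int[mu]_t ((k ^+ n)%:E * D (s, t)))).
    apply: le_integral_ge0 => s _; first by apply: integral_ge0 => t _; exact: kD.
    by apply: le_integral_subset => // t _; exact: kD.
  by apply: le_integral_subset => // s _; apply: integral_ge0 => t _; exact: kD.
apply: le_integral_ge0 => s _.
  by apply: integral_ge0 => t _; rewrite mule_ge0// lee_fin exprn_ge0.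
rewrite ge0_integralZl; [exact: lexx|exact: measurableT|exact: mD1| |].
  by move=> t _; exact: D0.
by rewrite lee_fin exprn_ge0.
Qed.

End tuple_integral.

(** * Entire functions of several variables: local L2 bounds *)

Section entire_bounds.
Context (R : realType) (d : nat).
Local Notation C := R[i].
Local Notation RT := (measurableTypeR R).
Local Notation normc := (@Normc.normc R).
Local Notation mu := (@lebesgue_measure R).
Local Notation lam := (@lebesgue_tuple R d).
Local Notation P := ((d.-tuple RT * d.-tuple RT)%type).
Implicit Types f : 'rV[C]_d -> C^o.

Lemma entire_line f (a v : 'rV[C]_d) (t : C^o) : entire f ->
  differentiable (fun t : C^o => f (a + t *: v)) t.
Proof.
move=> ef; apply: (@differentiable_comp C C^o _ C^o (fun t : C^o => a + t *: v) f); last exact: ef.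
apply: (@differentiableD C C^o _ (cst a) (fun t : C^o => t *: v)).
  exact: differentiable_cst.
apply: (@differentiableZl C C^o _ id v); exact: ex_diff.
Qed.

Lemma measurable_upd n (x : n.-tuple RT) j : measurable_fun setT (@upd R n x j).
Proof.
apply/measurable_fun_tnthP => i.
rewrite (_ : _ \o _ = if i == j then id else cst (tnth x i)); first by case: ifP.
by apply/funext => s; rewrite /= tnth_mktuple; case: ifP.
Qed.

Lemma cpoint_upd (p : P) j (s t : R) : Defs.cpoint (upd p.1 j s, upd p.2 j t) =
  Defs.cpoint p + ((s +i* t)%C - Defs.cpoint p 0 j) *: delta_mx 0 j.
Proof.
apply/rowP => i; rewrite !mxE/= !tnth_mktuple; case: eqVneq => [->|_] /=.
  by rewrite mulr1 addrC subrK.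
by rewrite mulr0 addr0.
Qed.

Lemma entire_iint_bound f (r : R) (p : P) : entire f -> box r p ->
  ((normc (f (Defs.cpoint p)))%:E <= (16 ^+ d)%:E *
    iint ((fun q => (normc (f (Defs.cpoint q)))%:E) \_ (box (r + 2))))%E.
Proof.
move=> ef bp; have := @submean_box R d (fun q => (normc (f (Defs.cpoint q)))%:E) 16 r.
apply => //.
- by apply/measurable_EFinP; exact: measurable_entire.
- by move=> q; rewrite lee_fin normc_ge0.
move=> q j q1 q2.
pose g (t : C^o) := f (Defs.cpoint q + (t - Defs.cpoint q 0 j) *: delta_mx 0 j).
have gE : g = fun t => f ((Defs.cpoint q - Defs.cpoint q 0 j *: delta_mx 0 j) + t *: delta_mx 0 j).
  by apply/funext => t; rewrite /g scalerBl addrA addrAC.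
have dg z : differentiable g z by rewrite gE; exact: entire_line.
have cg : continuous g by move=> z; exact: differentiable_continuous.
have gqE (s t : R) : g (s +i* t)%C = f (Defs.cpoint (upd q.1 j s, upd q.2 j t)).
  by rewrite cpoint_upd.
have gq0 : f (Defs.cpoint q) = g (Defs.cpoint q 0 j) by rewrite /g subrr scale0r addr0.
rewrite gq0; under eq_integral do under eq_integral do rewrite -gqE.
apply: area_bound => //; [|by rewrite mxE..].
apply/measurable_EFinP.
rewrite (_ : (fun _ => _) = (fun p : P => normc (f (Defs.cpoint p))) \o
  (fun st : RT * RT => (upd q.1 j st.1, upd q.2 j st.2))); last first.
  by apply/funext => st /=; rewrite gqE.
apply: measurableT_comp; first exact: measurable_entire.
apply/measurable_fun_pair => /=.
  by apply: measurableT_comp; first exact: measurable_upd.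
by apply: measurableT_comp; first exact: measurable_upd.
Qed.


Lemma iintE (F : P -> \bar R) : measurable_fun setT F -> (forall p, 0 <= F p)%E ->
  iint F = (\int[(lam \x lam)%E]_p F p)%E.
Proof. by move=> mF F0; rewrite (@fubini_tonelli1 _ _ _ _ _ lam lam). Qed.

Definition tbox n (r : R) : set (n.-tuple RT) := [set x | forall j, `|tnth x j| <= r].

Lemma boxE n (r : R) : @box R n r = tbox r `*` tbox r.
Proof.
apply/seteqP; split => [p bp|p [b1 b2] j]; last by split; [exact: b1|exact: b2].
by split => j; have [] := bp j.
Qed.

Lemma measurable_tbox n (r : R) : measurable (@tbox n r).
Proof.
have mJ : measurable ([set` `[-r, r]] : set RT) by exact: measurable_itv.
rewrite (_ : @tbox n r = \bigcap_(j in [set: 'I_n])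
  ((fun p : n.-tuple RT => tnth p j) @^-1` [set` `[-r, r]])).
  apply: fin_bigcap_measurable => // j _.
  rewrite -[X in measurable X]setTI; exact: (measurable_tnth j measurableT mJ).
by apply/seteqP; split => [p bp j _|p bp j]; have := bp j; rewrite /= in_itv/= ler_norml//; exact.
Qed.

Lemma tbox_fin n (r : R) : (@lebesgue_tuple R n (tbox r) < +oo)%E.
Proof.
elim: n => [|n ih].
  by rewrite /= diracE ltry.
have -> : @lebesgue_tuple R n.+1 (tbox r) =
  (mu \x @lebesgue_tuple R n)%E (@cons_pair R n @^-1` (tbox r)) by [].
have -> : @cons_pair R n @^-1` (tbox r) = [set` `[-r, r]] `*` tbox r.
  apply/seteqP; split => [[s x] /= h|[s x] /= [h1 h2] j].
    split; first by have := h ord0; rewrite /= tnth0 in_itv/= ler_norml.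
    by move=> j; have := h (lift ord0 j); rewrite /= tnthS.
  by have [i ->|->] := unliftP ord0 j; rewrite /= ?tnthS ?tnth0//; move: h1; rewrite in_itv/= ler_norml.
have mJ : measurable ([set` `[-r, r]] : set RT) by exact: measurable_itv.
rewrite product_measure1E; [|exact: mJ|exact: measurable_tbox].
apply: lte_mul_pinfty => //.
by rewrite /= lebesgue_measure_itv/=; case: ifP.
Qed.

Lemma box_fin (r : R) : ((lam \x lam)%E (@box R d r) < +oo)%E.
Proof.
rewrite boxE product_measure1E; [|exact: measurable_tbox..].
have h := tbox_fin d r.
by apply: lte_mul_pinfty => //; rewrite ge0_fin_numE.
Qed.

(** Passes from L1 to L2 by the pointwise inequality x <= l x^2 + 1 / l, with l
    left free instead of optimized. *)
Lemma entire_L2_bound f (r l : R) (p : P) : entire f -> box r p -> 0 < l ->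
  ((normc (f (Defs.cpoint p)))%:E <= (16 ^+ d)%:E *
    (l%:E * \int[(lam \x lam)%E]_(q in box (r + 2)) (normc (f (Defs.cpoint q)) ^+ 2)%:E +
     l^-1%:E * (lam \x lam)%E (@box R d (r + 2))))%E.
Proof.
move=> ef bp l0; apply: (le_trans (entire_iint_bound ef bp)).
apply: lee_wpmul2l; first by rewrite lee_fin exprn_ge0.
have mf : measurable_fun setT (fun q : P => normc (f (Defs.cpoint q)) : RT) by exact: measurable_entire.
have mb := @measurable_box R d (r + 2).
rewrite iintE; last 2 first.
- by apply/(measurable_restrictT _ _).1 => //; apply: measurable_funTS; exact/measurable_EFinP.
- by move=> q; rewrite patchE; case: ifPn => // _; rewrite lee_fin normc_ge0.
rewrite -integral_mkcond.
have m2 : measurable_fun (box (r + 2)) (fun q : P => (normc (f (Defs.cpoint q)) ^+ 2)%:E).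
  by apply/measurable_EFinP; apply: measurable_funX; exact: measurable_funTS.
rewrite -(integral_cst _ mb) -ge0_integralZl//; last 2 first.
- by move=> q _; rewrite lee_fin sqr_ge0.
- by rewrite lee_fin ltW.
rewrite -ge0_integralD//=; last 3 first.
- by move=> q _; rewrite -EFinM lee_fin mulr_ge0 ?sqr_ge0// ltW.
- exact: measurable_funeM.
- by move=> q _; rewrite lee_fin invr_ge0 ltW.
apply: le_integral_ge0 => q _; first by rewrite lee_fin normc_ge0.
rewrite -EFinM -EFinD lee_fin; set x := normc _.
rewrite -subr_ge0 (_ : _ - _ = (l * x - 1 / 2) ^+ 2 / l + 3 / 4 / l); last first.
  by field; rewrite gt_eqF.
by rewrite addr_ge0// divr_ge0 ?sqr_ge0 ?(ltW l0)//; lra.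
Qed.

(** The norm of 'rV[C]_d takes its values in C, where they are real. *)
Definition rnorm (v : 'rV[C]_d) : R := complex.Re `|v|.

Lemma rnormE v : `|v| = (rnorm v)%:C%C.
Proof. by rewrite /rnorm RRe_real// ger0_real. Qed.

Lemma rnorm_ge0 v : 0 <= rnorm v.
Proof. by rewrite -lecR -rnormE normr_ge0. Qed.

Lemma rnormZ (a : C) (v : 'rV[C]_d) : rnorm (a *: v) = normc a * rnorm v.
Proof.
have h := rnormE (a *: v); rewrite normrZ normc_absE rnormE -rmorphM in h.
by case: h.
Qed.

Lemma coord_le_rnorm (v : 'rV[C]_d) j : normc (v 0 j) <= rnorm v.
Proof.
rewrite -lecR -rnormE -normc_absE -[leRHS]/(mx_norm v) mx_normE -[leLHS]nngE num_le.
exact: (le_bigmax _ (fun i : 'I_1 * 'I_d => `|v i.1 i.2|%:nng) (0, j)).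
Qed.

Lemma rnorm_eq0 v : rnorm v = 0 -> v = 0.
Proof. by move=> v0; apply/eqP; rewrite -normr_eq0 rnormE v0. Qed.

End entire_bounds.

(** * Locally uniform limits of entire functions *)

Section limit_entire.
Context (R : realType).
Local Notation C := R[i].
Local Notation normc := (@Normc.normc R).

Lemma real_cauchy_cvg (u : nat -> R) :
  (forall e, 0 < e -> exists N, forall n m, (N <= n)%N -> (N <= m)%N -> `|u n - u m| <= e) ->
  exists l, forall e, 0 < e -> exists N, forall n, (N <= n)%N -> `|u n - l| <= e.
Proof.
move=> cu; have : cvgn u.
  apply/cauchy_cvgP/cauchy_exP => e e0.
  have e2 : 0 < e / 2 by rewrite divr_gt0.
  have [N uN] := cu _ e2; exists (u N), N => // n /= Nn.
  by rewrite /ball/= (le_lt_trans (uN _ _ (leqnn N) Nn))//; lra.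
move=> /cvgrPdist_le ul; exists (limn u) => e e0.
by have [N _ uN] := ul e e0; exists N => n /uN; rewrite distrC.
Qed.

Lemma complex_cauchy_cvg (u : nat -> C) :
  (forall e, 0 < e -> exists N, forall n m, (N <= n)%N -> (N <= m)%N -> normc (u n - u m) <= e) ->
  exists l, forall e, 0 < e -> exists N, forall n, (N <= n)%N -> normc (u n - l) <= e.
Proof.
move=> cu.
have ImB (x y : C) : complex.Im (x - y) = complex.Im x - complex.Im y by case: x; case: y.
have ReB (x y : C) : complex.Re (x - y) = complex.Re x - complex.Re y by case: x; case: y.
have [a ua] : exists l, forall e, 0 < e -> exists N, forall n, (N <= n)%N -> `|complex.Re (u n) - l| <= e.
  apply: real_cauchy_cvg => e /cu[N uN]; exists N => n m Nn Nm.
  by rewrite -ReB (le_trans (Re_le_normc _))// uN.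
have [b ub] : exists l, forall e, 0 < e -> exists N, forall n, (N <= n)%N -> `|complex.Im (u n) - l| <= e.
  apply: real_cauchy_cvg => e /cu[N uN]; exists N => n m Nn Nm.
  by rewrite -ImB (le_trans (Im_le_normc _))// uN.
exists (a +i* b)%C => e e0; have e2 : 0 < e / 2 by rewrite divr_gt0.
have [N uN] := ua _ e2; have [M uM] := ub _ e2.
exists (maxn N M) => n; rewrite geq_max => /andP[Nn Mn].
rewrite (le_trans (normc_le_ReIm _))// ReB ImB /= [leRHS]splitr lerD//; [exact: uN|exact: uM].
Qed.

Let telescope1 (A B a b p q : C) :
  p - q = ((A - B) - (a - b)) - (A - (a + p)) + (B - (b + q)).
Proof. ring. Qed.

Let telescope2 (A F a f p l : C) :
  F - (f + l) = - ((A - F) - (a - f)) + (A - (a + p)) + (p - l).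
Proof. ring. Qed.

Let telescope3 (A F a f A' a' : C) :
  (A - F) - (a - f) = ((A' - F) - (a' - f)) + ((A - A') - (a - a')).
Proof. ring. Qed.

Section bounds.
Context (d : nat).
Local Notation V := ('rV[C]_d).

Definition lsum (l : 'I_d -> C) (v : V) : C^o := \sum_j v 0 j * l j.

Lemma lsum_is_linear l : linear (lsum l).
Proof.
move=> a u v; rewrite /lsum scaler_sumr -big_split/=; apply: eq_bigr => j _.
by rewrite !mxE mulrDl -mulrA.
Qed.

HB.instance Definition _ l := GRing.isLinear.Build C V C^o *:%R (lsum l) (lsum_is_linear l).

(* the normed module structure, for statements on continuity *)
Let W : normedModType C := V.

Lemma continuous_lsum l : continuous (lsum l : W -> C^o).
Proof.
move=> v; apply: (@differentiable_continuous C V C^o).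
rewrite (_ : lsum l = \sum_(j < d) (fun v : V => v 0 j * l j : C^o)); last first.
  by apply/funext => w; rewrite /lsum fct_sumE.
apply: differentiable_sum => j; apply: (@differentiableM C V).
  exact: differentiable_coord.
exact: differentiable_cst.
Qed.

Lemma normc_sum (I : finType) (F : I -> C) : normc (\sum_i F i) <= \sum_i normc (F i).
Proof.
elim/big_ind2 : _ => //; first by rewrite Normc.normc0.
by move=> a x b y ax byy; rewrite (le_trans (normcD _ _))// lerD.
Qed.

(** [lipschitz_bound] on the complex line through z and v + z. *)
Lemma entire_lipschitz (f : V -> C^o) (z : V) (M : R) : entire f ->
  (forall w : V, (forall j, normc (w 0 j - z 0 j) <= 4) -> normc (f w) <= M) ->
  forall v : V, rnorm v <= 1 / 2 -> normc (f (v + z) - f z) <= 128 * rnorm v * M.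
Proof.
move=> ef fM v v2.
have [v0|vn0] := eqVneq (rnorm v) 0.
  by rewrite v0 mulr0 mul0r (rnorm_eq0 v0) add0r subrr Normc.normc0.
have s0 : 0 < rnorm v by rewrite lt_neqAle eq_sym vn0 rnorm_ge0.
have sC : (rnorm v)%:C%C != 0 :> C by rewrite eq_complex/= eqxx andbT.
pose h : V := ((rnorm v)%:C%C)^-1 *: v.
have h1 j : normc (h 0 j) <= 1.
  rewrite (le_trans (coord_le_rnorm _ _))// /h rnormZ Normc.normcV normc_R gtr0_norm//.
  by rewrite mulVf.
have := @lipschitz_bound R (fun t : C^o => f (z + t *: h)) (rnorm v) M _ _ _.
rewrite scale0r addr0 /h scalerA divff// scale1r (addrC z); apply.
- by move=> t; exact: entire_line.
- by rewrite s0.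
- move=> t t1 t2; apply: fM => j; rewrite !mxE [z 0 j + _]addrC addrK.
  rewrite Normc.normcM (le_trans (y := normc t * 1))//.
    by rewrite ler_wpM2l ?normc_ge0//; have := h1 j; rewrite mxE.
  by rewrite mulr1 (le_trans (normc_le_ReIm _))// (_ : 4 = 2 + 2) ?lerD//; lra.
Qed.

Section seq.
Context (f_ : nat -> V -> C^o).
Hypothesis ef : forall n, entire (f_ n).
Hypothesis cf : forall r e, 0 < e -> exists N, forall n m, (N <= n)%N -> (N <= m)%N ->
  forall w : V, (forall j, normc (w 0 j) <= r) -> normc (f_ n w - f_ m w) <= e.

Let L (z : W) n (v : W) : C := 'd (f_ n : W -> C^o) z v.

Let L0 z n : L z n 0 = 0.
Proof. exact: (linear0 ('d (f_ n : W -> C^o) z)). Qed.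

Let LZ z n (a : C) v : L z n (a *: v) = a * L z n v.
Proof. exact: (linearZ_LR ('d (f_ n : W -> C^o) z)). Qed.

Let LE z n (v : V) : L z n v = \sum_j v 0 j * L z n (delta_mx 0 j).
Proof.
rewrite {1}(row_sum_delta v).
transitivity (\sum_j L z n (v 0 j *: delta_mx 0 j)).
  exact: (linear_sum ('d (f_ n : W -> C^o) z)).
by apply: eq_bigr => j _; rewrite LZ.
Qed.

(** The differences of the sequence are small on a neighbourhood of z, hence have
    a small Lipschitz constant at z. *)
Lemma seq_lipschitz (z : V) e : 0 < e -> exists N, forall n m, (N <= n)%N -> (N <= m)%N ->
  forall v : V, rnorm v <= 1 / 2 ->
   normc ((f_ n (v + z) - f_ m (v + z)) - (f_ n z - f_ m z)) <= e * rnorm v.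
Proof.
move=> e0; have e1 : 0 < e / 128 by rewrite divr_gt0.
have [N fN] := cf (rnorm z + 4) e1; exists N => n m Nn Nm v v2.
have efg : entire (fun w => f_ n w - f_ m w : C^o).
  by move=> w; apply: (@differentiableB C V C^o); exact: ef.
rewrite (le_trans (entire_lipschitz (M := e / 128) efg _ v2))//; last first.
  by rewrite le_eqVlt; apply/orP; left; apply/eqP; field.
move=> w wz; apply: fN => // j.
rewrite -[X in normc X](subrK (z 0 j)) (le_trans (normcD _ _))// addrC lerD//.
exact: coord_le_rnorm.
Qed.

(** The differentials form a Cauchy sequence: they are limits of difference
    quotients, and these are uniformly Cauchy by [seq_lipschitz]. *)
Lemma seq_diff_cauchy (z : V) e : 0 < e -> exists N, forall n m, (N <= n)%N -> (N <= m)%N ->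
  forall v : V, normc (L z n v - L z m v) <= 3 * e * rnorm v.
Proof.
move=> e0; have [N fN] := seq_lipschitz z e0; exists N => n m Nn Nm v.
have [v0|vn0] := eqVneq (rnorm v) 0.
  by rewrite v0 mulr0 (rnorm_eq0 v0) !L0 subrr Normc.normc0.
have s0 : 0 < rnorm v by rewrite lt_neqAle eq_sym vn0 rnorm_ge0.
have [r1 r10 fr1] := frechet_ball (@ef n z) e0.
have [r2 r20 fr2] := frechet_ball (@ef m z) e0.
pose r := Num.min (1 / 2) (Num.min r1 r2).
have r0 : 0 < r by rewrite !lt_min r10 r20 divr_gt0.
pose t := r / (2 * rnorm v).
have t0 : 0 < t by rewrite divr_gt0// mulr_gt0.
pose w : V := t%:C%C *: v.
have wE : rnorm w = r / 2.
  by rewrite /w rnormZ normc_R gtr0_norm// /t; field.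
have r12 : r <= 1 / 2 by rewrite ge_min lexx.
have rr1 : r <= r1 by rewrite !ge_min lexx orbT.
have rr2 : r <= r2 by rewrite !ge_min lexx !orbT.
have w2 : rnorm w <= 1 / 2 by rewrite wE; lra.
have h0 := fN n m Nn Nm w w2.
have h1 : normc (f_ n (w + z) - (f_ n z + L z n w)) <= e * rnorm w.
  rewrite -lecR rmorphM /= -rnormE; apply: fr1; rewrite rnormE ltcR wE; lra.
have h2 : normc (f_ m (w + z) - (f_ m z + L z m w)) <= e * rnorm w.
  rewrite -lecR rmorphM /= -rnormE; apply: fr2; rewrite rnormE ltcR wE; lra.
have : normc (L z n w - L z m w) <= 3 * e * rnorm w.
  rewrite (telescope1 (f_ n (w + z)) (f_ m (w + z)) (f_ n z) (f_ m z)).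
  rewrite (le_trans (normcD _ _))// (_ : 3 * e * rnorm w = e * rnorm w + e * rnorm w + e * rnorm w); last by ring.
  apply: lerD; last exact: h2.
  apply: le_trans (normcB _ _) _; apply: lerD; [exact: h0|exact: h1].
rewrite /w !LZ -mulrBr Normc.normcM rnormZ normc_R gtr0_norm// mulrCA.
by rewrite ler_pM2l.
Qed.

(** The differential of f at z is the limit l of the differentials of f_ n: the
    remainder of f differs from that of a fixed f_ n by f - f_ n, whose difference
    quotients are uniformly small, and by the difference of the differentials. *)
Theorem entire_limit (f : V -> C^o) :
  (forall w e, 0 < e -> exists N, forall n, (N <= n)%N -> normc (f_ n w - f w) <= e) ->
  entire f.
Proof.
move=> fl z.
have key (j : 'I_d) : exists l : C, forall e, 0 < e ->
    exists N, forall n, (N <= n)%N -> normc (L z n (delta_mx 0 j) - l) <= e.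
  apply: complex_cauchy_cvg => e e0.
  have e1 : 0 < e / (3 * (rnorm (delta_mx 0 j : V) + 1)).
    by rewrite divr_gt0// mulr_gt0// ltr_wpDl// rnorm_ge0.
  have [N fN] := seq_diff_cauchy z e1; exists N => n m Nn Nm.
  rewrite (le_trans (fN n m Nn Nm _))//; set a := rnorm _.
  have a0 : 0 <= a by exact: rnorm_ge0.
  rewrite (_ : 3 * _ * a = e * (a / (a + 1))); last by field; rewrite gt_eqF// ltr_wpDl.
  by rewrite ger_pMr// ler_pdivrMr ?mul1r ?lerDl// ltr_wpDl.
have [l lP] := choice key.
apply: (@ball_frechet R W f z (lsum l)); first exact: continuous_lsum.
move=> e e0.
pose e' := e / (d%:R + 2).
have d2 : 0 < d%:R + 2 :> R by rewrite ltr_wpDl.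
have e'0 : 0 < e' by rewrite divr_gt0.
have e'E : e = e' + e' + e' * d%:R by rewrite /e'; field; rewrite gt_eqF.
have [N1 fN1] := seq_lipschitz z e'0.
have [N2 fN2] := choice (fun j => lP j e' e'0).
pose n := maxn N1 (\max_j N2 j).
have nN1 : (N1 <= n)%N by exact: leq_maxl.
have nN2 j : (N2 j <= n)%N by rewrite (leq_trans _ (leq_maxr _ _))// leq_bigmax.
have [r r0 fr] := frechet_ball (@ef n z) e'0.
exists (Num.min (1 / 2) r); first by rewrite lt_min r0 divr_gt0.
move=> v; rewrite rnormE ltcR lt_min => /andP[v2 vr].
rewrite -rmorphM lecR e'E !mulrDl.
rewrite (telescope2 (f_ n (v + z)) _ (f_ n z) _ (L z n v)).
rewrite (le_trans (normcD _ _))// lerD//; last first.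
  rewrite LE /lsum -sumrB (le_trans (normc_sum _))//.
  rewrite -mulrA mulr_natl -[X in _ * (_ *+ X)](card_ord d) -sumr_const mulr_sumr.
  apply: ler_sum => j _; rewrite -mulrBr Normc.normcM mulrC.
  by rewrite ler_pM ?normc_ge0//; [exact: fN2|exact: coord_le_rnorm].
rewrite (le_trans (normcD _ _))// lerD//; last first.
  by rewrite -lecR rmorphM /= -rnormE; apply: fr; rewrite rnormE ltcR.
rewrite normcN1; apply/ler_addgt0Pl => a a0; have a2 : 0 < a / 2 by rewrite divr_gt0.
have [M1 fM1] := fl (v + z) _ a2; have [M2 fM2] := fl z _ a2.
pose m := maxn N1 (maxn M1 M2).
have mN1 : (N1 <= m)%N by exact: leq_maxl.
have mM1 : (M1 <= m)%N by rewrite (leq_trans _ (leq_maxr _ _))// leq_maxl.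
have mM2 : (M2 <= m)%N by rewrite (leq_trans _ (leq_maxr _ _))// leq_maxr.
rewrite (telescope3 _ _ _ _ (f_ m (v + z)) (f_ m z)).
rewrite (le_trans (normcD _ _))// lerD//; last by apply: fN1 => //; exact: ltW.
by rewrite (le_trans (normcB _ _))// [leRHS]splitr lerD//; [exact: fM1|exact: fM2].
Qed.

End seq.
End bounds.
End limit_entire.

(** * The weights *)

Section weights.
Context (R : realType) (d : nat) (nrm : vnorm R d) (beta : R) (U : set 'rV[R]_d).
Hypotheses (beta_lt1 : beta < 1) (coneU : is_cone U).
Local Notation C := R[i].
Local Notation V := ('rV[C]_d).
Local Notation weight := (weight nrm beta U).
Local Notation p := ((1 - beta)^-1).

Let p_gt0 : 0 < p.
Proof. by rewrite invr_gt0 subr_gt0. Qed.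

Lemma vdist_ge0 x : 0 <= vdist nrm U x.
Proof.
have [[u Uu] _] := coneU; apply: lb_le_inf; first by exists (nrm (x - u)), u.
by move=> _ [v _ <-]; exact: vnorm_ge0.
Qed.

Lemma vdist_le x u : U u -> vdist nrm U x <= nrm (x - u).
Proof.
move=> Uu; apply: ge_inf; last by exists u.
by exists 0 => _ [v _ <-]; exact: vnorm_ge0.
Qed.

(** Dilations preserve U, as it is a cone. *)
Lemma vdistZ (B : R) x : 0 < B -> vdist nrm U (B *: x) = B * vdist nrm U x.
Proof.
have le (b : R) y : 0 < b -> vdist nrm U (b *: y) <= b * vdist nrm U y.
  move=> b0; have [[u Uu] UZ] := coneU.
  rewrite mulrC -ler_pdivrMr//; apply: lb_le_inf; first by exists (nrm (y - u)), u.
  move=> _ [v Uv <-]; rewrite ler_pdivrMr// mulrC -[X in X * _](gtr0_norm b0) -vnormZ scalerBr.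
  by apply: vdist_le; exact: UZ.
move=> B0; apply/eqP; rewrite eq_le le//=.
rewrite mulrC -ler_pdivlMr// mulrC -[X in vdist _ _ X](scalerK (lt0r_neq0 B0)).
by rewrite le// invr_gt0.
Qed.

(** The weight of index (B, N) is wX^(2N) exp (- 2 B^p wT); see [weightE]. *)
Definition wX (z : V) : R := \prod_j (1 + `|re_rV z 0 j|).
Definition wT (z : V) : R := vdist nrm U (re_rV z) `^ p + nrm (im_rV z) `^ p.

Lemma wX_ge1 z : 1 <= wX z.
Proof.
rewrite /wX; elim/big_ind : _ => // [x y x1 y1|j _]; last by rewrite lerDl.
by rewrite (le_trans x1)// ler_peMr// (le_trans _ x1).
Qed.

Lemma wT_ge0 z : 0 <= wT z.
Proof. by rewrite addr_ge0// powR_ge0. Qed.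

Lemma weightE (B : R) N z : 0 < B ->
  weight B N z = wX z ^+ (2 * N) * expR (- (2 * B `^ p * wT z)).
Proof.
move=> B0; rewrite /weight prodrXl; congr (_ * expR _).
rewrite vdistZ// vnormZ (gtr0_norm B0).
by rewrite !powRM ?vdist_ge0 ?vnorm_ge0 ?(ltW B0)// /wT; ring.
Qed.

Lemma weight_mono (B B' : R) N N' z : 0 < B' -> B' <= B -> (N <= N')%N ->
  weight B N z <= weight B' N' z.
Proof.
move=> B'0 BB NN; have B0 : 0 < B by exact: lt_le_trans BB.
rewrite (weightE _ _ B0) (weightE _ _ B'0); apply: ler_pM.
- by rewrite exprn_ge0// (le_trans _ (wX_ge1 z)).
- exact: expR_ge0.
- by rewrite ler_weXn2l ?wX_ge1// leq_mul2l NN orbT.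
- rewrite ler_expR lerN2 ler_wpM2r ?wT_ge0// ler_wpM2l//.
  by rewrite ge0_ler_powR// ?nnegrE ltW.
Qed.

(** Where the exponential gain from n to B' does not absorb the polynomial factor,
    that factor bounds a power of the gain, hence the exponential loss from B' to
    B'': m is such that the m-th power of the gain exceeds the loss. *)
Lemma weight_interp (n B' B'' delta : R) (N' : nat) : 0 < n -> n < B' -> B' < B'' -> 0 < delta ->
  exists2 c : R, 0 <= c & exists N'' : nat, forall z,
    weight B' N' z <= delta * weight n 0 z + c * weight B'' N'' z.
Proof.
move=> n0 nB BB delta0; have B'0 := lt_trans n0 nB; have B''0 := lt_trans B'0 BB.
pose a := n `^ p; pose a' := B' `^ p; pose a'' := B'' `^ p.
have aa' : a < a' by apply: gt0_ltr_powR => //; rewrite ?nnegrE ltW.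
have aa'' : a' < a'' by apply: gt0_ltr_powR => //; rewrite ?nnegrE ltW.
pose m := (Num.trunc ((a'' - a') / (a' - a))).+1.
have am0 : 0 < a' - a by rewrite subr_gt0.
have mP : a'' - a' <= m%:R * (a' - a).
  by rewrite -ler_pdivrMr// ltW// truncnS_gt.
exists (delta^-1 ^+ m); first by rewrite exprn_ge0// invr_ge0 ltW.
exists (N' * m.+1)%N => z; rewrite !weightE// muln0 expr0 mul1r -/a -/a' -/a''.
set T := wT z; set X := wX z.
have T0 : 0 <= T by exact: wT_ge0.
have X1 : 1 <= X by exact: wX_ge1.
have X0 k : 0 <= X ^+ k by rewrite exprn_ge0// (le_trans _ X1).
have [h|h] := leP (X ^+ (2 * N') * expR (- (2 * (a' - a) * T))) delta.
  rewrite (_ : - (2 * a' * T) = - (2 * (a' - a) * T) + - (2 * a * T)); last by ring.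
  rewrite expRD mulrA (le_trans (y := delta * expR (- (2 * a * T))))//.
    by rewrite ler_wpM2r// expR_ge0.
  rewrite lerDl; apply: mulr_ge0; first by rewrite exprn_ge0// invr_ge0 ltW.
  by apply: mulr_ge0; [exact: X0|exact: expR_ge0].
have X2 : expR (2 * (a' - a) * T) <= X ^+ (2 * N') / delta.
  rewrite ler_pdivlMr// mulrC -ler_pdivlMr ?expR_gt0// -expRN; exact: ltW.
apply: (@le_trans _ _ (delta^-1 ^+ m * (X ^+ (2 * (N' * m.+1)) * expR (- (2 * a'' * T))))); last first.
  by rewrite lerDr mulr_ge0// ?expR_ge0// ltW.
rewrite (_ : - (2 * a' * T) = 2 * (a'' - a') * T + - (2 * a'' * T)); last by ring.
rewrite expRD !mulrA ler_wpM2r ?expR_ge0//.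
rewrite (_ : (2 * (N' * m.+1) = 2 * N' + (2 * N') * m)%N); last by rewrite mulnA mulnS.
rewrite exprD mulrCA ler_wpM2l ?X0// exprM -exprMn mulrC.
apply: (@le_trans _ _ (expR (2 * (a' - a) * T) ^+ m)); last first.
  rewrite (mulrC delta^-1); apply: lerXn2r; [exact: expR_ge0| |exact: X2].
  by apply: divr_ge0; [exact: X0|exact: ltW].
rewrite -expRM_natl ler_expR; move: (m%:R) mP => M mP.
rewrite (_ : T * _ = (2 * T) * (a'' - a')); last by ring.
rewrite (_ : M * _ = (2 * T) * (M * (a' - a))); last by ring.
by rewrite ler_wpM2l// mulr_ge0.
Qed.

Lemma weight_box_lower (B r : R) : 0 < B -> exists2 m : R, 0 < m &
  forall N z, (forall j, `|re_rV z 0 j| <= r) -> (forall j, `|im_rV z 0 j| <= r) -> m <= weight B N z.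
Proof.
move=> B0; have [[u Uu] _] := coneU.
pose S := \sum_j nrm (delta_mx 0 j).
have S0 : 0 <= S by apply: sumr_ge0 => j _; exact: vnorm_ge0.
pose K := (r * S + nrm u) `^ p + (r * S) `^ p.
exists (expR (- (2 * B `^ p * K))); first exact: expR_gt0.
move=> N z zr zi; rewrite weightE//.
have nr : nrm (re_rV z) <= r * S by exact: vnorm_le_coord.
have ni : nrm (im_rV z) <= r * S by exact: vnorm_le_coord.
have rS : 0 <= r * S by exact: le_trans (vnorm_ge0 _ _) nr.
rewrite -[leLHS]mul1r ler_pM ?expR_ge0//.
  by rewrite exprn_ege1// wX_ge1.
rewrite ler_expR lerN2 ler_wpM2l ?mulr_ge0 ?powR_ge0// /wT lerD//.
  rewrite ge0_ler_powR ?nnegrE ?vdist_ge0 ?addr_ge0 ?vnorm_ge0 ?(ltW p_gt0)//.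
  by rewrite (le_trans (vdist_le _ Uu))// (le_trans (vnormD _ _ _))// vnormN lerD.
by rewrite ge0_ler_powR ?nnegrE ?vnorm_ge0 ?(ltW p_gt0).
Qed.

End weights.

(** * Weighted L2 forms *)

Section quadratic_forms.
Context (R : realType) (d : nat).
Local Notation C := R[i].
Local Notation V := ('rV[C]_d).
Local Notation RT := (measurableTypeR R).
Local Notation P := ((d.-tuple RT * d.-tuple RT)%type).
Local Notation normc := (@Normc.normc R).
Local Notation lam := (@lebesgue_tuple R d).
Implicit Types (f g : V -> C^o) (W : V -> R).

(** [sqnormH] is the case where W is the weight of index (B, N). *)
Definition qform W f : \bar R := integralC (fun z => normc (f z) ^+ 2 * W z).

Definition is_weight W :=
  measurable_fun setT (fun p : P => W (Defs.cpoint p) : RT) /\ forall z, 0 <= W z.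

Lemma integrand_ge0 W f z : is_weight W -> 0 <= normc (f z) ^+ 2 * W z.
Proof. by move=> [_ W0]; rewrite mulr_ge0// sqr_ge0. Qed.

Lemma measurable_qform W f : entire f -> is_weight W -> measurable_fun setT
  (fun p : P => (normc (f (Defs.cpoint p)) ^+ 2 * W (Defs.cpoint p))%:E).
Proof.
move=> ef [mW _]; apply/measurable_EFinP; apply: measurable_funM => //.
by apply: measurable_funX; exact: measurable_entire.
Qed.

Lemma qform_ge0 W f : is_weight W -> (0 <= qform W f)%E.
Proof. by move=> wW; apply: integral_ge0 => p _; rewrite lee_fin integrand_ge0. Qed.

Lemma qform_le2 f1 f2 f3 W1 W2 W3 (a b : R) : entire f2 -> entire f3 ->
  is_weight W1 -> is_weight W2 -> is_weight W3 -> 0 <= a -> 0 <= b ->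
  (forall z, normc (f1 z) ^+ 2 * W1 z <=
    a * (normc (f2 z) ^+ 2 * W2 z) + b * (normc (f3 z) ^+ 2 * W3 z)) ->
  (qform W1 f1 <= a%:E * qform W2 f2 + b%:E * qform W3 f3)%E.
Proof.
move=> ef2 ef3 w1 w2 w3 a0 b0 le123.
have g2 p : (0%R <= (normc (f2 (Defs.cpoint p)) ^+ 2 * W2 (Defs.cpoint p))%:E)%E.
  by rewrite lee_fin integrand_ge0.
have g3 p : (0%R <= (normc (f3 (Defs.cpoint p)) ^+ 2 * W3 (Defs.cpoint p))%:E)%E.
  by rewrite lee_fin integrand_ge0.
have m2 := measurable_qform ef2 w2.
have m3 := measurable_qform ef3 w3.
rewrite /qform /integralC -!ge0_integralZl//.
rewrite -ge0_integralD//; last 4 first.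
- by move=> p _; rewrite mule_ge0.
- exact: measurable_funeM.
- by move=> p _; rewrite mule_ge0.
- exact: measurable_funeM.
apply: le_integral_ge0 => p _; first by rewrite lee_fin integrand_ge0.
by rewrite -!EFinM -EFinD lee_fin.
Qed.

Lemma qform_le f W1 W2 (c : R) : entire f -> is_weight W1 -> is_weight W2 -> 0 <= c ->
  (forall z, W1 z <= c * W2 z) -> (qform W1 f <= c%:E * qform W2 f)%E.
Proof.
move=> ef w1 w2 c0 le12.
have := @qform_le2 f f f W1 W2 W2 c 0 ef ef w1 w2 w2 c0 (lexx _).
rewrite mul0e adde0; apply => z; rewrite mul0r addr0 mulrCA ler_wpM2l ?sqr_ge0//.
Qed.

Lemma qform_leD f W1 W2 W3 (a b : R) : entire f -> is_weight W1 -> is_weight W2 -> is_weight W3 ->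
  0 <= a -> 0 <= b ->
  (forall z, W1 z <= a * W2 z + b * W3 z) ->
  (qform W1 f <= a%:E * qform W2 f + b%:E * qform W3 f)%E.
Proof.
move=> ef w1 w2 w3 a0 b0 le123; apply: qform_le2 => // z.
by rewrite !(mulrCA _ (normc _ ^+ 2)) -mulrDr ler_wpM2l ?sqr_ge0.
Qed.

Lemma qform_convex (a b : C) f g W : entire f -> entire g -> is_weight W ->
  normc a + normc b <= 1 ->
  (qform W (a *: f + b *: g)%R <= (normc a)%:E * qform W f + (normc b)%:E * qform W g)%E.
Proof.
move=> ef eg w ab; apply: qform_le2 => //; rewrite ?normc_ge0// => z.
rewrite (mulrA (normc a)) (mulrA (normc b)) -mulrDl ler_wpM2r//; first by case: w.
have /le_trans -> // : normc ((a *: f + b *: g) z) ^+ 2 <=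
    (normc a * normc (f z) + normc b * normc (g z)) ^+ 2.
  apply: lerXn2r; [exact: normc_ge0|by apply: addr_ge0; apply: mulr_ge0; exact: normc_ge0|].
  by rewrite (le_trans (normcD _ _))// -!Normc.normcM.
have := normc_ge0 a; have := normc_ge0 b; move: (normc a) (normc b) (normc (f z)) (normc (g z)) ab.
move=> s t x y st t0 s0; rewrite -subr_ge0.
have -> : s * x ^+ 2 + t * y ^+ 2 - (s * x + t * y) ^+ 2 =
   s * t * (x - y) ^+ 2 + (1 - (s + t)) * (s * x ^+ 2 + t * y ^+ 2) by ring.
apply: addr_ge0; first by apply: mulr_ge0; [exact: mulr_ge0|exact: sqr_ge0].
apply: mulr_ge0; first by rewrite subr_ge0.
by apply: addr_ge0; apply: mulr_ge0 => //; exact: sqr_ge0.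
Qed.

Lemma qformZ W f (a : C) : entire f -> is_weight W ->
  qform W (a *: f) = ((normc a ^+ 2)%:E * qform W f)%E.
Proof.
move=> ef w; rewrite /qform /integralC -ge0_integralZl//=.
- by apply: eq_integral => p _; rewrite -EFinM [in RHS]mulrA -[in RHS]exprMn -Normc.normcM.
- exact: measurable_qform.
- by move=> p _; rewrite lee_fin integrand_ge0.
- by rewrite lee_fin sqr_ge0.
Qed.

Lemma qformD W f g : entire f -> entire g -> is_weight W ->
  (qform W (f + g)%R <= 2%:E * qform W f + 2%:E * qform W g)%E.
Proof.
move=> ef eg w; apply: qform_le2 => // z.
rewrite !(mulrA 2) -mulrDl ler_wpM2r//; first by case: w.
have /le_trans -> // : normc ((f + g) z) ^+ 2 <= (normc (f z) + normc (g z)) ^+ 2.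
  apply: lerXn2r; [exact: normc_ge0|by apply: addr_ge0; exact: normc_ge0|].
  exact: normcD.
by rewrite -subr_ge0 (_ : _ - _ = (normc (f z) - normc (g z)) ^+ 2) ?sqr_ge0//; ring.
Qed.

Lemma qformN W f : qform W (- f) = qform W f.
Proof. by apply: eq_integral => p _; rewrite normcN1. Qed.

Lemma qformB W f g : entire f -> entire g -> is_weight W ->
  (qform W (f - g)%R <= 2%:E * qform W f + 2%:E * qform W g)%E.
Proof.
move=> ef eg w; rewrite -[in leRHS](qformN W g).
apply: qformD; [exact: ef| |exact: w].
by move=> z; apply: (@differentiableN C V C^o); exact: eg.
Qed.

Lemma qform_fatou (F_ : nat -> V -> R) (F : V -> R) (c : \bar R) :
  (forall n, measurable_fun setT (fun p : P => F_ n (Defs.cpoint p) : RT)) ->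
  (forall n z, 0 <= F_ n z) ->
  (forall z, F_ n z @[n --> \oo] --> F z) ->
  (forall n, (integralC (F_ n) <= c)%E) -> (integralC F <= c)%E.
Proof.
move=> mF F0 FF Fc.
have mE n : measurable_fun setT (fun p : P => (F_ n (Defs.cpoint p))%:E) by (apply/measurable_EFinP; exact: mF).
have E0 n (p : P) : setT p -> (0%R <= (F_ n (Defs.cpoint p))%:E)%E by rewrite lee_fin.
have := fatou (lam \x lam)%E measurableT mE E0.
rewrite (eq_integral (fun p => (F (Defs.cpoint p))%:E)); last first.
  move=> p _; have cv : (F_ n (Defs.cpoint p))%:E @[n --> \oo] --> (F (Defs.cpoint p))%:E.
    by apply: cvg_EFin; [exact: nearW|exact: FF].
  by rewrite (cvg_limn_einf_sup cv).1.
move/le_trans; apply.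
rewrite limn_einf_lim; apply: lime_le; first exact: is_cvg_einfs.
apply: nearW => n; apply: (le_trans (y := integralC (F_ n))) => //.
by apply: ereal_inf_lbound; exists n => /=.
Qed.

End quadratic_forms.

(** * Continuous seminorms of the inductive limit *)

Section neighbourhoods.
Context (R : realType) (d : nat) (nrm : vnorm R d) (beta : R) (U : set 'rV[R]_d).
Hypotheses (beta_lt1 : beta < 1) (coneU : is_cone U).
Local Notation C := R[i].
Local Notation V := ('rV[C]_d).
Local Notation RT := (measurableTypeR R).
Local Notation P := ((d.-tuple RT * d.-tuple RT)%type).
Local Notation normc := (@Normc.normc R).
Local Notation weight := (weight nrm beta U).
Local Notation E := (Sbeta nrm beta U).
Local Notation normH := (normH nrm beta U).
Local Notation spaceSb := (spaceSb nrm beta U).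

Lemma is_weight_weight B N : is_weight (weight B N).
Proof. by split => [|z]; [exact: measurable_weight|exact: weight_ge0]. Qed.

Lemma spaceSb_fin b B N (f : V -> C^o) : spaceSb b f -> b < B -> (qform (weight B N) f < +oo)%E.
Proof. by move=> fb bB; have [] := fb B N bB. Qed.

Lemma qform_normH B N (f : V -> C^o) : (qform (weight B N) f < +oo)%E ->
  qform (weight B N) f = (normH B N f ^+ 2)%:E.
Proof.
move=> fy; have f0 := qform_ge0 f (is_weight_weight B N).
rewrite /normH sqr_sqrtr ?fine_ge0// fineK// ge0_fin_numE//.
Qed.

(** The weights whose form is finite and continuous on every step of the inductive
    limit; by [ind_base_qform] it is then continuous on the limit. *)
Definition dominated (W : V -> R) := is_weight W /\
  forall b, 0 < b -> exists B N (c : R), [/\ b < B, 0 <= c & forall z, W z <= c * weight B N z].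

Lemma dominated_fin W (f : E) : dominated W -> (qform W f < +oo)%E.
Proof.
move=> [wW dW]; have := SbetaP f; rewrite inE => -[b b0 fb].
have [B [N [c [bB c0 Wc]]]] := dW b b0.
apply: (le_lt_trans (qform_le (entire_Sbeta f) wW (is_weight_weight B N) c0 Wc)).
by apply: lte_mul_pinfty; [rewrite lee_fin|by []|exact: (spaceSb_fin N fb bB)].
Qed.

Lemma absconvex_qform W (e : R) : is_weight W -> absconvex [set f : E | (qform W f <= e%:E)%E].
Proof.
move=> wW a b x y ab /= xe ye.
have {}ab : normc a + normc b <= 1 by rewrite -lecR rmorphD.
have e0 : 0 <= e by rewrite -lee_fin; exact: le_trans (qform_ge0 x wW) xe.
apply: (le_trans (qform_convex (entire_Sbeta x) (entire_Sbeta y) wW ab)).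
apply: (@le_trans _ _ ((normc a)%:E * e%:E + (normc b)%:E * e%:E)%E).
  by apply: leeD; apply: lee_wpmul2l => //; rewrite lee_fin normc_ge0.
by rewrite -!EFinM -EFinD lee_fin -mulrDl ler_piMl.
Qed.

Lemma ind_base_qform W (e : R) : dominated W -> 0 < e -> ind_base [set f : E | (qform W f <= e%:E)%E].
Proof.
move=> [wW dW] e0; split; first exact: absconvex_qform.
move=> b b0; have [B [N [c [bB c0 Wc]]]] := dW b b0.
exists [:: (B, N)]; first by move=> q; rewrite inE => /eqP ->.
have c1 : 0 < c + 1 by rewrite ltr_wpDl.
exists (Num.sqrt (e / (c + 1))); first by rewrite sqrtr_gt0 divr_gt0.
move=> f fb /(_ (B, N)); rewrite inE eqxx => /(_ isT) /= fe.
apply: (le_trans (qform_le (entire_Sbeta f) wW (is_weight_weight B N) c0 Wc)).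
rewrite qform_normH; last exact: (spaceSb_fin N fb bB).
rewrite -EFinM lee_fin; apply: (@le_trans _ _ (c * (e / (c + 1)))).
  rewrite ler_wpM2l// -[leRHS]sqr_sqrtr ?divr_ge0 ?(ltW e0) ?(ltW c1)//.
  by apply: lerXn2r; [exact: sqrtr_ge0|exact: sqrtr_ge0|exact: ltW].
by rewrite mulrCA ger_pMr// ler_pdivrMr// mul1r lerDl.
Qed.

Lemma ind_base_fincap (V_ : nat -> set E) : (forall n, ind_base (V_ n)) ->
  forall k, ind_base [set f | forall n, (n < k)%N -> V_ n f].
Proof.
move=> bV; elim=> [|k ih].
  rewrite (_ : [set _ | _] = setT); first exact: ind_baseT.
  by apply/seteqP; split.
rewrite (_ : [set _ | _] = [set f | forall n, (n < k)%N -> V_ n f] `&` V_ k).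
  exact: ind_baseI.
apply/seteqP; split => f /=.
  by move=> fV; split => [n nk|]; apply: fV => //; exact: ltnW.
by move=> [fV fk] n; rewrite ltnS leq_eqVlt => /predU1P[->|/fV].
Qed.

(** On each step only finitely many of the conditions remain besides a common
    ball, and a finite intersection is harmless. *)
Lemma ind_base_bigcap (V_ : nat -> set E) : (forall n, ind_base (V_ n)) ->
  (forall b, 0 < b -> exists n0 B, b < B /\ forall (f : E), spaceSb b f ->
     normH B 0 f < 1 -> forall n, (n0 <= n)%N -> V_ n f) ->
  ind_base [set f | forall n, V_ n f].
Proof.
move=> bV tV; split.
  by move=> a b x y ab Vx Vy n; apply: (bV n).1.
move=> b b0; have [n0 [B [bB VB]]] := tV b b0.
have [s sb [e e0 sV]] := (ind_base_fincap bV n0).2 b b0.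
exists ((B, 0%N) :: s); first by move=> q; rewrite inE => /predU1P[->//|/sb].
exists (Num.min e 1); first by rewrite lt_min e0 ltr01.
move=> f fb fs n; have [nn0|n0n] := ltnP n n0.
  apply: sV => // q qs; have := fs q; rewrite inE qs orbT lt_min => /(_ isT).
  by case/andP.
apply: VB n0n => //; have := fs (B, 0%N); rewrite inE eqxx lt_min => /(_ isT).
by case/andP.
Qed.

Definition boxC (r : R) : set V := [set z | forall j, `|re_rV z 0 j| <= r /\ `|im_rV z 0 j| <= r].

Lemma boxC_cpoint r (p : P) : boxC r (Defs.cpoint p) <-> box r p.
Proof. by split=> h j; have := h j; rewrite re_cpoint im_cpoint. Qed.

Definition cutoff (r : R) (W : V -> R) (z : V) : R := W z * \1_(boxC r) z.

Lemma is_weight_cutoff r W : is_weight W -> is_weight (cutoff r W).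
Proof.
move=> [mW W0]; split => [|z]; last by rewrite /cutoff mulr_ge0.
apply: measurable_funM => //.
rewrite (_ : (fun p => _) = \1_(@box R d r)); last first.
  apply/funext => p; rewrite !indicE.
  have -> // : (Defs.cpoint p \in boxC r) = (p \in @box R d r).
  by apply/idP/idP; rewrite !inE => h; apply/boxC_cpoint.
exact: (measurable_indic (@measurable_box R d r)).
Qed.

Lemma cutoff_le r W z : is_weight W -> cutoff r W z <= W z.
Proof.
move=> [_ W0]; rewrite /cutoff indicE; case: (_ \in _); first by rewrite mulr1.
by rewrite mulr0.
Qed.

(** On a bounded region all the weights are bounded below. *)
Lemma dominated_cutoff r W (c : R) : is_weight W -> 0 <= c -> (forall z, W z <= c) ->
  dominated (cutoff r W).
Proof.
move=> wW c0 Wc; split; first exact: is_weight_cutoff.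
move=> b b0; have b1 : 0 < b + 1 by rewrite addr_gt0.
have [m m0 mP] := weight_box_lower nrm beta_lt1 coneU r b1.
exists (b + 1), 0%N, (c / m); split; first by rewrite ltrDl.
  by rewrite divr_ge0// ltW.
move=> z; rewrite /cutoff indicE; case: (boolP (z \in boxC r)) => zr /=.
  have zb : boxC r z by exact: set_mem zr.
  rewrite mulr1 (le_trans (Wc z))// -[leLHS](divfK (lt0r_neq0 m0)) ler_wpM2l//.
    by rewrite divr_ge0// ltW.
  by apply: mP => j; case: (zb j).
by rewrite mulr0 mulr_ge0 ?weight_ge0 ?divr_ge0// ltW.
Qed.

(** Controls the form of index (B, N) on a ball of that of index (n, 0), up to the
    error delta, while its own form is continuous on the limit. *)
Definition excess (n B : R) (N : nat) (delta : R) (z : V) : R :=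
  Num.max 0 (weight B N z - delta * weight n 0 z).

Lemma is_weight_excess n B N delta : is_weight (excess n B N delta).
Proof.
split => [|z]; last by rewrite /excess le_max lexx.
apply: measurable_maxr => //; apply: measurable_funB; first exact: measurable_weight.
by apply: measurable_funM => //; exact: measurable_weight.
Qed.

(** On the steps of index less than B the weight of index (B, N) itself is
    continuous; on the others [weight_interp] bounds the excess by a weight of
    larger index. *)
Lemma dominated_excess n B N delta : 0 < n -> n < B -> 0 < delta ->
  dominated (excess n B N delta).
Proof.
move=> n0 nB delta0; split; first exact: is_weight_excess.
move=> b b0; pose B' := Num.max b B + 1.
have bB : b < B' by rewrite ltr_pwDr// le_max lexx.
have BB : B < B' by rewrite ltr_pwDr// le_max lexx orbT.
have [c c0 [N' wc]] := weight_interp nrm beta_lt1 coneU N n0 nB BB delta0.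
exists B', N', c; split => // z; rewrite /excess ge_max; apply/andP; split.
  by rewrite mulr_ge0// weight_ge0.
by rewrite lerBlDl.
Qed.

Lemma qform_excess n B N delta (f : E) : 0 < delta ->
  (qform (weight B N) f <= delta%:E * qform (weight n 0) f + qform (excess n B N delta) f)%E.
Proof.
move=> delta0; rewrite -[X in (_ + X)%E]mul1e.
apply: qform_leD; [exact: entire_Sbeta|exact: is_weight_weight|exact: is_weight_weight|
  exact: is_weight_excess|exact: ltW|exact: ler01|].
by move=> z; rewrite mul1r /excess addrC -lerBlDr le_max lexx orbT.
Qed.

End neighbourhoods.

(** * Bounded sets *)

Section bounded_sets.
Context (R : realType) (d : nat) (nrm : vnorm R d) (beta : R) (U : set 'rV[R]_d).
Hypotheses (beta_lt1 : beta < 1) (coneU : is_cone U).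
Local Notation C := R[i].
Local Notation V := ('rV[C]_d).
Local Notation normc := (@Normc.normc R).
Local Notation weight := (weight nrm beta U).
Local Notation E := (Sbeta nrm beta U).
Local Notation normH := (normH nrm beta U).
Local Notation spaceSb := (spaceSb nrm beta U).

Lemma weight0_le1 B z : weight B 0 z <= 1.
Proof.
rewrite /Defs.weight muln0 big1 ?mul1r => [|j _]; last by rewrite expr0.
by rewrite -expR0 ler_expR subr_le0 (le_trans (y := 0))// ?oppr_le0 mulr_ge0 ?powR_ge0.
Qed.

Lemma boxC_rnorm (r : R) (z : V) : rnorm z <= r -> boxC r z.
Proof.
move=> zr j; rewrite !mxE; split.
  by rewrite (le_trans (Re_le_normc _))// (le_trans (coord_le_rnorm _ _)).
by rewrite (le_trans (Im_le_normc _))// (le_trans (coord_le_rnorm _ _)).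
Qed.

Lemma qform_cutoff_le (W : V -> R) (f : V -> C^o) (c : \bar R) : is_weight W -> entire f ->
  (forall r, (qform (cutoff r W) f <= c)%E) -> (qform W f <= c)%E.
Proof.
move=> wW ef fc; apply: (@qform_fatou R d (fun n z => normc (f z) ^+ 2 * cutoff n%:R W z)).
- by move=> n; apply/measurable_EFinP; apply: measurable_qform => //; exact: is_weight_cutoff.
- by move=> n z; apply: integrand_ge0; exact: is_weight_cutoff.
- move=> z; apply: cvg_near_cst.
  exists (Num.trunc (rnorm z)).+1 => // n /= zn; rewrite /cutoff indicE mem_set ?mulr1//.
  by apply: boxC_rnorm; rewrite (le_trans (ltW (truncnS_gt _)))// ler_nat.
- by move=> n; exact: fc.
Qed.

Lemma tvs_bounded_absorb (A : set E) (W : set E) : tvs_bounded A -> ind_base W ->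
  exists l : C, forall f, A f -> exists2 v : E, W v & f = l *: v.
Proof.
move=> bA bW; have [|r r0 rA] := bA W; first by apply/nbhs0_SbetaE; exists W.
exists r => f Af; have [|v Wv <-] := rA r _ f Af; first by rewrite ger0_norm// ltW.
by exists v.
Qed.

(** Otherwise for each n some f_n in A has a form of index (n+1, 0) greater than n,
    already when truncated to a large enough region. The truncated forms are
    continuous, and those of index n >= n0 are at most the form of index
    (n0+1, 0); so the f where all of them are at most 1 form a neighbourhood of
    0, which fails to absorb A. *)
Lemma tvs_bounded_step (A : set E) : tvs_bounded A ->
  exists n : nat, exists M : R, forall f, A f -> (qform (weight n.+1%:R 0) f <= M%:E)%E.
Proof.
move=> bA; apply: contrapT => no.
have key n : exists fr : E * R, A fr.1 /\
    (n%:R%:E < qform (cutoff fr.2 (weight n.+1%:R 0)) fr.1)%E.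
  apply: contrapT => /forallNP nofr; apply: no; exists n, n%:R => f Af.
  apply: qform_cutoff_le => [||r]; [exact: is_weight_weight|exact: entire_Sbeta|].
  by rewrite leNgt; apply/negP => h; apply: (nofr (f, r)).
have [fr frP] := choice key.
pose W n := [set f : E | (qform (cutoff (fr n).2 (weight n.+1%:R 0)) f <= 1%:E)%E].
have bW n : ind_base (W n).
  apply: ind_base_qform => //; apply: (@dominated_cutoff R d nrm beta U beta_lt1 coneU _ _ 1) => //.
    exact: is_weight_weight.
  exact: weight0_le1.
have bcap : ind_base [set f | forall n, W n f].
  apply: ind_base_bigcap => // b b0.
  pose n0 := Num.trunc b; have bn0 : b < n0.+1%:R by exact: truncnS_gt.
  exists n0, n0.+1%:R; split => // f fb fn n n0n; rewrite /W /=.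
  apply: (@le_trans _ _ (1%:E * qform (weight n0.+1%:R 0) f)%E); last first.
    rewrite mul1e qform_normH; last exact: (spaceSb_fin 0 fb bn0).
    by rewrite lee_fin expr_le1// ?sqrtr_ge0// ltW.
  apply: qform_le; [exact: entire_Sbeta|apply: is_weight_cutoff; exact: is_weight_weight|
    exact: is_weight_weight|exact: ler01|move=> z].
  rewrite mul1r; apply: le_trans (cutoff_le _ _ (is_weight_weight _ _ _ _ _)) _.
  by apply: weight_mono => //; rewrite ?ltr0n// ler_nat.
have [l lA] := tvs_bounded_absorb bA bcap.
pose n := (Num.trunc (normc l ^+ 2)).+1.
have [Af nf] := frP n; have [v Wv fv] := lA _ Af.
move: nf; rewrite fv qformZ; [|exact: entire_Sbeta|apply: is_weight_cutoff; exact: is_weight_weight].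
apply/negP; rewrite -leNgt (le_trans (y := ((normc l ^+ 2)%:E * 1%:E)%E))//.
  by apply: lee_wpmul2l; [rewrite lee_fin sqr_ge0|exact: Wv].
by rewrite mule1 lee_fin ltW// truncnS_gt.
Qed.

(** On the set A, bounded for the norm of index (n+1, 0), each norm of larger index
    is bounded by that norm and by the form of an excess weight, which is bounded
    on A like every continuous seminorm. *)
Lemma bounded_in_step (A : set E) : tvs_bounded A ->
  exists b : R, [/\ 0 < b, forall f, A f -> spaceSb b f
    & forall (B : R) (N : nat), b < B -> exists M : R, forall f, A f -> normH B N f <= M].
Proof.
move=> bA; have [n [M AM]] := tvs_bounded_step bA.
have n0 : 0 < n.+1%:R :> R by rewrite ltr0n.
have bound B N : n.+1%:R < B -> exists M' : R, forall f, A f -> (qform (weight B N) f <= M'%:E)%E.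
  move=> nB; pose W := excess nrm beta U n.+1%:R B N 1.
  have dW : dominated nrm beta U W by exact: dominated_excess.
  have [l lA] := tvs_bounded_absorb bA (ind_base_qform dW ltr01).
  exists (M + normc l ^+ 2) => f Af.
  apply: (le_trans (qform_excess _ _ _ _ ltr01)); rewrite mul1e EFinD leeD//; first exact: AM.
  have [v /= Wv ->] := lA f Af.
  rewrite qformZ; [|exact: entire_Sbeta|exact: dW.1].
  rewrite -[leRHS]mule1; apply: lee_wpmul2l => //; by rewrite lee_fin sqr_ge0.
have fin B N f : A f -> n.+1%:R < B -> (qform (weight B N) f < +oo)%E.
  by move=> Af nB; have [M' AM'] := bound B N nB; rewrite (le_lt_trans (AM' f Af))// ltry.
exists n.+1%:R; split => //.
  by move=> f Af B N nB; split; [exact: entire_Sbeta|exact: fin].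
move=> B N nB; have [M' AM'] := bound B N nB; exists (Num.sqrt M') => f Af.
rewrite -[leLHS]ger0_norm ?sqrtr_ge0// -sqrtr_sqr ler_wsqrtr// -lee_fin -qform_normH; last exact: fin.
exact: AM'.
Qed.

Lemma step_bounded (A : set E) (b : R) : 0 < b -> (forall f, A f -> spaceSb b f) ->
  (forall (B : R) (N : nat), b < B -> exists M : R, forall f, A f -> normH B N f <= M) ->
  tvs_bounded A.
Proof.
move=> b0 Ab AM W /nbhs0_SbetaE[W0 bW0 WW0].
have [s sb [e e0 sW]] := bW0.2 b b0.
have [M M0 MP] : exists2 M : R, 0 < M & forall q, q \in s -> forall f, A f -> normH q.1 q.2 f <= M.
  elim: s sb {sW} => [|q s ih] sb; first by exists 1.
  have [|M M0 MP] := ih; first by move=> q' q's; apply: sb; rewrite inE q's orbT.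
  have [M' AM'] := AM q.1 q.2 (sb q (mem_head _ _)).
  exists (Num.max M M'); first by rewrite lt_max M0.
  move=> q'; rewrite inE => /predU1P[->|q's] f Af; rewrite le_max; apply/orP.
    by right; exact: AM'.
  by left; exact: MP.
pose r := (M + 1) / e.
have M1 : 0 < M + 1 by rewrite addr_gt0.
have r0 : 0 < r by rewrite divr_gt0.
exists r%:C%C; first by rewrite ltcR.
move=> l; rewrite normc_absE lecR => rl f Af.
have l0 : 0 < normc l by exact: lt_le_trans rl.
have ln0 : l != 0 by apply: contraTneq l0 => ->; rewrite Normc.normc0 ltxx.
exists (l^-1 *: f); last by rewrite scalerA divff// scale1r.
apply: WW0; apply: sW => [B N bB|q qs]; first by apply: spaceHZ; exact: Ab.
rewrite normHZ Normc.normcV mulrC ltr_pdivrMr//.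
rewrite (le_lt_trans (MP q qs f Af))// (lt_le_trans (y := e * r))//.
  by rewrite /r mulrC divfK ?gt_eqF// ltrDl.
by rewrite ler_pM2l.
Qed.

End bounded_sets.

(** * Separation and Cauchy filters *)

Section hausdorff_complete.
Context (R : realType) (d : nat) (nrm : vnorm R d) (beta : R) (U : set 'rV[R]_d).
Hypotheses (beta_lt1 : beta < 1) (coneU : is_cone U).
Local Notation C := R[i].
Local Notation V := ('rV[C]_d).
Local Notation RT := (measurableTypeR R).
Local Notation P := ((d.-tuple RT * d.-tuple RT)%type).
Local Notation normc := (@Normc.normc R).
Local Notation weight := (weight nrm beta U).
Local Notation E := (Sbeta nrm beta U).
Local Notation normH := (normH nrm beta U).
Local Notation spaceSb := (spaceSb nrm beta U).
Local Notation lam := (@lebesgue_tuple R d).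

Definition box_weight (r : R) : V -> R := cutoff r (fun=> 1).

Lemma is_weight_box_weight r : is_weight (box_weight r).
Proof. by apply: is_weight_cutoff; split => // z; exact: ler01. Qed.

Lemma dominated_box_weight r : dominated nrm beta U (box_weight r).
Proof.
apply: (@dominated_cutoff R d nrm beta U beta_lt1 coneU _ _ 1).
- by split => // z; exact: ler01.
- exact: ler01.
- by move=> z; exact: lexx.
Qed.

Lemma cpoint_ex (w : V) : exists p : P, Defs.cpoint p = w.
Proof.
exists ([tuple complex.Re (w 0 j) | j < d], [tuple complex.Im (w 0 j) | j < d]).
by apply/rowP => j; rewrite !mxE !tnth_mktuple; case: (w 0 j).
Qed.

(** From [entire_L2_bound]: the term in 1 / l is made at most e / 2 by the choice
    of l, then the one in l by the choice of eta. *)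
Lemma qform_point_bound (r e : R) : 0 < e -> exists2 eta : R, 0 < eta &
  forall f : V -> C^o, entire f -> (qform (box_weight (r + 2)) f <= eta%:E)%E ->
    forall w, rnorm w <= r -> normc (f w) <= e.
Proof.
move=> e0; pose v := fine ((lam \x lam)%E (@box R d (r + 2))).
have v0 : 0 <= v by rewrite fine_ge0.
have vE : (lam \x lam)%E (@box R d (r + 2)) = v%:E.
  by rewrite fineK// ge0_fin_numE// box_fin.
pose K : R := 16 ^+ d; have K0 : 0 < K by rewrite exprn_gt0.
pose l := 2 * K * (v + 1) / e.
have v1 : 0 < v + 1 by rewrite ltr_wpDl.
have l0 : 0 < l by apply: divr_gt0 => //; apply: mulr_gt0 => //; apply: mulr_gt0.
exists (e / (2 * K * l)); first by apply: divr_gt0 => //; apply: mulr_gt0 => //; apply: mulr_gt0.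
move=> f ef fe w wr; have [p pw] := cpoint_ex w.
have bp : box r p by apply/boxC_cpoint; rewrite pw; exact: boxC_rnorm.
have := entire_L2_bound ef bp l0; rewrite pw vE.
have -> : (\int[(lam \x lam)%E]_(q in box (r + 2)) (normc (f (Defs.cpoint q)) ^+ 2)%:E)%E =
    qform (box_weight (r + 2)) f.
  rewrite integral_mkcond; apply: eq_integral => q _; rewrite patchE /box_weight /cutoff mul1r indicE.
  have -> : (q \in box (r + 2)) = (Defs.cpoint q \in boxC (r + 2)).
    by apply/idP/idP; rewrite !inE => h; apply/boxC_cpoint.
  by case: (_ \in _); rewrite ?mulr1 ?mulr0.
move=> h; rewrite -lee_fin (le_trans h)//.
apply: (@le_trans _ _ (K%:E * (l%:E * (e / (2 * K * l))%:E + l^-1%:E * v%:E))%E).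
  apply: lee_wpmul2l; first by rewrite lee_fin ltW.
  apply: leeD => //; apply: lee_wpmul2l => //; by rewrite lee_fin ltW.
rewrite -[leLHS]/((K * (l * (e / (2 * K * l)) + l^-1 * v))%:E) lee_fin /l.
rewrite [leLHS](_ : _ = e / 2 + e / 2 * (v / (v + 1))); last first.
  by field; rewrite !gt_eqF.
rewrite [leRHS]splitr lerD2l ger_pMr ?divr_gt0//.
by rewrite ler_pdivrMr// mul1r lerDl.
Qed.

Lemma weight_point_bound (B r e : R) : 0 < B -> 0 < e -> exists2 eta : R, 0 < eta &
  forall f : V -> C^o, entire f -> (qform (weight B 0) f <= eta%:E)%E ->
    forall w, rnorm w <= r -> normc (f w) <= e.
Proof.
move=> B0 e0; have [eta eta0 h] := qform_point_bound r e0.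
have [m m0 mP] := weight_box_lower nrm beta_lt1 coneU (r + 2) B0.
exists (m * eta); first by rewrite mulr_gt0.
move=> f ef fe; apply: h => //.
apply: (@le_trans _ _ (m^-1%:E * qform (weight B 0) f)%E).
  apply: qform_le => //; [exact: is_weight_box_weight|exact: is_weight_weight|by rewrite invr_ge0 ltW|].
  move=> z; rewrite /box_weight /cutoff mul1r indicE; case: (boolP (z \in boxC (r + 2))) => zr /=.
    have zb : boxC (r + 2) z by exact: set_mem zr.
    by rewrite mulrC ler_pdivlMr// mul1r; apply: mP => j; case: (zb j).
  by rewrite mulr_ge0 ?weight_ge0// invr_ge0 ltW.
apply: (@le_trans _ _ (m^-1%:E * (m * eta)%:E)%E).
  by apply: lee_wpmul2l => //; rewrite lee_fin invr_ge0 ltW.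
by rewrite -EFinM mulKf// gt_eqF.
Qed.

(** The local L2 seminorms are continuous and separate the points. *)
Theorem Sbeta_hausdorff : hausdorff_space E.
Proof.
move=> x y xy; apply: val_inj; apply/funext => w /=.
apply/eqP; rewrite -subr_eq0; apply/eqP/Normc.eq0_normc/eqP.
rewrite eq_le normc_ge0 andbT; apply/ler_addgt0Pl => e e0; rewrite addr0.
have [eta eta0 h] := qform_point_bound (rnorm w) e0.
have eta4 : 0 < eta / 4 by rewrite divr_gt0.
have bW := ind_base_qform (dominated_box_weight (rnorm w + 2)) eta4.
set W := [set f | _] in bW.
have xW : nbhs x [set x + v | v in W] by exists W => // v Wv; exists v.
have yW : nbhs y [set y + v | v in W] by exists W => // v Wv; exists v.
have [_ [[v Wv <-] [v' Wv' vv]]] := xy _ _ xW yW.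
have xyE : x - y = v' - v by apply/eqP; rewrite subr_eq addrAC eq_sym subr_eq addrC vv addrC.
have := h (x - y : E) (entire_Sbeta _) _ w (lexx _); apply.
rewrite xyE; apply: (le_trans (qformB (entire_Sbeta _) (entire_Sbeta _) (is_weight_box_weight _))).
apply: (@le_trans _ _ (2%:E * (eta / 4)%:E + 2%:E * (eta / 4)%:E)%E).
  by apply: leeD; apply: lee_wpmul2l.
by rewrite -!EFinM -EFinD lee_fin; lra.
Qed.

Section cauchy_filter.
Context (F : set_system E) (FF : ProperFilter F) (cF : cauchy F).

Lemma cauchy_small (W : set E) : ind_base W ->
  exists2 G, F G & forall x y, G x -> G y -> W (x - y).
Proof.
move=> bW; have : entourage [set xy : E * E | W (xy.1 - xy.2)].
  by apply/entourage_SbetaE; exists W.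
move=> /cF [[G1 G2] /= [FG1 FG2] G12].
exists (G1 `&` G2); first exact: filterI.
by move=> x y [x1 _] [_ y2]; apply: (G12 (x, y)); split.
Qed.

Local Notation Qn n := (qform (weight n.+1%:R 0)).

(** Otherwise for each n some G_n in F and some neighbourhood W_n are such that
    G_n + W_n avoids the ball of radius n of the form Q_n of index (n+1, 0). The
    intersection of the sets {Q_n <= 1} + W_n is a neighbourhood of 0, so two
    elements of some G in F differ by an element of it. For x in G the numbers
    Q_n x decrease, so that x minus a point of {Q_n <= 1} is in the ball of
    radius n for large n, and also in y + W_n for any y in G and G_n. *)
Lemma cauchy_concentrated : exists n : nat, forall G W, F G -> ind_base W ->
  exists g v : E, [/\ G g, W v & (Qn n (g + v)%R <= n%:R%:E)%E].
Proof.
apply: contrapT => no.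
have key n : exists GW : set E * set E, [/\ F GW.1, ind_base GW.2 &
    forall g v : E, GW.1 g -> GW.2 v -> (n%:R%:E < Qn n (g + v)%R)%E].
  apply: contrapT => /forallNP nGW; apply: no; exists n => G W FG bW.
  apply: contrapT => ngv; apply: (nGW (G, W)); split => // g v Gg Wv.
  by rewrite ltNge; apply/negP => h; apply: ngv; exists g, v.
have [GW GWP] := choice key.
pose T n := [set x : E | exists u v : E, [/\ x = u + v, (Qn n u <= 1%:E)%E & (GW n).2 v]].
have aT n : absconvex (T n).
  move=> a b x y ab [u [v [-> u1 Wv]]] [u' [v' [-> u'1 Wv']]].
  exists (a *: u + b *: u'), (a *: v + b *: v'); split.
  - by rewrite !scalerDr addrACA.
  - exact: (absconvex_qform (is_weight_weight _ _ _ _ _) ab u1 u'1).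
  - by have [_ [aW _] _] := GWP n; exact: aW.
have bT n : ind_base (T n).
  have [_ bW _] := GWP n; split; first exact: aT.
  move=> b b0; have [s sb [e e0 sW]] := bW.2 b b0; exists s => //; exists e => // f fb fs.
  exists 0, f; split; [by rewrite add0r| |exact: sW].
  rewrite (_ : qform _ _ = 0%E) ?lee_fin//.
  have := qformZ 0 (entire_Sbeta (0 : E)) (is_weight_weight nrm beta U n.+1%:R 0).
  by rewrite scale0r Normc.normc0 expr0n/= mul0e.
have bcap : ind_base [set f | forall n, T n f].
  apply: ind_base_bigcap => // b b0.
  pose n0 := Num.trunc b; have bn0 : b < n0.+1%:R by exact: truncnS_gt.
  exists n0, n0.+1%:R; split => // f fb fn n n0n.
  exists f, 0; split; [by rewrite addr0| |by have [_ bW _] := GWP n; exact: ind_base0].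
  apply: (@le_trans _ _ (1%:E * Qn n0 f)%E); last first.
    rewrite mul1e qform_normH; last exact: (spaceSb_fin 0 fb bn0).
    by rewrite lee_fin expr_le1// ?sqrtr_ge0// ltW.
  apply: qform_le; [exact: entire_Sbeta|exact: is_weight_weight|
    exact: is_weight_weight|exact: ler01|move=> z].
  by rewrite mul1r; apply: weight_mono => //; rewrite ?ltr0n// ler_nat.
have [G FG GT] := cauchy_small bcap.
have [x Gx] := filter_ex FG.
have [b b0 xb] : exists2 b, 0 < b & spaceSb b x by have := SbetaP x; rewrite inE.
pose n0 := Num.trunc b; have bn0 : b < n0.+1%:R by exact: truncnS_gt.
pose M := fine (Qn n0 x).
have xM : Qn n0 x = M%:E.
  by rewrite fineK// ge0_fin_numE ?(spaceSb_fin 0 xb bn0)//; apply: qform_ge0; exact: is_weight_weight.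
pose n := maxn n0 (Num.trunc (2 * M + 2)).+1.
have n0n : (n0 <= n)%N by exact: leq_maxl.
have Mn : 2 * M + 2 <= n%:R.
  by rewrite (le_trans (ltW (truncnS_gt _)))// ler_nat leq_maxr.
have [FGn bWn GWn] := GWP n.
have [y [Gy Gny]] := filter_ex (filterI FG FGn).
have [u [v [xyE u1 Wv]]] := GT x y Gx Gy n.
have := GWn y v Gny Wv; apply/negP; rewrite -leNgt.
have -> : y + v = x - u.
  have xE : x = u + v + y by rewrite -xyE subrK.
  by rewrite xE -(addrA u v y) [RHS]addrC addKr addrC.
apply: (le_trans (qformB (entire_Sbeta _) (entire_Sbeta _) (is_weight_weight _ _ _ _ _))).
apply: (@le_trans _ _ (2%:E * M%:E + 2%:E * 1%:E)%E); last by rewrite -!EFinM -EFinD lee_fin mulr1.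
apply: leeD; apply: lee_wpmul2l => //; rewrite -xM -[leRHS]mul1e.
apply: qform_le; [exact: entire_Sbeta|exact: is_weight_weight|
  exact: is_weight_weight|exact: ler01|move=> z].
by rewrite mul1r; apply: weight_mono => //; rewrite ?ltr0n// ler_nat.
Qed.

End cauchy_filter.
End hausdorff_complete.

(** * Completeness *)

Section completeness.
Context (R : realType) (d : nat) (nrm : vnorm R d) (beta : R) (U : set 'rV[R]_d).
Hypotheses (beta_lt1 : beta < 1) (coneU : is_cone U).
Local Notation C := R[i].
Local Notation V := ('rV[C]_d).
Local Notation normc := (@Normc.normc R).
Local Notation weight := (weight nrm beta U).
Local Notation E := (Sbeta nrm beta U).
Local Notation normH := (normH nrm beta U).
Local Notation spaceSb := (spaceSb nrm beta U).
Local Notation Qn n := (qform (weight n.+1%:R 0)).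

Lemma rnorm_le (w : V) (r : R) : (forall j, normc (w 0 j) <= r) -> rnorm w <= Num.max r 0.
Proof.
move=> wr; have [w0|wn0] := eqVneq (rnorm w) 0; first by rewrite w0 le_max lexx orbT.
have : mx_norm w != 0.
  by apply: contra wn0 => /eqP h; apply/eqP; rewrite /rnorm (_ : `|w| = mx_norm w)// h.
move=> /mx_norm_neq0[[i j] /= wij].
have -> : rnorm w = normc (w 0 j).
  rewrite /rnorm (_ : `|w| = mx_norm w)// wij normc_absE /= (ord1 i)//.
by rewrite le_max wr.
Qed.

Section cauchy_filter.
Context (F : set_system E) (FF : ProperFilter F) (cF : cauchy F).

Definition near_ball n (G W : set E) : set E :=
  [set h | (Qn n h <= n%:R%:E)%E /\ exists g v : E, [/\ G g, W v & h = g + v]].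

(** On a fixed ball the interpolation of the weights turns the Cauchy property
    for the limit topology into the Cauchy property for each norm of a step. *)
Lemma near_ball_osc n (B : R) (N : nat) (e : R) : n.+1%:R < B -> 0 < e ->
  exists GW : set E * set E, [/\ F GW.1, ind_base GW.2 & forall h h' : E,
    near_ball n GW.1 GW.2 h -> near_ball n GW.1 GW.2 h' ->
    (qform (weight B N) (h - h')%R <= e%:E)%E].
Proof.
move=> nB e0; have n0 : 0 < n.+1%:R :> R by rewrite ltr0n.
pose delta := e / (8 * n.+1%:R).
have delta0 : 0 < delta by rewrite divr_gt0// mulr_gt0.
have dW := @dominated_excess R d nrm beta U beta_lt1 coneU _ _ N _ n0 nB delta0.
set X := excess _ _ _ _ _ _ _ in dW.
have e20 : 0 < e / 20 by rewrite divr_gt0.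
have bW := ind_base_qform dW e20.
have [G FG GP] := cauchy_small FF cF bW.
exists (G, [set f : E | (qform X f <= (e / 20)%:E)%E]); split => //=.
move=> h h' [hn [g [v [Gg Wv hE]]]] [h'n [g' [v' [Gg' Wv' h'E]]]].
rewrite {}hE in hn *; rewrite {}h'E in h'n *.
have ex := @qform_excess R d nrm beta U n.+1%:R B N delta (g + v - (g' + v')) delta0.
rewrite -/X in ex; apply: (le_trans ex).
have -> : e = e / 2 + e / 2 by rewrite -splitr.
rewrite EFinD; apply: leeD.
  have := qformB (entire_Sbeta (g + v)) (entire_Sbeta (g' + v')) (is_weight_weight nrm beta U n.+1%:R 0).
  move=> q4; have {}q4 : (Qn n (g + v - (g' + v'))%R <= (4 * n%:R)%:E)%E.
    apply: (le_trans q4); apply: (@le_trans _ _ (2%:E * n%:R%:E + 2%:E * n%:R%:E)%E).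
      by apply: leeD; apply: lee_wpmul2l.
    by rewrite -!EFinM -EFinD lee_fin; lra.
  apply: (@le_trans _ _ (delta%:E * (4 * n%:R)%:E)%E).
    by apply: lee_wpmul2l => //; rewrite lee_fin ltW.
  rewrite -EFinM lee_fin /delta.
  rewrite [leLHS](_ : _ = e / 2 * (n%:R / n.+1%:R)); last first.
    by move: n0; move: n.+1%:R n%:R => a c a0; field; rewrite gt_eqF.
  by rewrite ger_pMr ?divr_gt0// ler_pdivrMr// mul1r ler_nat.
have -> : g + v - (g' + v') = (g - g') + (v - v') by rewrite opprD addrACA.
apply: (le_trans (qformD (entire_Sbeta (g - g')) (entire_Sbeta (v - v')) dW.1)).
have h1 : (qform X (g - g')%R <= (e / 20)%:E)%E by exact: GP.
have h2 := qformB (entire_Sbeta v) (entire_Sbeta v') dW.1.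
have {}h2 : (qform X (v - v')%R <= (e / 5)%:E)%E.
  apply: (le_trans h2); apply: (@le_trans _ _ (2%:E * (e / 20)%:E + 2%:E * (e / 20)%:E)%E).
    by apply: leeD; apply: lee_wpmul2l.
  by rewrite -!EFinM -EFinD lee_fin; lra.
apply: (@le_trans _ _ (2%:E * (e / 20)%:E + 2%:E * (e / 5)%:E)%E).
  by apply: leeD; apply: lee_wpmul2l.
by rewrite -!EFinM -EFinD lee_fin; lra.
Qed.

(** [near_ball_osc] for the norms of index (n + 1 + 1 / (k + 1), k), which define
    the topology of the step n + 1, gives a sequence h_ that is Cauchy in all of
    them. Its limit f exists locally uniformly, is entire, and Fatou's lemma shows
    that the elements of [near_ball] are close to f in each norm. As the trace of
    a neighbourhood of 0 on the step contains a ball of finitely many norms, these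
    elements are close to f in the limit topology, and so are those of F. *)
Lemma cauchy_cvg_Sbeta : exists x : E, F --> x.
Proof.
have [n conc] := cauchy_concentrated beta_lt1 coneU FF cF.
have n0 : 0 < n.+1%:R :> R by rewrite ltr0n.
pose B k : R := n.+1%:R + k.+1%:R^-1.
have nB k : n.+1%:R < B k by rewrite ltrDl invr_gt0 ltr0n.
have B0 k : 0 < B k by exact: lt_trans (nB k).
pose ep k : R := k.+1%:R^-1.
have ep0 k : 0 < ep k by rewrite invr_gt0 ltr0n.
have [GW GWP] := choice (fun k => near_ball_osc k (nB k) (ep0 k)).
have FG k : F (GW k).1 by have [] := GWP k.
have bW k : ind_base (GW k).2 by have [] := GWP k.
pose S k := near_ball n (GW k).1 (GW k).2.
have osc k (h h' : E) : S k h -> S k h' -> (qform (weight (B k) k) (h - h')%R <= (ep k)%:E)%E.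
  by have [_ _] := GWP k; apply.
have FGcap l : F [set x | forall k, (k < l)%N -> (GW k).1 x].
  elim: l => [|l ih]; first by apply: filterS filterT => x _ k.
  apply: filterS (filterI ih (FG l)) => x [x1 x2] k.
  by rewrite ltnS leq_eqVlt => /predU1P[->//|/x1].
have [h_ hP] : exists h_ : nat -> E, forall l k, (k <= l)%N -> S k (h_ l).
  have key l : exists h : E, forall k, (k <= l)%N -> S k h.
    have [g [v [Gg Wv gvn]]] := conc _ _ (FGcap l.+1) (ind_base_fincap bW l.+1).
    exists (g + v) => k kl; split => //; exists g, v; split => //; [exact: Gg|exact: Wv].
  by have [h_ hP] := choice key; exists h_ => l k; exact: hP.
have ecf (r e : R) : 0 < e -> exists N, forall i j, (N <= i)%N -> (N <= j)%N ->
    forall w : V, (forall j, normc (w 0 j) <= r) -> normc (h_ i w - h_ j w) <= e.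
  move=> e0; have B1 : 0 < n.+1%:R + 1 :> R by rewrite addr_gt0.
  have [eta eta0 h] := @weight_point_bound R d nrm beta U beta_lt1 coneU _ (Num.max r 0) _ B1 e0.
  exists (Num.trunc eta^-1) => i j Ni Nj w wr.
  set N := Num.trunc _ in Ni Nj.
  have := h (h_ i - h_ j : E) (entire_Sbeta _) _ w (rnorm_le wr); apply.
  apply: (@le_trans _ _ (1%:E * qform (weight (B N) N) (h_ i - h_ j)%R)%E).
    apply: qform_le; [exact: entire_Sbeta|exact: is_weight_weight|exact: is_weight_weight|exact: ler01|move=> z].
    rewrite mul1r; apply: weight_mono => //; rewrite /B lerD2l invf_le1 ?ltr0n//.
    by rewrite ler1n.
  rewrite mul1e (le_trans (osc N _ _ (hP _ _ Ni) (hP _ _ Nj)))// lee_fin /ep.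
  by rewrite -[leRHS]invrK lef_pV2 ?posrE ?invr_gt0 ?ltr0n// ltW// truncnS_gt.
have [f fl] : exists f : V -> C^o, forall w e, 0 < e -> exists N, forall i, (N <= i)%N ->
    normc (h_ i w - f w) <= e.
  have key (w : V) : exists l : C, forall e, 0 < e -> exists N, forall i, (N <= i)%N ->
      normc (h_ i w - l) <= e.
    apply: complex_cauchy_cvg => e e0; have [N hN] := ecf (rnorm w) e e0.
    by exists N => i j Ni Nj; apply: hN => // k; exact: coord_le_rnorm.
  by have [f fP] := choice key; exists f.
have ef : entire f.
  by apply: (entire_limit (f_ := fun i => h_ i : V -> C^o)) fl => // i; exact: entire_Sbeta.
have fat k (h : E) : S k h -> (qform (weight (B k) k) (fun z => h z - f z)%R <= (ep k)%:E)%E.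
  move=> Skh; apply: (@qform_fatou R d (fun i z => normc (h z - h_ (k + i)%N z) ^+ 2 * weight (B k) k z)).
  - move=> i; apply/measurable_EFinP; apply: (measurable_qform (f := (h - h_ (k + i)%N : E))).
      exact: entire_Sbeta.
    exact: is_weight_weight.
  - by move=> i z; rewrite mulr_ge0 ?sqr_ge0 ?weight_ge0.
  - move=> z; have nc : normc (h z - h_ (k + i)%N z) @[i --> \oo] --> normc (h z - f z).
      apply/cvgrPdist_le => e e0; have [N fN] := fl z e e0.
      exists N => // i /= Ni; have tri (a b : C) : normc a - normc b <= normc (a - b).
        by rewrite lerBlDr (le_trans _ (normcD _ _))// subrK.
      have abE : (h z - f z) - (h z - h_ (k + i)%N z) = h_ (k + i)%N z - f z by ring.
      have le1 := fN (k + i)%N (leq_trans Ni (leq_addl _ _)).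
      rewrite ler_norml lerNl opprB; apply/andP; split.
        by rewrite (le_trans (tri _ _))// normc_distC abE.
      by rewrite (le_trans (tri _ _))// abE.
    by apply: cvgM; [rewrite expr2; apply: cvgM|exact: cvg_cst].
  - move=> i; apply: (osc k h (h_ (k + i)%N)) => //; apply: hP; exact: leq_addr.
have Sfin k (h : E) : S k h -> (qform (weight (B k) k) h < +oo)%E.
  move=> [hn _]; apply: (le_lt_trans (qform_excess n.+1%:R (B k) k h ltr01)).
  rewrite mul1e lte_add_pinfty//; first by rewrite (le_lt_trans hn)// ltry.
  by apply: dominated_fin; exact: dominated_excess.
have big (x : R) (N : nat) : n.+1%:R < x -> exists k0, forall k, (k0 <= k)%N -> (N <= k)%N /\ B k <= x.
  move=> nx; exists (maxn N (Num.trunc (x - n.+1%:R)^-1)) => k; rewrite geq_max => /andP[-> kx]; split => //.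
  rewrite /B addrC -lerBrDr -[leRHS]invrK lef_pV2 ?posrE ?invr_gt0 ?ltr0n ?subr_gt0//.
  by rewrite (le_trans (ltW (truncnS_gt _)))// ler_nat ltnS.
have fb : spaceSb n.+1%:R f.
  move=> x N nx; split => //; have [k kP] := big x N nx; have [Nk Bx] := kP k (leqnn k).
  change (qform (weight x N) f < +oo)%E.
  apply: (@le_lt_trans _ _ (1%:E * qform (weight (B k) k) f)%E).
    apply: qform_le => //; [exact: is_weight_weight|exact: is_weight_weight|move=> z].
    by rewrite mul1r; exact: weight_mono.
  have Sk := hP k k (leqnn k).
  have ehf : entire (fun z => h_ k z - f z : C^o).
    by move=> z; apply: (@differentiableB C V C^o); [exact: entire_Sbeta|exact: ef].
  rewrite mul1e (_ : f = (h_ k : V -> C^o) - (fun z => h_ k z - f z)); last first.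
    by apply/funext => z; rewrite /= fctE opprB addrC subrK.
  apply: (le_lt_trans (qformB (entire_Sbeta (h_ k)) ehf (is_weight_weight _ _ _ _ _))).
  apply: lte_add_pinfty; apply: lte_mul_pinfty => //; first exact: Sfin.
  by rewrite (le_lt_trans (fat _ _ Sk))// ltry.
have fS : f \in spaceS nrm beta U by rewrite inE; exists n.+1%:R.
pose fE : E := MkSbeta fS; exists fE.
move=> A [W bW0 WA].
pose W4 : set E := [set x | W ((4 : C) *: x)].
have bW4 : ind_base W4 by exact: ind_baseZ.
(* three summands instead of two: x - g, - v and g + v - f *)
have sum3 (a b c : E) : W4 a -> W4 b -> W4 c -> W (a + b + c).
  move=> Wa Wb Wc.
  have half : `|2^-1 : C| = 2^-1 by rewrite ger0_norm ?invr_ge0.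
  have quart : `|4^-1 : C| = 4^-1 by rewrite ger0_norm ?invr_ge0.
  have Wab : W ((2 : C) *: (a + b)).
    have -> : (2 : C) *: (a + b) = (2^-1 : C) *: ((4 : C) *: a) + (2^-1 : C) *: ((4 : C) *: b).
      rewrite !scalerA -scalerDr; congr (_ *: _).
      by rewrite (_ : 4 = 2 * 2 :> C) ?mulKf ?pnatr_eq0// -natrM.
    by apply: bW0.1 => //; rewrite half [leRHS]splitr mul1r.
  have -> : a + b + c = (2^-1 : C) *: ((2 : C) *: (a + b)) + (4^-1 : C) *: ((4 : C) *: c).
    by rewrite !scalerA !mulVf ?pnatr_eq0// !scale1r.
  apply: bW0.1 => //; rewrite half quart.
  rewrite (_ : (4^-1 : C) = 2^-1 * 2^-1); last by rewrite -invfM -natrM.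
  by rewrite [leRHS]splitr mul1r lerD2l ler_piMl// ?invr_ge0// invf_le1// ler1n.
have [G4 FG4 G4P] := cauchy_small FF cF bW4.
have [s sb [e e0 sW]] := bW4.2 _ n0.
have [k0 k0P] : exists k0, forall k, (k0 <= k)%N -> forall q, q \in s -> (q.2 <= k)%N /\ B k <= q.1.
  elim: s sb {sW} => [|q s ih] sb; first by exists 0%N.
  have [|k0 k0P] := ih; first by move=> q' q's; apply: sb; rewrite inE q's orbT.
  have [k1 k1P] := big q.1 q.2 (sb q (mem_head _ _)).
  exists (maxn k0 k1) => k; rewrite geq_max => /andP[kk0 kk1] q'; rewrite inE => /predU1P[->|].
    exact: k1P.
  exact: k0P.
pose k := maxn k0 (Num.trunc (e ^+ 2)^-1).
have epe : ep k < e ^+ 2.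
  rewrite /ep -[ltRHS]invrK ltf_pV2 ?posrE ?invr_gt0 ?exprn_gt0 ?ltr0n//.
  by rewrite (lt_le_trans (truncnS_gt _))// ler_nat ltnS leq_maxr.
have [g [v [[Gg G4g] [Wv W4v] gvn]]] := conc _ _ (filterI (FG k) FG4) (ind_baseI (bW k) bW4).
have Sgv : S k (g + v) by split => //; exists g, v.
have W4h : W4 (g + v - fE).
  apply: sW => [x N nx|q qs].
    have [b b0 gvb] : exists2 b, 0 < b & spaceSb b (g + v) by have := SbetaP (g + v); rewrite inE.
    have [j jP] := big x N nx; have [Nj Bj] := jP (maxn j k) (leq_maxl _ _).
    split; first exact: entire_Sbeta.
    change (qform (weight x N) (g + v - fE)%R < +oo)%E.
    apply: (le_lt_trans (qformB (entire_Sbeta _) (entire_Sbeta _) (is_weight_weight _ _ _ _ _))).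
    apply: lte_add_pinfty; apply: lte_mul_pinfty => //; last by have [] := fb x N nx.
    apply: (le_lt_trans (qform_excess n.+1%:R x N (g + v) ltr01)).
    rewrite mul1e lte_add_pinfty//; first by rewrite (le_lt_trans gvn)// ltry.
    by apply: dominated_fin; exact: dominated_excess.
  have [q2 Bq] := k0P k (leq_maxl _ _) q qs.
  have qle : (qform (weight q.1 q.2) (g + v - fE)%R <= (ep k)%:E)%E.
    apply: (@le_trans _ _ (1%:E * qform (weight (B k) k) (g + v - fE)%R)%E).
      apply: qform_le; [exact: entire_Sbeta|exact: is_weight_weight|exact: is_weight_weight|exact: ler01|move=> z].
      by rewrite mul1r; exact: weight_mono.
    by rewrite mul1e; exact: (fat k (g + v)).
  rewrite -(ltr_pXn2r (_ : 0 < 2)%N) ?nnegrE ?sqrtr_ge0 ?(ltW e0)//.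
  rewrite -lte_fin -qform_normH; last by rewrite (le_lt_trans qle)// ltry.
  by rewrite (le_lt_trans qle)// lte_fin.
apply: filterS FG4 => x G4x.
rewrite -(subrKC fE x); apply: WA.
rewrite (_ : x - fE = (x - g) + (- v) + (g + v - fE)); last first.
  by rewrite -addrA [- v + _]addrA [- v + _]addrC addrK addrA subrK.
apply: sum3 => //; first exact: G4P.
by rewrite -scaleN1r; apply: (ind_baseB bW4) => //; rewrite normrN1.
Qed.

End cauchy_filter.

Theorem Sbeta_complete : complete_space E.
Proof. by move=> F FF cF; exact: cauchy_cvg_Sbeta. Qed.

End completeness.

Theorem corollary1 (R : realType) (d : nat) (nrm : vnorm R d) (beta : R)
    (U : set 'rV[R]_d) (beta_ge0 : 0 <= beta) (beta_lt1 : beta < 1)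
    (openU : open U) (coneU : is_cone U) :
  [/\ hausdorff_space (Sbeta nrm beta U),
      complete_space (Sbeta nrm beta U)
    & forall A : set (Sbeta nrm beta U),
        tvs_bounded A <->
        exists b : R, [/\ 0 < b,
          forall f, A f -> spaceSb nrm beta U b f
        & forall (B : R) (N : nat), b < B ->
            exists M : R, forall f, A f -> normH nrm beta U B N f <= M]].
Proof.
split; [exact: Sbeta_hausdorff|exact: Sbeta_complete|move=> A; split].
  exact: bounded_in_step.
by move=> [b [b0 Ab AM]]; exact: step_bounded Ab AM.
Qed.
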